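(* Let $N>2$ and $R=\mathbb F_2[V_0,V_{N+1}]$. (a) Up to isomorphism, there is a unique $A_\infty$-deformation of $\mathcal A_0$ over $R$ satisfying: - the deformation is bigraded by $\ell$ and $m$, and for each generating element $U_i,s_i\in\mathcal A_0$ the gradings agree with those given for $\mathcal A_0$ in the context; - the deformation has no non-zero operations $\mu_n$ for $2<n<2N$, and has $$\mu_{2N}(U_1,s_1,\dots,U_N,s_N)=V_0,$$ and likewise for each cyclic permutation of $(U_1,s_1,\dots,U_N,s_N)$, and no other non-zero $\mu_{2N}$'s. (b) Up to isomorphism, there is a unique $A_\infty$-deformation of $\mathcal B_0$ over $R$ satisfying: - the deformation is bigraded by $m$ and $A$, and for each generating element $\rho_i,\sigma_i\in\mathcal B_0$ the gradings agree with those given for $\mathcal B_0$ in the context; - the deformation has no non-zero operations $\mu_n$ for $2<n<N$, and has $$\mu_N(\sigma_N,\sigma_{N-1},\dots,\sigma_1)=V_{N+1},$$ and likewise for each cyclic permutation of $(\sigma_N,\dots,\sigma_1)$, and no other non-zero $\mu_N$'s.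
   Context: **Conventions.** Indices of generators are counted mod $N$. An $A_\infty$-algebra over $R$ is an $R$-module with maps $\mu_n$ from its $n$-fold tensor power to itself ($n\ge1$; no $\mu_0$ and no weighted operations) such that for all $n$ and all $a_1,\dots,a_n$ $$\sum_{1\le r\le n}\sum_{k=1}^{n-r+1}\mu_{n-r+1}(a_1,\dots,a_{k-1},\mu_r(a_k,\dots,a_{k+r-1}),a_{k+r},\dots,a_n)=0.$$ An $A_\infty$-deformation of an associative $R$-algebra is an $A_\infty$-algebra over $R$ with the same elements and the same multiplication $\mu_2$, equipped with further (possibly vanishing) operations. Isomorphism means isomorphism of $A_\infty$-algebras. For a nonzero product $a$ of generators, its initial and final idempotents are the unique $I_{j_1},I_{j_2}$ with $I_{j_1}a\neq0$ and $aI_{j_2}\ne0$. The deformations considered are unital in the sense that $\mu_j(a_1,\dots,a_j)=0$ if for some $1<i\le j$ the initial idempotent of $a_i$ is not the same as the final idempotent of $a_{i-1}$. **Gradings.** The Maslov grading $m$ is $\mathbb Z$-valued; the Alexander grading $A$ takes values in $H_0(S^1\smallsetminus\{2N\text{ points}\};\mathbb Z)\cong\mathbb Z^{2N}$ with generators $h_1,\dots,h_{2N}$. If $A(a)=\sum_jk_jh_j$, the length is $\ell(a)=\sum_jk_j$. Operations satisfy $m(\mu_n(a_1,\dots,a_n))=\sum_im(a_i)+n-2$, and $A$ and $\ell$ of $\mu_n(a_1,\dots,a_n)$ are the sums of the corresponding gradings of the inputs. For both algebras, $m(V_0)=2N-2$, $m(V_{N+1})=2$, $A(V_0)=\sum_{j=1}^{2N}h_j$,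 $A(V_{N+1})=\sum_{j=1}^Nh_{2j}$, and $A(I_j)=0$. **$\mathcal A_0$** is the associative $R$-algebra with generators $I_i,U_i,s_i$ ($1\le i\le N$) and multiplication: $I_iI_i=I_i$ and $I_iI_j=0$ for $i\ne j$; $I_jU_i=U_iI_j=U_i$ if $i=j$ and $0$ otherwise; $I_js_i=s_i$ if $i=j$ and $0$ otherwise; $s_iI_j=s_i$ if $i=j-1$ and $0$ otherwise; $U_iU_j=0$ unless $i=j$; $U_is_j=s_jU_i=0$ for all $i,j$; $s_is_j=0$ unless $i=j-1$. Gradings: $m(I_j)=m(U_j)=m(s_j)=0$, $A(U_j)=h_{2j-1}$, $A(s_j)=h_{2j}$ (so $\ell(U_j)=\ell(s_j)=1$). **$\mathcal B_0$** is the associative $R$-algebra with generators $I_j,\rho_j,\sigma_j$ ($1\le j\le N$) and multiplication: $I_iI_i=I_i$ and $I_iI_j=0$ unless $i=j$; $I_i\rho_j=\rho_jI_i=\rho_i$ if $i=j$ and $0$ otherwise; $I_i\sigma_j=\sigma_i$ if $i=j$ and $0$ otherwise; $\sigma_jI_i=\sigma_j$ if $j=i-1$ and $0$ otherwise; $\rho_i\rho_j=0$ and $\sigma_i\sigma_j=0$ for all $i,j$; $\rho_i\sigma_j=0$ unless $i=j$; $\sigma_i\rho_j=0$ unless $i=j-1$. By convention, multiplication in $\mathcal B_0$ is right-to-left, rather than left-to-right as in $\mathcal A_0$. Gradings: $m(\rho_j)=m(\sigma_j)=-1$, $A(\rho_j)=h_{2j-1}$, $A(\sigma_j)=h_{2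j}$.
   Formalization: In (b) the Maslov grading of V_{N+1} is taken to be -2 instead of 2: since m(σ_j) = -1, the operation μ_N(σ_N,…,σ_1) = V_{N+1} has degree -N+N-2 = -2, so with m(V_{N+1}) = 2 no deformation as in (b) exists. *)

(* Defs.v *)
From HB Require Import structures.
From mathcomp Require Import all_boot all_order all_algebra.
From mathcomp Require Import finmap monalg.

Set Implicit Arguments.
Unset Strict Implicit.
Unset Printing Implicit Defensive.

Import GRing.Theory.
Local Open Scope ring_scope.

(* An A_oo-structure on A is a single function mu : seq A -> A, whose          *)
(* restriction to sequences of length n >= 1 is mu_n. There is no mu_0: the    *)
(* value mu [::] is irrelevant and occurs in no condition below. The relations *)
(* are the unsigned ones, appropriate in characteristic 2.                     *)
Section AInfinity.
Variables (R : comNzRingType) (A : lmodType R).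
Implicit Types (mu nu f : seq A -> A).

Definition multilinear f :=
  forall (s t : seq A) (c : R) (x y : A),
    f (s ++ (c *: x + y) :: t) = c *: f (s ++ x :: t) + f (s ++ y :: t).

Definition insertions f mu (a : seq A) : A :=
  \sum_(1 <= r < (size a).+1) \sum_(0 <= k < (size a - r).+1)
    f (take k a ++ mu (take r (drop k a)) :: drop (k + r) a).

Definition ainf_algebra mu :=
  multilinear mu /\ forall a, insertions mu mu a = 0.

Definition ainf_morphism mu nu f :=
  multilinear f /\
  forall a,
    \sum_(1 <= k < (size a).+1)
      \sum_(l : k.-tuple 'I_(size a).+1
            | all (fun i : 'I__ => 0 < i)%N l
              && (sumn (map val l) == size a))
        nu (map f (reshape (map val l) a))
    = insertions f mu a.

Definition ainf_isomorphic mu nu :=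
  exists2 f, ainf_morphism mu nu f & bijective (fun x => f [:: x]).

Definition ainf_deformation (mul : A -> A -> A) mu :=
  ainf_algebra mu /\ forall x y, mu [:: x; y] = mul x y.

End AInfinity.

Definition baseR : comNzRingType := {mpoly 'F_2[2]}.
Definition V0 : baseR := << ucm ord0 >>.
Definition VN1 : baseR := << ucm ord_max >>.

(* Both algebras are spanned over baseR by paths in one quiver, with vertices  *)
(* 'I_N, a loop at each i (letter false: U_i or rho_i) and an arrow            *)
(* i -> i + 1 mod N (letter true: s_i or sigma_i). The 1-based index j of the  *)
(* generators corresponds to the ordinal of value j - 1. The vanishing         *)
(* products of composable generators are encoded by a relation r: a path is    *)
(* nonzero iff any two consecutive letters of its word satisfy r. Thus         *)
(* (i, w) stands for the product of generators spelled by w from vertex i,     *)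
(* and (i, [::]) for I_i.                                                      *)
Section PathAlgebra.
Variables (N : nat) (r : rel bool).

Definition qpath : choiceType := {p : 'I_N * seq bool | sorted r p.2}.
Definition src (p : qpath) : 'I_N := (val p).1.
Definition word (p : qpath) : seq bool := (val p).2.

Definition step (i : 'I_N) (b : bool) : 'I_N := if b then ordS i else i.
Definition tgt (p : qpath) : 'I_N := foldl step (src p) (word p).

Definition idem (i : 'I_N) : qpath := exist _ (i, [::]) isT.
Definition arrow (b : bool) (i : 'I_N) : qpath := exist _ (i, [:: b]) isT.
Definition is_generator (p : qpath) : bool := (size (word p) <= 1)%N.

Definition qalg := {malg baseR[qpath]}.
End PathAlgebra.

(* elt and qmul are locked because conversion tests that fail may otherwise    *)
(* unfold << _ *g _ >> at great length.                                        *)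
HB.lock Definition elt (N : nat) (r : rel bool) (p : qpath N r) : qalg N r :=
  << (1 : baseR) *g p >>.
Arguments elt {N r} p.

Arguments is_generator {N r} p.

Section PathProduct.
Variables (N : nat) (r : rel bool).
Notation qpath := (qpath N r).
Notation qalg := (qalg N r).

Definition path_mul (p q : qpath) : qalg :=
  if tgt p == src q then
    oapp elt 0 (insub (src p, word p ++ word q) : option qpath)
  else 0.

End PathProduct.

HB.lock Definition qmul (N : nat) (r : rel bool) (x y : qalg N r) : qalg N r :=
  \sum_(p <- msupp x) \sum_(q <- msupp y) (x@_p * y@_q) *: path_mul p q.
Arguments qmul {N r} x y.

Section GradingsOperations.
Variables (N : nat) (r : rel bool).
Notation qpath := (qpath N r).
Notation qalg := (qalg N r).
Notation idem := (@idem N r).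

Section Gradings.
(* v 0 and v 1 are the degrees of V_0 and V_{N+1}, and g b i is the degree of  *)
(* the arrow b at i; the idempotents have degree 0.                            *)
Variables (G : zmodType) (v : 'I_2 -> G) (g : bool -> 'I_N -> G).

Fixpoint word_deg (i : 'I_N) (w : seq bool) : G :=
  if w is b :: w' then g b i + word_deg (step i b) w' else 0.

Definition term_deg (m : 'X_{1..2}) (p : qpath) : G :=
  \sum_(e < 2) v e *+ m e + word_deg (src p) (word p).

Definition homogeneous (d : G) (x : qalg) :=
  forall p m, (x@_p)@_m != 0 -> term_deg m p = d.

Definition graded (shift : nat -> G) (mu : seq qalg -> qalg) :=
  forall (a : seq qalg) (d : seq G), (0 < size a)%N -> size d = size a ->
    (forall i, (i < size a)%N -> homogeneous d`_i a`_i) ->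
    homogeneous (\sum_(x <- d) x + shift (size a)) (mu a).
End Gradings.

Section Operations.
Variables (mul : qalg -> qalg -> qalg) (mu : seq qalg -> qalg).

Definition initial_idem (p : qpath) (i : 'I_N) := mul (elt (idem i)) (elt p) != 0.
Definition final_idem (p : qpath) (i : 'I_N) := mul (elt p) (elt (idem i)) != 0.

Definition idem_unital :=
  forall (s t : seq qpath) (p q : qpath) (i j : 'I_N),
    final_idem p i -> initial_idem q j -> i != j ->
    mu (map elt (s ++ p :: q :: t)) = 0.

(* On tuples of generators, the operation of arity size w takes the value c    *)
(* on the rotations of w and vanishes otherwise. A value c in the base ring    *)
(* stands for c I_i, where I_i is the initial idempotent of the first input.   *)
(* The vanishing can be imposed on generators only: for instance, the          *)
(* A_oo-relation on (U_1, U_1, s_1, ..., U_N, s_N) forces                      *)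
(* mu_{2N}(U_1^2, s_1, ..., U_N, s_N) <> 0.                                    *)
Definition cyclic_values (w : seq qpath) (c : baseR) :=
  (forall k p t i, rot k w = p :: t -> initial_idem p i ->
     mu (map elt (p :: t)) = c *: elt (idem i)) /\
  (forall u : seq qpath, size u = size w -> all is_generator u ->
     (forall k, u != rot k w) -> mu (map elt u) = 0).
End Operations.

End GradingsOperations.

Section PathAlgebraTheory.
Variables (N : nat) (r : rel bool).
Implicit Types (p q : qpath N r) (x y z : qalg N r) (i j : 'I_N) (b c : bool).

Lemma msupp_elt p : msupp (elt p) = [fset p]%fset.
Proof. by rewrite elt.unlock msuppU oner_eq0. Qed.

Lemma mcoeff_elt p q : (elt p)@_q = (p == q)%:R.
Proof. rewrite elt.unlock; exact: mcoeffU. Qed.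

Lemma elt_neq0 p : elt p != 0.
Proof. by rewrite elt.unlock monalgU_eq0 oner_neq0. Qed.

Lemma qmulEw (d1 d2 : {fset qpath N r}) x y :
  (msupp x `<=` d1)%fset -> (msupp y `<=` d2)%fset ->
  qmul x y = \sum_(p <- d1) \sum_(q <- d2) (x@_p * y@_q) *: path_mul p q.
Proof.
move=> h1 h2; rewrite qmul.unlock (big_fset_incl _ h1) /=; last first.
  move=> p _ /mcoeff_outdom ->; rewrite big1 // => q _.
  by rewrite mul0r scale0r.
apply: eq_bigr => p _; rewrite (big_fset_incl _ h2) //= => q _ /mcoeff_outdom ->.
by rewrite mulr0 scale0r.
Qed.

Lemma qmul_sing x y p q : msupp x = [fset p]%fset -> msupp y = [fset q]%fset ->
  qmul x y = (x@_p * y@_q) *: path_mul p q.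
Proof. by rewrite qmul.unlock => -> ->; rewrite !big_seq_fset1. Qed.

Lemma qmul_elt p q : qmul (elt p) (elt q) = path_mul p q.
Proof.
rewrite (qmul_sing (msupp_elt p) (msupp_elt q)).
by rewrite (mcoeff_elt p p) (mcoeff_elt q q) !eqxx mul1r scale1r.
Qed.

Lemma qmul_linearl y a x x' : qmul (a *: x + x') y = a *: qmul x y + qmul x' y.
Proof.
pose d := (msupp (a *: x + x') `|` msupp x `|` msupp x')%fset.
have s1 : (msupp (a *: x + x') `<=` d)%fset by rewrite /d -fsetUA fsubsetUl.
have s2 : (msupp x `<=` d)%fset by rewrite /d fsetUAC fsubsetUr.
have s3 : (msupp x' `<=` d)%fset by rewrite /d fsubsetUr.
have sy := fsubset_refl (msupp y).
rewrite (qmulEw s1 sy) (qmulEw s2 sy) (qmulEw s3 sy) scaler_sumr -big_split /=.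
apply: eq_bigr => p _; rewrite scaler_sumr -big_split /=; apply: eq_bigr => q _.
by rewrite mcoeffD mcoeffZ mulrDl scalerDl scalerA mulrA.
Qed.

Lemma qmul_linearr x a y y' : qmul x (a *: y + y') = a *: qmul x y + qmul x y'.
Proof.
pose d := (msupp (a *: y + y') `|` msupp y `|` msupp y')%fset.
have s1 : (msupp (a *: y + y') `<=` d)%fset by rewrite /d -fsetUA fsubsetUl.
have s2 : (msupp y `<=` d)%fset by rewrite /d fsetUAC fsubsetUr.
have s3 : (msupp y' `<=` d)%fset by rewrite /d fsubsetUr.
have sx := fsubset_refl (msupp x).
rewrite (qmulEw sx s1) (qmulEw sx s2) (qmulEw sx s3) scaler_sumr -big_split /=.
apply: eq_bigr => p _; rewrite scaler_sumr -big_split /=; apply: eq_bigr => q _.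
by rewrite mcoeffD mcoeffZ mulrDr scalerDl scalerA mulrCA.
Qed.

HB.instance Definition _ x :=
  GRing.isLinear.Build baseR (qalg N r) (qalg N r) *:%R (qmul x)
    (fun a => @qmul_linearr x a).

Lemma qmul0r x : qmul 0 x = 0.
Proof. by rewrite qmul.unlock msupp0 big_seq_fset0. Qed.

Lemma qmulr0 x : qmul x 0 = 0.
Proof. exact: raddf0. Qed.

Lemma qalgE x : x = \sum_(p <- msupp x) x@_p *: elt p.
Proof.
apply/malgP => q; rewrite {1}[x]monalgE !raddf_sum /=.
apply: eq_bigr => p _; move: (x@_p) => c.
by rewrite mcoeffU mcoeffZ mcoeff_elt mulr_natr.
Qed.

Lemma qalg_ind (P : qalg N r -> Prop) :
  P 0 -> (forall a p x, P x -> P (a *: elt p + x)) -> forall x, P x.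
Proof.
move=> P0 PS x; rewrite [x]qalgE; elim/big_rec: _ => // p y _; exact: PS.
Qed.

Lemma path_mulP p q (s : qpath N r) :
  tgt p = src q -> val s = (src p, word p ++ word q) -> path_mul p q = elt s.
Proof. by move=> /eqP e vs; rewrite /path_mul e -vs valK. Qed.

Lemma path_mul0 p q :
  ~~ ((tgt p == src q) && sorted r (word p ++ word q)) -> path_mul p q = 0.
Proof. by rewrite /path_mul; case: eqP => //= _ H; rewrite insubF //; apply/negbTE. Qed.

Lemma path_mul_some p q : tgt p == src q -> sorted r (word p ++ word q) ->
  exists2 s, path_mul p q = elt s &
    [/\ src s = src p, word s = word p ++ word q & tgt s = tgt q].
Proof.
move=> e so; exists (exist _ (src p, word p ++ word q) so).
  by apply: path_mulP => //; apply/eqP.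
by split => //; rewrite /tgt /= foldl_cat /= -/(tgt p) (eqP e).
Qed.

Lemma sorted_catl w w' : sorted r (w ++ w') -> sorted r w.
Proof. by case: w => //= b w; rewrite cat_path => /andP[]. Qed.
Lemma sorted_catr w w' : sorted r (w ++ w') -> sorted r w'.
Proof.
case: w => //= b w; rewrite cat_path => /andP[_].
by case: w' => //= c w' /andP[].
Qed.

Lemma path_mulA p q s :
  qmul (path_mul p q) (elt s) = qmul (elt p) (path_mul q s).
Proof.
case/boolP: ((tgt p == src q) && (tgt q == src s)
              && sorted r (word p ++ word q ++ word s)) => [|H].
  move=> /andP[/andP[e1 e2] so].
  have [|t -> [t1 t2 t3]] := path_mul_some e1.
    by apply: sorted_catl; rewrite -catA; exact: so.
  have [u -> [u1 u2 u3]] := path_mul_some e2 (sorted_catr so).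
  rewrite !qmul_elt; have [||v -> [v1 v2 v3]] := @path_mul_some t s.
  - by rewrite t3.
  - by rewrite t2 -catA.
  symmetry; apply: path_mulP; first by rewrite u1; apply/eqP.
  by rewrite u2 catA -t2 -v2 -t1 -v1 /src /word; case: (val v).
transitivity (0 : qalg N r).
  case/boolP: ((tgt p == src q) && sorted r (word p ++ word q)) => H1.
    case/andP: (H1) => e1 so1; have [t -> [t1 t2 t3]] := path_mul_some e1 so1.
    rewrite qmul_elt path_mul0 // t3 t2 -catA.
    by apply: contra H => /andP[-> ->]; rewrite e1.
  by rewrite path_mul0 // qmul0r.
case/boolP: ((tgt q == src s) && sorted r (word q ++ word s)) => H1.
  case/andP: (H1) => e1 so1; have [t -> [t1 t2 t3]] := path_mul_some e1 so1.
  rewrite qmul_elt path_mul0 // t1 t2.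
  by apply: contra H => /andP[-> ->]; rewrite e1.
by rewrite (path_mul0 H1) qmulr0.
Qed.

Lemma qmulA : associative (@qmul N r).
Proof.
have H1 p q z : qmul (elt p) (qmul (elt q) z) = qmul (qmul (elt p) (elt q)) z.
  elim/qalg_ind: z => [|c s z IH]; first by rewrite !qmulr0.
  rewrite (qmul_linearr (elt q) c (elt s) z).
  rewrite (qmul_linearr (elt p) c (qmul (elt q) (elt s)) (qmul (elt q) z)).
  rewrite (qmul_linearr (qmul (elt p) (elt q)) c (elt s) z) IH.
  by rewrite (qmul_elt p q) path_mulA (qmul_elt q s).
have H2 p y z : qmul (elt p) (qmul y z) = qmul (qmul (elt p) y) z.
  elim/qalg_ind: y => [|b q y IH]; first by rewrite qmul0r !qmulr0 qmul0r.
  rewrite (qmul_linearl z b (elt q) y) (qmul_linearr (elt p) b (elt q) y).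
  rewrite (qmul_linearr (elt p) b (qmul (elt q) z) (qmul y z)).
  rewrite (qmul_linearl z b (qmul (elt p) (elt q)) (qmul (elt p) y)).
  by rewrite IH H1.
move=> x y z; elim/qalg_ind: x => [|a p x IH]; first by rewrite !qmul0r.
rewrite (qmul_linearl (qmul y z) a (elt p) x) (qmul_linearl y a (elt p) x).
by rewrite (qmul_linearl z a (qmul (elt p) y) (qmul x y)) IH H2.
Qed.

Lemma idem_mul p i : qmul (elt (idem r i)) (elt p) = if i == src p then elt p else 0.
Proof.
rewrite qmul_elt; case: eqP => [e|ne].
  apply: path_mulP => //; rewrite [src (idem r i)]/= [word (idem r i)]/= cat0s e.
  by rewrite /src /word; case: (val p).
by apply: path_mul0; rewrite /tgt /=; case: eqP.
Qed.

Lemma mul_idem p i : qmul (elt p) (elt (idem r i)) = if tgt p == i then elt p else 0.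
Proof.
rewrite qmul_elt; case: eqP => [e|ne].
  apply: path_mulP => //; rewrite [word (idem r i)]/= cats0 /src /word.
  by case: (val p).
by apply: path_mul0; rewrite /src /=; case: eqP.
Qed.

Lemma arrow_mul b c i j : qmul (elt (arrow r b i)) (elt (arrow r c j)) != 0
  = (step i b == j) && r b c.
Proof.
rewrite qmul_elt; case/boolP: (_ && _) => [/andP[e rbc]|H].
  have [|s -> _] := @path_mul_some (arrow r b i) (arrow r c j) e; first by rewrite /= rbc.
  exact: elt_neq0.
by rewrite path_mul0 ?eqxx //= andbT.
Qed.

Lemma arrow_cons b i (w : seq bool) (so : sorted r (b :: w)) (so' : sorted r w) :
  elt (exist _ (i, b :: w) so : qpath N r)
  = qmul (elt (arrow r b i)) (elt (exist _ (step i b, w) so' : qpath N r)).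
Proof. by rewrite qmul_elt; symmetry; apply: path_mulP. Qed.

End PathAlgebraTheory.

Definition maslov_shift (n : nat) : int := n%:Z - 2.

(* h N j is the generator h_j, for 1 <= j <= 2N. *)
Definition h (N j : nat) : 'rV[int]_(2 * N) :=
  \row_(k < 2 * N) (k.+1 == j)%:R.

Definition alexV (N : nat) (e : 'I_2) : 'rV[int]_(2 * N) :=
  if e == ord0 then \sum_(1 <= j < (2 * N).+1) h N j
  else \sum_(1 <= j < N.+1) h N (2 * j).

Definition alex_arrow (N : nat) (b : bool) (i : 'I_N) : 'rV[int]_(2 * N) :=
  if b then h N (2 * i.+1) else h N (2 * i.+1 - 1).

Definition len (n : nat) (a : 'rV[int]_n) : int := \sum_(j < n) a 0 j.

(* A_0: equal letters only, i.e. U_i s_j = s_j U_i = 0. *)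
Definition A0 (N : nat) := qalg N (fun b c => b == c).
Definition A0_mul (N : nat) : A0 N -> A0 N -> A0 N := @qmul N _.

Definition A0_maslovV (N : nat) (e : 'I_2) : int :=
  if e == ord0 then (2 * N)%:Z - 2 else 2.

Definition A0_word (N : nat) : seq (qpath N (fun b c => b == c)) :=
  flatten [seq [:: arrow _ false i; arrow _ true i] | i <- enum 'I_N].

Definition A0_deformation (N : nat) (mu : seq (A0 N) -> A0 N) :=
  [/\ ainf_deformation (@A0_mul N) mu,
      idem_unital (@A0_mul N) mu,
      graded (fun e => len (alexV N e)) (fun b i => len (alex_arrow b i))
        (fun=> 0) mu
      /\ graded (A0_maslovV N) (fun _ _ => 0) maslov_shift mu,
      forall a, (2 < size a < 2 * N)%N -> mu a = 0
    & cyclic_values (@A0_mul N) mu (A0_word N) V0].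

(* B_0: alternating letters only, i.e. rho_i rho_j = sigma_i sigma_j = 0.      *)
(* Products are read from right to left, so mu_2(x, y) is the path y x.        *)
Definition B0 (N : nat) := qalg N (fun b c => b != c).
Definition B0_mul (N : nat) (x y : B0 N) : B0 N := qmul y x.

(* On this side m(V_{N+1}) is -2, not 2 as for A_0: with m(sigma_j) = -1, the  *)
(* operation mu_N(sigma_N, ..., sigma_1) = V_{N+1} has degree                  *)
(* N * (-1) + N - 2 = -2, so no graded deformation exists for another value.   *)
Definition B0_maslovV (N : nat) (e : 'I_2) : int :=
  if e == ord0 then (2 * N)%:Z - 2 else - 2.

Definition B0_word (N : nat) : seq (qpath N (fun b c => b != c)) :=
  rev [seq arrow _ true i | i <- enum 'I_N].

Definition B0_deformation (N : nat) (mu : seq (B0 N) -> B0 N) :=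
  [/\ ainf_deformation (@B0_mul N) mu,
      idem_unital (@B0_mul N) mu,
      graded (B0_maslovV N) (fun _ _ => - 1) maslov_shift mu
      /\ graded (alexV N) (@alex_arrow N) (fun=> 0) mu,
      forall a, (2 < size a < N)%N -> mu a = 0
    & cyclic_values (@B0_mul N) mu (B0_word N) VN1].

(* Main.v *)
From HB Require Import structures.
Require Import Defs.
From mathcomp Require Import all_boot all_order all_algebra.
From mathcomp Require Import finmap monalg.
From mathcomp Require Import zify ring.

(** Both algebras are path algebras of one quiver with quadratic monomial
   relations, and both are deformed by the same obstruction argument.

   A path algebra with quadratic monomial relations is Koszul: its Hochschild
   complex retracts onto the cochains on Koszul tuples, the composable tuples of
   letters (arrows of the quiver) whose successive products vanish.  The form of
   this fact used here is [hoch_homotopy]: a homogeneous cocycle that vanishes on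
   Koszul tuples is the coboundary of an explicit cochain, read off a discrete
   Morse matching [up] of the bar complex.

   The [A_oo]-relations, and the equations for an [A_oo]-morphism between two
   solutions, are solved one arity at a time.  In characteristic 2 the first
   relation that fails, and the first morphism equation that fails, define
   Hochschild cocycles ([hoch_obstruction], [hoch_defect]), and correcting the
   operation or the morphism in that arity changes them by any prescribed
   coboundary ([ins_correct], [defect_correct]).  Everything is therefore decided
   on Koszul tuples ([deformation_exists], [deformation_unique]), and there the
   gradings leave no room.

   Suppose that the value on a Koszul tuple of [s] letters contains a path of
   length [P] with coefficient [V_0^a V_{N+1}^b].  For [A_0], the length gives
   [2Na + Nb + P = s].  The Maslov grading gives [(2N-2)a + 2b = s - 2] for an
   operation, or for the defect of a morphism, so that [2a + (N-2)b + P = 2] and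
   [s <= 2N].  For the obstruction to an operation it gives [s - 3] instead; the
   deformation is built with coefficients in [F_2[V_0]], so that [b = 0],
   [2a + P = 3] and [s <= 2N+1].  For [B_0], a Koszul tuple repeats the same kind
   of letter, whereas a path alternates between the two kinds; the Alexander and
   Maslov gradings then leave only [a = 0], [b = 1] and [s = N] for operations,
   [s = N+1] for obstructions.

   So nothing can survive beyond the arity [2N], respectively [N], of the
   prescribed operation.  In that arity two deformations agree on Koszul tuples
   by hypothesis.  Conversely, the obstruction to the next relation is on Koszul
   tuples the coboundary of the prescribed values, that is, the sum of two outer
   faces.  Every letter of a Koszul tuple determines its neighbours, so either
   both faces are rotations of the prescribed tuple, and they cancel, or none is
   ([seed_cocycle]).

   Two points precede this argument for an arbitrary deformation: [mu_1] vanishes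
   for degree reasons, and the values of the operations have the sources and
   targets of their inputs, by the relations on a tuple extended by an idempotent
   ([typed_ainf]). *)


Set Implicit Arguments.
Unset Strict Implicit.
Unset Printing Implicit Defensive.

Import GRing.Theory.
Local Open Scope ring_scope.

(** * Sums over the ways to cut a list *)

Fixpoint splits (T : Type) (a : seq T) : seq (seq T * seq T) :=
  if a is x :: a' then ([::], a) :: [seq (x :: s.1, s.2) | s <- splits a']
  else [:: ([::], [::])].

Lemma splits_map (T T' : Type) (f : T -> T') a :
  splits (map f a) = [seq (map f s.1, map f s.2) | s <- splits a].
Proof. by elim: a => //= x a ->; rewrite -!map_comp. Qed.

Section SplitSums.
Variables (T : Type) (V : nmodType).
Implicit Types (a u v : seq T) (F G : seq T -> seq T -> V).

Lemma big_splits_nil F : \sum_(s <- splits [::]) F s.1 s.2 = F [::] [::].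
Proof. by rewrite big_seq1. Qed.

Lemma big_splits_cons F x a : \sum_(s <- splits (x :: a)) F s.1 s.2 =
  F [::] (x :: a) + \sum_(s <- splits a) F (x :: s.1) s.2.
Proof. by rewrite big_cons big_map. Qed.

Lemma eq_big_splits F G a :
  (forall u v, u ++ v = a -> F u v = G u v) ->
  \sum_(s <- splits a) F s.1 s.2 = \sum_(s <- splits a) G s.1 s.2.
Proof.
elim: a F G => [|x a IH] F G e; first by rewrite !big_splits_nil e.
rewrite !big_splits_cons e //; congr (_ + _).
by apply: (IH (fun u => F (x :: u)) (fun u => G (x :: u))) => u v euv; apply: e; rewrite -euv.
Qed.

(** Both sides sum over all [u ++ v ++ w = a]. *)
Lemma splits_coassoc (F : seq T -> seq T -> seq T -> V) a :
  \sum_(s <- splits a) \sum_(t <- splits s.1) F t.1 t.2 s.2 =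
  \sum_(s <- splits a) \sum_(t <- splits s.2) F s.1 t.1 t.2.
Proof.
elim: a F => [|x a IH] F; first by rewrite /= !big_seq1 /= ?big_seq1.
rewrite (big_splits_cons (fun u v => \sum_(t <- splits u) F t.1 t.2 v)).
rewrite (big_splits_cons (fun u v => \sum_(t <- splits v) F u t.1 t.2)).
rewrite /= big_seq1 /= (big_splits_cons (F [::])) -addrA; congr (_ + _).
rewrite -(IH (fun u => F (x :: u))) -big_split /=; apply: eq_bigr => s _.
exact: (big_splits_cons (fun u v => F u v s.2)).
Qed.

Lemma big_splits_plug F u y v :
  \sum_(s <- splits (u ++ y :: v)) F s.1 s.2 =
  \sum_(s <- splits u) F s.1 (s.2 ++ y :: v) +
  \sum_(s <- splits v) F (u ++ y :: s.1) s.2.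
Proof.
elim: u F => [|x u IH] F; first by rewrite /= [in RHS]big_seq1 big_cons big_map.
rewrite [LHS](big_splits_cons F x) (big_splits_cons (fun b c => F b (c ++ y :: v))).
by rewrite (IH (fun u => F (x :: u))) addrA.
Qed.

Lemma big_splits_head F a :
  (forall x u v, x :: u ++ v = a -> F (x :: u) v = 0) ->
  \sum_(s <- splits a) F s.1 s.2 = F [::] a.
Proof.
case: a => [|x a] F0; first by rewrite big_seq1.
rewrite big_splits_cons (eq_big_splits (F := fun u => F (x :: u)) (G := fun _ _ => 0)).
  by rewrite big1 ?addr0.
by move=> u v euv; apply: F0; rewrite euv.
Qed.

Lemma big_splits_last F a :
  (forall u y v, u ++ y :: v = a -> F u (y :: v) = 0) ->
  \sum_(s <- splits a) F s.1 s.2 = F a [::].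
Proof.
elim: a F => [|x a IH] F F0; first by rewrite big_seq1.
rewrite big_splits_cons (F0 [::]) // add0r (IH (fun u => F (x :: u))) // => u y v e.
by apply: F0; rewrite -e.
Qed.

Lemma big_splits_last1 F x a :
  (forall u v, u ++ v = x :: a -> size v != 1%N -> F u v = 0) ->
  \sum_(s <- splits (x :: a)) F s.1 s.2 = F (belast x a) [:: last x a].
Proof.
elim: a x F => [|y a IH] x F F0.
  by rewrite big_splits_cons big_seq1 /= [F [:: x] _]F0 ?addr0.
rewrite big_splits_cons F0 // add0r (IH y (fun u => F (x :: u))) //= => u v e.
by apply: F0; rewrite -e.
Qed.

Lemma big_splits0 F a : (forall u v, u ++ v = a -> F u v = 0) ->
  \sum_(s <- splits a) F s.1 s.2 = 0.
Proof. by move=> F0; rewrite (eq_big_splits (G := fun _ _ => 0)) ?big1. Qed.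

(** Both sides sum over all [a = u1 ++ u2 ++ y ++ v1 ++ v2]: a piece [z] is
   chosen together with a piece [y] inside it. *)
Lemma splits_nested (F : seq T -> seq T -> seq T -> seq T -> seq T -> V) a :
  \sum_(s <- splits a) \sum_(t <- splits s.2)
    \sum_(p <- splits s.1) \sum_(q <- splits t.2) F p.1 p.2 t.1 q.1 q.2 =
  \sum_(s <- splits a) \sum_(t <- splits s.2)
    \sum_(p <- splits t.1) \sum_(q <- splits p.2) F s.1 p.1 q.1 q.2 t.2.
Proof.
transitivity (\sum_(s <- splits a) \sum_(p <- splits s.1) \sum_(t <- splits s.2)
    \sum_(q <- splits t.2) F p.1 p.2 t.1 q.1 q.2).
  by apply: eq_bigr => s _; rewrite exchange_big.
rewrite (splits_coassoc (fun u1 u2 w => \sum_(t <- splits w) \sum_(q <- splits t.2)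
   F u1 u2 t.1 q.1 q.2)).
apply: eq_bigr => s _.
rewrite (splits_coassoc (fun u2 z' v2 => \sum_(q <- splits z') F s.1 u2 q.1 q.2 v2)).
apply: eq_bigr => t _.
by rewrite -(splits_coassoc (fun y v1 v2 => F s.1 t.1 y v1 v2)).
Qed.

End SplitSums.

(** * Multilinear maps and their compositions *)

Section Composition.
Variables (K : comNzRingType) (A : lmodType K).
Implicit Types (f g h : seq A -> A) (a u v : seq A) (x y : A).

Lemma multilinearD f u x y v : multilinear f ->
  f (u ++ (x + y) :: v) = f (u ++ x :: v) + f (u ++ y :: v).
Proof. by move=> fL; rewrite -[x]scale1r fL !scale1r. Qed.

Lemma multilinear0 f u v : multilinear f -> f (u ++ 0 :: v) = 0.
Proof.
move=> fL; apply: (addrI (f (u ++ 0 :: v))).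
by rewrite -multilinearD // !addr0.
Qed.

Lemma multilinearZ f u c x v : multilinear f ->
  f (u ++ (c *: x) :: v) = c *: f (u ++ x :: v).
Proof. by move=> fL; rewrite -[c *: x]addr0 fL multilinear0 // addr0. Qed.

Lemma multilinear_sum f u v I (r : seq I) (F : I -> A) : multilinear f ->
  f (u ++ (\sum_(i <- r) F i) :: v) = \sum_(i <- r) f (u ++ F i :: v).
Proof.
move=> fL; elim: r => [|i r IH]; first by rewrite !big_nil multilinear0.
by rewrite !big_cons multilinearD // IH.
Qed.

Lemma multilinear_cons f x : multilinear f -> multilinear (fun a => f (x :: a)).
Proof. by move=> fL u v; apply: (fL (x :: u)). Qed.

Lemma multilinear_add f g : multilinear f -> multilinear g ->
  multilinear (fun a => f a + g a).
Proof. by move=> fL gL u v c x y; rewrite fL gL scalerDr addrACA. Qed.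

Definition restrict_size n f a := if size a == n then f a else 0.

Lemma multilinear_restrict n f : multilinear f -> multilinear (restrict_size n f).
Proof.
move=> fL u v c x y; rewrite /restrict_size !size_cat /=.
by case: ifP => _; rewrite ?fL // scaler0 addr0.
Qed.

(** The composition of the pre-Lie structure on cochains.  [g] is also applied to
   empty pieces, so that the cuts are those of [splits]; operations are normalized
   to vanish there. *)
Definition ins f g a :=
  \sum_(s <- splits a) \sum_(t <- splits s.2) f (s.1 ++ g t.1 :: t.2).

Lemma eq_ins f f' g g' a :
  (forall u z v, u ++ z ++ v = a -> f (u ++ g z :: v) = f' (u ++ g' z :: v)) ->
  ins f g a = ins f' g' a.
Proof.
move=> e; apply: (eq_big_splits (F := fun u w => \sum_(t <- splits w) f (u ++ g t.1 :: t.2))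
  (G := fun u w => \sum_(t <- splits w) f' (u ++ g' t.1 :: t.2))) => u w euw.
apply: (eq_big_splits (F := fun z v => f (u ++ g z :: v))
  (G := fun z v => f' (u ++ g' z :: v))) => z v ezv.
by apply: e; rewrite ezv.
Qed.

Lemma ins0 f g a : (forall u z v, u ++ z ++ v = a -> f (u ++ g z :: v) = 0) ->
  ins f g a = 0.
Proof.
move=> e; rewrite (eq_ins (f' := fun _ => 0) (g' := g)) // /ins.
by rewrite big1 // => s _; rewrite big1.
Qed.

Lemma ins_addl f f' g a : ins (fun b => f b + f' b) g a = ins f g a + ins f' g a.
Proof. by rewrite -big_split; apply: eq_bigr => s _; rewrite -big_split. Qed.

Lemma ins_addr f g g' a : multilinear f ->
  ins f (fun b => g b + g' b) a = ins f g a + ins f g' a.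
Proof.
move=> fL; rewrite -big_split; apply: eq_bigr => s _; rewrite -big_split.
by apply: eq_bigr => t _; rewrite multilinearD.
Qed.

Lemma ins_cons f g x a : ins f g (x :: a) =
  \sum_(t <- splits (x :: a)) f (g t.1 :: t.2) + ins (fun b => f (x :: b)) g a.
Proof.
exact: (big_splits_cons (fun u w => \sum_(t <- splits w) f (u ++ g t.1 :: t.2))).
Qed.

Lemma ins_plug f g u y v : ins f g (u ++ y :: v) =
  \sum_(s <- splits u) \sum_(t <- splits s.2) f (s.1 ++ g t.1 :: t.2 ++ y :: v) +
  \sum_(s <- splits v) \sum_(t <- splits s.2) f (u ++ y :: s.1 ++ g t.1 :: t.2) +
  \sum_(s <- splits u) \sum_(t <- splits v) f (s.1 ++ g (s.2 ++ y :: t.1) :: t.2).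
Proof.
rewrite /ins (big_splits_plug (fun b w => \sum_(t <- splits w) f (b ++ g t.1 :: t.2))).
rewrite [RHS]addrAC; congr (_ + _).
  rewrite -big_split; apply: eq_bigr => s _.
  exact: (big_splits_plug (fun b w => f (s.1 ++ g b :: w))).
by apply: eq_bigr => s _; apply: eq_bigr => t _; rewrite -catA.
Qed.

Lemma multilinear_ins f g : multilinear f -> multilinear g -> multilinear (ins f g).
Proof.
move=> fL gL u v c x y; rewrite !ins_plug !scalerDr !scaler_sumr addrACA.
congr (_ + _); first rewrite addrACA; first congr (_ + _).
- rewrite -big_split; apply: eq_bigr => s _; rewrite scaler_sumr -big_split.
  by apply: eq_bigr => t _; rewrite -!cat_cons !catA fL.
- rewrite -big_split; apply: eq_bigr => s _; rewrite scaler_sumr -big_split.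
  by apply: eq_bigr => t _; rewrite fL.
- rewrite -big_split; apply: eq_bigr => s _; rewrite scaler_sumr -big_split.
  by apply: eq_bigr => t _; rewrite gL fL.
Qed.

(** Insertions of [g] and, further to the right, of [h]. *)
Definition ins2 f g h a :=
  \sum_(s <- splits a) \sum_(t <- splits s.2) \sum_(p <- splits t.2)
    \sum_(q <- splits p.2) f (s.1 ++ g t.1 :: p.1 ++ h q.1 :: q.2).

(** The pre-Lie identity: inserting twice, the second insertion is either inside
   the first one or disjoint from it. *)
Lemma ins_ins f g h a : multilinear f ->
  ins (ins f g) h a = ins f (ins g h) a + (ins2 f g h a + ins2 f h g a).
Proof.
move=> fL; rewrite addrC; rewrite {1}/ins.
under eq_bigr => s _ do under eq_bigr => t _ do rewrite ins_plug.
under eq_bigr => s _ do rewrite 2!big_split.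
rewrite 2!big_split; congr (_ + _ + _).
- transitivity (\sum_(s <- splits a) \sum_(p <- splits s.1) \sum_(t <- splits s.2)
     \sum_(q <- splits p.2) f (p.1 ++ g q.1 :: q.2 ++ h t.1 :: t.2)).
    by apply: eq_bigr => s _; rewrite exchange_big.
  rewrite (splits_coassoc (fun b c w => \sum_(t <- splits w)
     \sum_(q <- splits c) f (b ++ g q.1 :: q.2 ++ h t.1 :: t.2))).
  apply: eq_bigr => s _.
  rewrite -(splits_coassoc (fun b c w => \sum_(q <- splits w)
     f (s.1 ++ g b :: c ++ h q.1 :: q.2))).
  by apply: eq_bigr => t _; rewrite exchange_big.
- rewrite (splits_nested (fun b c d e w => f (b ++ g (c ++ h d :: e) :: w))).
  rewrite /ins; apply: eq_bigr => s _; apply: eq_bigr => t _.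
  rewrite multilinear_sum //; apply: eq_bigr => p _.
  by rewrite multilinear_sum //; apply: eq_bigr.
Qed.

End Composition.

(** * The Hochschild differential *)

Section Hochschild.
Variables (K : comNzRingType) (A : lmodType K) (mul : A -> A -> A).
Hypothesis mul_linl : forall z c x y, mul (c *: x + y) z = c *: mul x z + mul y z.
Hypothesis mul_linr : forall z c x y, mul z (c *: x + y) = c *: mul z x + mul z y.
Implicit Types (f g h X Y : seq A -> A) (a u v : seq A) (x y : A).

Definition mu2 a : A := if a is [:: x; y] then mul x y else 0.

Lemma mu2_size a : size a != 2 -> mu2 a = 0.
Proof. by case: a => [|x [|y [|z a]]]. Qed.

Lemma bilinear0r x : mul x 0 = 0.
Proof. by have := mul_linr x (-1) 0 0; rewrite scaler0 addr0 scaleN1r addNr. Qed.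

Lemma bilinear0l x : mul 0 x = 0.
Proof. by have := mul_linl x (-1) 0 0; rewrite scaler0 addr0 scaleN1r addNr. Qed.

Lemma multilinear_mu2 : multilinear mu2.
Proof.
move=> u v c x y; case: u => [|z [|z' u]].
- by case: v => [|t [|t' v]] /=; rewrite ?scaler0 ?addr0 ?mul_linl.
- by case: v => [|t v] /=; rewrite ?scaler0 ?addr0 ?mul_linr.
by rewrite !mu2_size ?scaler0 ?addr0 //= !size_cat /= !addnS.
Qed.

(** The faces of a tuple are split asymmetrically: [hochr] gathers the inner ones
   and the last one, so as to recurse on the list. *)
Fixpoint hochr Y a : A :=
  if a is x :: a' then
    if a' is y :: a'' then Y (mul x y :: a'') + hochr (fun b => Y (x :: b)) a'
    else mul (Y [::]) x
  else 0.

Definition hoch Y a : A := (if a is x :: a' then mul x (Y a') else 0) + hochr Y a.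

Lemma hochr_cons2 Y x y a :
  hochr Y [:: x, y & a] = Y (mul x y :: a) + hochr (fun b => Y (x :: b)) (y :: a).
Proof. by []. Qed.

Lemma hochrE Y x a : multilinear Y ->
  hochr Y (x :: a) = ins Y mu2 (x :: a) + mul (Y (belast x a)) (last x a).
Proof.
elim: a x Y => [|y a IH] x Y YL.
  rewrite ins_cons big_cons big_seq1 /= !(multilinear0 [::]) //.
  rewrite ins0 ?add0r // => u z v; case: u => //; case: z => // _.
  exact: (multilinear0 [:: x]).
rewrite hochr_cons2 (IH _ _ (multilinear_cons x YL)) [in RHS]ins_cons addrA; congr (_ + _ + _).
rewrite !big_cons big_map big_map /= !(multilinear0 [::]) // !add0r.
rewrite (big_splits_head (F := fun b c => Y (mu2 [:: x, y & b] :: c))) // => z b c _.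
exact: (multilinear0 [::]).
Qed.

Lemma ins_mu2 Y x a : a != [::] ->
  ins mu2 Y (x :: a) = mul x (Y a) + mul (Y (belast x a)) (last x a).
Proof.
move=> a0; rewrite ins_cons addrC; congr (_ + _).
  rewrite /ins (big_splits_head (F := fun u w => \sum_(t <- splits w)
     mu2 (x :: u ++ Y t.1 :: t.2))).
    rewrite (big_splits_last (F := fun u w => mu2 [:: x, Y u & w])) //.
  move=> y u v _; rewrite big1 // => s _.
  by rewrite mu2_size //= size_cat addnS.
rewrite (big_splits_last1 (F := fun u w => mu2 (Y u :: w))) // => u v e sv.
by rewrite mu2_size.
Qed.

(** The differential as a commutator with the product, so that the pre-Lie
   identity applies to it. *)
Lemma hoch_ins Y a : multilinear Y -> (1 < size a)%N ->
  hoch Y a = ins Y mu2 a + ins mu2 Y a.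
Proof.
move=> YL; case: a => [|x [|y a]] // _; rewrite /hoch hochrE // ins_mu2 //.
by rewrite addrCA.
Qed.

Lemma hochD Y Y' a : hoch (fun b => Y b + Y' b) a = hoch Y a + hoch Y' a.
Proof.
have mulD x y z : mul x (y + z) = mul x y + mul x z.
  by have := mul_linr x 1 y z; rewrite !scale1r.
have Dmul x y z : mul (x + y) z = mul x z + mul y z.
  by have := mul_linl z 1 x y; rewrite !scale1r.
rewrite addrACA; congr (_ + _); first by case: a; rewrite ?addr0.
elim: a Y Y' => [|x [|y a] IH] Y Y'; first by rewrite addr0.
  by rewrite /= Dmul.
by rewrite !hochr_cons2 IH addrACA.
Qed.

Lemma eq_hoch Y Y' a : (forall b, size b = (size a).-1 -> Y b = Y' b) ->
  hoch Y a = hoch Y' a.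
Proof.
case: a => [|x a] //= e; congr (_ + _); first by rewrite e.
elim: a x Y Y' e => [|y a IH] x Y Y' e /=; first by rewrite e.
rewrite e //; congr (_ + _).
by apply: (IH y (fun b => Y (x :: b)) (fun b => Y' (x :: b))) => b eb; rewrite e //= eb.
Qed.

Hypothesis mulA : associative mul.
Hypothesis char2 : forall x : A, x + x = 0.

Lemma ins_mu2_mu2 a : ins mu2 mu2 a = 0.
Proof.
case: (eqVneq (size a) 3) => [|na].
  case: a => [|x [|y [|z [|? ?]]]] // _.
  by rewrite ins_mu2 //= mulA char2.
apply: ins0 => u z v e; case: (eqVneq (size z) 2) => sz.
  by rewrite mu2_size // size_cat /=; move: na; rewrite -e !size_cat sz; lia.
by rewrite (mu2_size sz) (multilinear0 _ _ multilinear_mu2).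
Qed.

(** In characteristic 2 the disjoint double insertions cancel in pairs. *)
Lemma ins_insC f g a : multilinear f ->
  ins (ins f g) g a = ins f (ins g g) a.
Proof. by move=> fL; rewrite ins_ins // char2 addr0. Qed.

Lemma hoch_hoch Y a : multilinear Y -> (2 < size a)%N -> hoch (hoch Y) a = 0.
Proof.
move=> YL sa.
pose Z b := ins Y mu2 b + ins mu2 Y b.
have m2L := multilinear_mu2.
have ZL : multilinear Z by apply: multilinear_add; apply: multilinear_ins.
rewrite (eq_hoch (Y' := Z)); last by move=> b sb; rewrite hoch_ins //; lia.
rewrite hoch_ins // /Z; last by lia.
rewrite ins_addl ins_addr // ins_insC // (ins_ins Y mu2 a m2L).
have z0 : ins Y (ins mu2 mu2) a = 0.
  by apply: ins0 => u z v _; rewrite ins_mu2_mu2 multilinear0.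
have e0 : ins (ins mu2 mu2) Y a = 0 by apply: ins0 => u z v _; apply: ins_mu2_mu2.
rewrite z0 (ins_ins mu2 Y a m2L) in e0 *.
rewrite add0r addrACA char2 add0r addrC -[RHS]e0; congr (_ + _); exact: addrC.
Qed.

End Hochschild.

(** * Decompositions of a list into consecutive nonempty blocks *)

Fixpoint blocks (T : Type) (a : seq T) : seq (seq (seq T)) :=
  if a is x :: a' then
    [seq [:: x] :: b | b <- blocks a'] ++
    flatten [seq (if b is c :: b' then [:: (x :: c) :: b'] else [::]) | b <- blocks a']
  else [:: [::]].

Lemma mem_blocks (T : eqType) (a : seq T) b :
  b \in blocks a -> flatten b = a /\ [::] \notin b.
Proof.
elim: a b => [|x a IH] b /=; first by rewrite inE => /eqP ->.
rewrite mem_cat => /orP[/mapP[c /IH[<- c0] ->] //|/flatten_mapP[c /IH[<- c0]]].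
by case: c c0 => // d c c0; rewrite !inE => /eqP ->; move: c0; rewrite !inE => /norP[].
Qed.

Section BlockSums.
Variables (T : Type) (V : nmodType).
Implicit Types (a u v : seq T) (G : seq (seq T) -> V).

Lemma big_blocks_nil G : \sum_(b <- blocks [::]) G b = G [::].
Proof. by rewrite big_seq1. Qed.

Lemma big_blocks_cons G x a : \sum_(b <- blocks (x :: a)) G b =
  \sum_(s <- splits a) \sum_(b <- blocks s.2) G ((x :: s.1) :: b).
Proof.
elim: a x G => [|y a IH] x G; first by rewrite /= !big_seq1 /= ?big_seq1.
pose G' b := if b is c :: b' then G ((x :: c) :: b') else 0.
rewrite (big_splits_cons (fun u v => \sum_(b <- blocks v) G ((x :: u) :: b))).
rewrite -(IH y G') [blocks (x :: _)]/= -/(blocks (y :: a)) big_cat big_map; congr (_ + _).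
rewrite big_flatten big_map; apply: eq_bigr => -[|c b] _; last exact: big_seq1.
by rewrite big_nil.
Qed.

Lemma big_blocks_splits (G : seq (seq T) -> seq (seq T) -> V) a :
  \sum_(b <- blocks a) \sum_(s <- splits b) G s.1 s.2 =
  \sum_(s <- splits a) \sum_(c <- blocks s.1) \sum_(d <- blocks s.2) G c d.
Proof.
have [n] := ubnP (size a); elim: n a G => // n IH [|x a] G.
  by rewrite /= !big_seq1 /= ?big_seq1 /= ?big_seq1.
rewrite ltnS /= => san.
rewrite (big_blocks_cons (fun b => \sum_(s <- splits b) G s.1 s.2)).
transitivity (\sum_(s <- splits a) (\sum_(b <- blocks s.2) G [::] ((x :: s.1) :: b) +
    \sum_(b <- blocks s.2) \sum_(t <- splits b) G ((x :: s.1) :: t.1) t.2)).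
  apply: eq_bigr => s _; rewrite -big_split; apply: eq_bigr => b _.
  exact: big_splits_cons.
rewrite big_split /= (big_splits_cons (fun u v => \sum_(c <- blocks u)
  \sum_(d <- blocks v) G c d)) /= big_blocks_nil (big_blocks_cons (G [::])); congr (_ + _).
transitivity (\sum_(s <- splits a) \sum_(p <- splits s.2) \sum_(c <- blocks p.1)
    \sum_(d <- blocks p.2) G ((x :: s.1) :: c) d).
  apply: (eq_big_splits (F := fun u v => \sum_(b <- blocks v)
      \sum_(t <- splits b) G ((x :: u) :: t.1) t.2)
    (G := fun u v => \sum_(p <- splits v) \sum_(c <- blocks p.1)
      \sum_(d <- blocks p.2) G ((x :: u) :: c) d)) => u v euv.
  rewrite (IH v (fun c d => G ((x :: u) :: c) d)) //.
  by apply: leq_trans san; rewrite -euv size_cat ltnS leq_addl.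
rewrite -(splits_coassoc (fun u v w => \sum_(c <- blocks v)
    \sum_(d <- blocks w) G ((x :: u) :: c) d)).
apply: eq_bigr => s _; rewrite (big_blocks_cons (fun c => \sum_(d <- blocks s.2) G c d)).
by [].
Qed.

Lemma big_blocks_plug G u y v : \sum_(b <- blocks (u ++ y :: v)) G b =
  \sum_(s <- splits u) \sum_(t <- splits v) \sum_(c <- blocks s.1)
    \sum_(d <- blocks t.2) G (c ++ (s.2 ++ y :: t.1) :: d).
Proof.
have [n] := ubnP (size u); elim: n u G => // n IH [|x u] G.
  rewrite [splits [::]]/= big_seq1 => _; rewrite [LHS](big_blocks_cons G).
  by apply: eq_bigr => s _; rewrite /= big_seq1.
rewrite ltnS /= => sun; rewrite big_blocks_cons.
rewrite (big_splits_plug (fun b c => \sum_(d <- blocks c) G ((x :: b) :: d))).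
rewrite (big_splits_cons (fun b c => \sum_(t <- splits v) \sum_(e <- blocks b)
    \sum_(d <- blocks t.2) G (e ++ (c ++ y :: t.1) :: d))) [LHS]addrC; congr (_ + _).
  by apply: eq_bigr => t _; rewrite /= big_seq1.
transitivity (\sum_(s <- splits u) \sum_(p <- splits s.2) \sum_(t <- splits v)
  \sum_(c <- blocks p.1) \sum_(d <- blocks t.2)
    G (((x :: s.1) :: c) ++ (p.2 ++ y :: t.1) :: d)).
  apply: (eq_big_splits (F := fun b w => \sum_(d <- blocks (w ++ y :: v))
      G ((x :: b) :: d))
    (G := fun b w => \sum_(p <- splits w) \sum_(t <- splits v) \sum_(c <- blocks p.1)
      \sum_(d <- blocks t.2) G (((x :: b) :: c) ++ (p.2 ++ y :: t.1) :: d)))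
    => b w ebw.
  rewrite (IH w (fun e => G ((x :: b) :: e))) //.
  by apply: leq_trans sun; rewrite -ebw size_cat ltnS leq_addl.
rewrite -(splits_coassoc (fun b c e => \sum_(t <- splits v) \sum_(f <- blocks c)
    \sum_(d <- blocks t.2) G (((x :: b) :: f) ++ (e ++ y :: t.1) :: d))).
apply: eq_bigr => s _; rewrite exchange_big; apply: eq_bigr => t _.
by rewrite (big_blocks_cons (fun c => \sum_(d <- blocks t.2)
  G (c ++ (s.2 ++ y :: t.1) :: d))).
Qed.

Lemma big_blocks_size1 G x a : (forall b, size b != 1%N -> G b = 0) ->
  \sum_(b <- blocks (x :: a)) G b = G [:: x :: a].
Proof.
move=> G0; rewrite big_blocks_cons.
rewrite (big_splits_last (F := fun u v => \sum_(b <- blocks v) G ((x :: u) :: b))).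
  by rewrite big_blocks_nil.
move=> u y v _; rewrite big_blocks_cons big1 // => s _.
by rewrite big1 // => b _; rewrite G0.
Qed.

End BlockSums.

Section Star.
Variables (K : comNzRingType) (A : lmodType K) (mul : A -> A -> A).
Hypothesis mul_linl : forall z c x y, mul (c *: x + y) z = c *: mul x z + mul y z.
Hypothesis mul_linr : forall z c x y, mul z (c *: x + y) = c *: mul z x + mul z y.
Hypothesis char2 : forall x : A, x + x = 0.
Notation mu2 := (mu2 mul).
Notation hoch := (hoch mul).
Implicit Types (f g h X Y nu mu : seq A -> A) (a u v : seq A) (x y : A).

(** The composite of [g] with the coalgebra morphism of the bar construction that [f]
   induces. *)
Definition star g f a := \sum_(b <- blocks a) g (map f b).

Lemma star_cons g f x a : star g f (x :: a) =
  \sum_(s <- splits a) star (fun b => g (f (x :: s.1) :: b)) f s.2.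
Proof. exact: (big_blocks_cons (fun b => g (map f b))). Qed.

Lemma star_addl g g' f a : star (fun b => g b + g' b) f a = star g f a + star g' f a.
Proof. exact: big_split. Qed.

Lemma star_plug g f u y v : star g f (u ++ y :: v) =
  \sum_(s <- splits u) \sum_(t <- splits v) \sum_(c <- blocks s.1)
    \sum_(d <- blocks t.2) g (map f c ++ f (s.2 ++ y :: t.1) :: map f d).
Proof.
rewrite /star (big_blocks_plug (fun b => g (map f b))).
do 2![apply: eq_bigr => ? _]; apply: eq_bigr => c _; apply: eq_bigr => d _.
by rewrite map_cat.
Qed.

Lemma multilinear_star g f : multilinear g -> multilinear f -> multilinear (star g f).
Proof.
move=> gL fL u v c x y; rewrite !star_plug scaler_sumr -big_split.
apply: eq_bigr => s _; rewrite scaler_sumr -big_split.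
apply: eq_bigr => t _; rewrite scaler_sumr -big_split.
apply: eq_bigr => b _; rewrite scaler_sumr -big_split.
by apply: eq_bigr => d _; rewrite fL gL.
Qed.

Definition unary a : A := if a is [:: x] then x else 0.

Lemma multilinear_unary : multilinear unary.
Proof.
move=> [|z u] [|t v] c x y //=; rewrite ?scaler0 ?addr0 //.
  by case: u => [|? ?]; rewrite /= scaler0 addr0.
by case: u => [|? ?]; rewrite /= scaler0 addr0.
Qed.

Lemma star_unary g a : multilinear g -> star g unary a = g a.
Proof.
elim: a g => [|x a IH] g gL; first by rewrite /star big_blocks_nil.
rewrite star_cons (big_splits_head (F := fun u v =>
  star (fun b => g (unary (x :: u) :: b)) unary v)) /=.
  by rewrite (IH (fun b => g (x :: b))) //; apply: multilinear_cons.
by move=> y u v _; rewrite /star big1 // => b _; apply: (multilinear0 [::]).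
Qed.

(** The sum of all terms obtained from [star nu f] by replacing one value of [f]
   with a value of [X]. *)
Definition star_ins nu f X a :=
  \sum_(s <- splits a) \sum_(t <- splits s.2) \sum_(c <- blocks s.1)
    \sum_(d <- blocks t.2) nu (map f c ++ X t.1 :: map f d).

Lemma star_ins_add nu f X Y a : multilinear nu ->
  star_ins nu f (fun b => X b + Y b) a = star_ins nu f X a + star_ins nu f Y a.
Proof.
move=> nuL; rewrite -big_split; apply: eq_bigr => s _; rewrite -big_split.
apply: eq_bigr => t _; rewrite -big_split; apply: eq_bigr => c _; rewrite -big_split.
by apply: eq_bigr => d _; rewrite multilinearD.
Qed.

(** With [star_ins_star]: composing a morphism with the operations of its source
   or of its target replaces one of its values. *)
Lemma ins_star nu f mu a : multilinear nu ->
  ins (star nu f) mu a = star_ins nu f (ins f mu) a.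
Proof.
move=> nuL; rewrite /ins.
under eq_bigr => s _ do under eq_bigr => t _ do rewrite star_plug.
rewrite (splits_nested (fun u1 u2 x v1 v2 : seq A => \sum_(c <- blocks u1)
   \sum_(d <- blocks v2) nu (map f c ++ f (u2 ++ mu x :: v1) :: map f d))).
apply: eq_bigr => s _; apply: eq_bigr => t _.
under eq_bigr => p _ do rewrite exchange_big /=.
rewrite exchange_big; apply: eq_bigr => c _.
under eq_bigr => p _ do rewrite exchange_big /=.
rewrite exchange_big; apply: eq_bigr => d _.
rewrite multilinear_sum //; apply: eq_bigr => p _.
by rewrite multilinear_sum.
Qed.

Lemma star_ins_star nu f a : multilinear nu ->
  star (ins nu nu) f a = star_ins nu f (star nu f) a.
Proof.
move=> nuL; rewrite /star /ins.
transitivity (\sum_(b <- blocks a) \sum_(s <- splits b) \sum_(t <- splits s.2)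
   nu (map f s.1 ++ nu (map f t.1) :: map f t.2)).
  apply: eq_bigr => b _; rewrite splits_map big_map; apply: eq_bigr => s _.
  by rewrite splits_map big_map.
rewrite (big_blocks_splits (fun c r : seq (seq A) => \sum_(t <- splits r)
   nu (map f c ++ nu (map f t.1) :: map f t.2))).
apply: eq_bigr => s _.
under eq_bigr => c _ do rewrite (big_blocks_splits (fun e d : seq (seq A) =>
   nu (map f c ++ nu (map f e) :: map f d))).
rewrite exchange_big; apply: eq_bigr => t _; apply: eq_bigr => c _.
rewrite exchange_big; apply: eq_bigr => d _.
by rewrite multilinear_sum.
Qed.

(** * Obstruction theory *)

Definition extends_mul X :=
  [/\ multilinear X, forall a, (size a < 2)%N -> X a = 0
    & forall x y, X [:: x; y] = mul x y].

Lemma extends_mul2 X a : extends_mul X -> (size a <= 2)%N -> X a = mu2 a.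
Proof.
case=> XL X1 X2; case: a => [|x [|y [|z a]]] // _; first exact: X1.
  exact: X1.
Qed.

(** In the lowest arity where [Y] is nonzero, composing [Y] with [X] on either
   side only involves the product. *)
Lemma eq_ins_mu2r Y X a n : extends_mul X -> multilinear Y ->
  (forall b, (size b <= n)%N -> Y b = 0) -> (size a <= n.+2)%N ->
  ins Y X a = ins Y mu2 a.
Proof.
move=> XE YL Y0 sa; apply: eq_ins => u z v e.
case: (leqP (size z) 2) => sz; first by rewrite (extends_mul2 XE).
by rewrite !Y0 // size_cat /=; move: sa; rewrite -e !size_cat; lia.
Qed.

Lemma eq_ins_mu2l Y X a n : extends_mul X ->
  (forall b, (size b <= n)%N -> Y b = 0) -> (size a <= n.+2)%N ->
  ins X Y a = ins mu2 Y a.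
Proof.
move=> XE Y0 sa; have [XL _ _] := XE; have m2L := multilinear_mu2 mul_linl mul_linr.
apply: eq_ins => u z v e; case: (leqP (size z) n) => sz.
  by rewrite Y0 // !multilinear0.
rewrite (extends_mul2 XE) // size_cat /=; move: sa; rewrite -e !size_cat; lia.
Qed.

(** Bianchi identity: [ins (ins X X) X = ins X (ins X X)], whose lowest part is the
   cocycle condition. *)
Lemma hoch_obstruction X a n : extends_mul X ->
  (forall b, (size b <= n)%N -> ins X X b = 0) -> size a = n.+2 ->
  hoch (ins X X) a = 0.
Proof.
move=> XE O0 sa; have [XL _ _] := XE.
have OL : multilinear (ins X X) by apply: multilinear_ins.
have m2L := multilinear_mu2 mul_linl mul_linr.
rewrite (hoch_ins mul OL) ?sa //.
rewrite -(eq_ins_mu2r XE OL O0) ?sa // -(eq_ins_mu2l XE O0) ?sa //.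
by rewrite ins_insC // char2.
Qed.

(** In arity at most [n.+1] the new operation [Y] can only be composed with the
   product. *)
Lemma ins_correct X Y n a : extends_mul X -> multilinear Y -> (2 < n)%N ->
  (forall b, size b != n -> Y b = 0) -> (size a <= n.+1)%N ->
  ins (fun b => X b + Y b) (fun b => X b + Y b) a =
  ins X X a + (if size a == n.+1 then hoch Y a else 0).
Proof.
move=> XE YL n2 Y0 sa; have [XL _ _] := XE.
have XYL : multilinear (fun b => X b + Y b) by apply: multilinear_add.
have m2L := multilinear_mu2 mul_linl mul_linr.
have Y0' b : (size b <= n.-1)%N -> Y b = 0 by move=> sb; apply: Y0; lia.
rewrite ins_addr // !ins_addl -!addrA; congr (_ + _).
have -> : ins Y Y a = 0.
  apply: ins0 => u z v e; case: (eqVneq (size z) n) => sz; last first.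
    by rewrite (Y0 z) // multilinear0.
  by rewrite Y0 // size_cat /=; move: sa; rewrite -e !size_cat; lia.
rewrite addr0 (eq_ins_mu2l XE Y0') ?(eq_ins_mu2r XE YL Y0'); try by lia.
case: eqP => [san|/eqP san]; first by rewrite (hoch_ins mul YL) // san; lia.
rewrite !ins0 ?addr0 // => u z v e.
  case: (eqVneq (size z) n) => sz; last by rewrite Y0 // multilinear0.
  by rewrite mu2_size // size_cat /=; move: sa san; rewrite -e !size_cat; lia.
case: (eqVneq (size z) 2) => sz; last by rewrite mu2_size // multilinear0.
by rewrite Y0 // size_cat /=; move: sa san; rewrite -e !size_cat; lia.
Qed.

(** The defect of [f] as an [A_oo]-morphism from [mu] to [nu]. *)
Definition defect mu nu f a := star nu f a + ins f mu a.

Lemma multilinear_defect mu nu f : multilinear mu -> multilinear nu ->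
  multilinear f -> multilinear (defect mu nu f).
Proof.
move=> muL nuL fL; apply: multilinear_add; first exact: multilinear_star.
exact: multilinear_ins.
Qed.

Definition extends_id f :=
  [/\ multilinear f, f [::] = 0 & forall x, f [:: x] = x].

(** The analogue of [hoch_obstruction]: applying the operations of the target to
   the defect agrees with applying the defect after those of the source, because
   [mu] and [nu] square to zero. *)
Lemma hoch_defect mu nu f a n : extends_mul mu -> extends_mul nu -> extends_id f ->
  (forall b, ins mu mu b = 0) -> (forall b, ins nu nu b = 0) ->
  (forall b, (size b <= n)%N -> defect mu nu f b = 0) -> size a = n.+2 ->
  hoch (defect mu nu f) a = 0.
Proof.
move=> muE nuE [fL f0 f1] mumu nunu E0 sa.
have [muL _ _] := muE; have [nuL nu1 nu2] := nuE.
have EL := multilinear_defect muL nuL fL.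
have m2L := multilinear_mu2 mul_linl mul_linr.
rewrite (hoch_ins mul EL) ?sa //.
rewrite -(eq_ins_mu2r muE EL E0) ?sa //.
have -> : ins mu2 (defect mu nu f) a = star_ins nu f (defect mu nu f) a.
  apply: (eq_big_splits (F := fun u w => \sum_(t <- splits w)
      mu2 (u ++ defect mu nu f t.1 :: t.2))
    (G := fun u w => \sum_(t <- splits w) \sum_(c <- blocks u)
    \sum_(d <- blocks t.2) nu (map f c ++ defect mu nu f t.1 :: map f d))) => u w euw.
  apply: (eq_big_splits (F := fun z v => mu2 (u ++ defect mu nu f z :: v))
    (G := fun z v => \sum_(c <- blocks u)
    \sum_(d <- blocks v) nu (map f c ++ defect mu nu f z :: map f d))) => z v ezv.
  case: (leqP (size z) n) => sz.
    rewrite E0 // multilinear0 // big1 // => c _; rewrite big1 // => d _.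
    by rewrite multilinear0.
  have: (size u + size v <= 1)%N.
    by move: sa; rewrite -euw -ezv !size_cat; lia.
  case: u {euw} => [|x [|? ?]] //; case: v {ezv} => [|y [|? ?]] //= _.
  - by rewrite !big_seq1 /= nu1.
  - by rewrite !big_seq1 /= nu2 f1.
  - by rewrite !big_seq1 /= nu2 f1.
have -> : ins (defect mu nu f) mu a = star_ins nu f (ins f mu) a.
  rewrite /defect ins_addl ins_insC // ins_star // [ins f _ a]ins0 ?addr0 // => u z v _.
  by rewrite mumu multilinear0.
rewrite [X in _ + X]star_ins_add // addrCA char2 addr0 -star_ins_star //.
by rewrite /star big1.
Qed.

Lemma star_mu2 f x a : f [::] = 0 ->
  star mu2 f (x :: a) = \sum_(s <- splits (x :: a)) mul (f s.1) (f s.2).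
Proof.
move=> f0; rewrite star_cons (big_splits_cons (fun u v => mul (f u) (f v))) f0.
rewrite (bilinear0l mul_linl) add0r; apply: eq_bigr => s _.
case: s.2 => [|y v]; first by rewrite /star big_seq1 /= f0 (bilinear0r mul_linr).
rewrite /star (big_blocks_size1 (G := fun b => mu2 (f (x :: s.1) :: map f b))) //.
by move=> b sb; rewrite mu2_size //= size_map.
Qed.

Lemma size_flatten_neq0 (T : eqType) (b : seq (seq T)) : [::] \notin b ->
  (size b <= size (flatten b))%N.
Proof.
elim: b => //= -[//|x e] b IH; rewrite inE negb_or size_cat /= => /IH.
by move=> H; rewrite addSn ltnS (leq_trans H) // leq_addl.
Qed.

Lemma size_block (T : eqType) (a c : seq T) b :
  b \in blocks a -> c \in b -> (size c + size b <= (size a).+1)%N.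
Proof.
move=> /mem_blocks[<- b0] cb; elim: b b0 cb => // d b IH.
rewrite [in X in X -> _]inE negb_or => /andP[d0 b0].
have d1 : (0 < size d)%N by case: d d0.
rewrite inE /= size_cat => /orP[/eqP ->|/(IH b0)] => [|H].
  by rewrite addnS ltnS leq_add2l size_flatten_neq0.
by rewrite addnS ltnS (leq_trans H) // -add1n leq_add2r.
Qed.

(** The analogue of [ins_correct]: in arity at most [n.+1], at most one block is fed
   to [Y], and then the remaining operations are products. *)
Lemma defect_correct mu nu f Y n a : extends_mul mu -> extends_mul nu -> extends_id f ->
  multilinear Y -> (1 < n)%N ->
  (forall b, size b != n -> Y b = 0) -> (size a <= n.+1)%N ->
  defect mu nu (fun b => f b + Y b) a =
  defect mu nu f a + (if size a == n.+1 then hoch Y a else 0).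
Proof.
move=> muE nuE [fL f0 f1] YL n1 Y0 sa.
have [muL _ _] := muE; have [nuL nu1 nu2] := nuE.
have m2L := multilinear_mu2 mul_linl mul_linr.
have Y0' b : (size b <= n.-1)%N -> Y b = 0 by move=> sb; apply: Y0; lia.
pose nu3 b := if (2 < size b)%N then nu b else 0.
have nuD g b : star nu g b = star mu2 g b + star nu3 g b.
  rewrite -star_addl; apply: eq_bigr => c _; rewrite /nu3.
  case: leqP => sc; last by rewrite mu2_size ?add0r //; lia.
  by rewrite addr0 (extends_mul2 nuE).
rewrite /defect !nuD ins_addl.
have -> : star nu3 (fun b => f b + Y b) a = star nu3 f a.
  apply: eq_big_seq => b ba; rewrite /nu3 !size_map; case: leqP => // sb.
  congr nu; apply/eq_in_map => c /(size_block ba) sc.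
  rewrite Y0 ?addr0 //; apply/eqP => en; move: (leq_trans sc (sa : (size a < n.+2)%N)).
  by rewrite en -[n.+2]addn2 leq_add2l leqNgt sb.
rewrite (eq_ins_mu2r muE YL Y0'); last by lia.
have -> : star mu2 (fun b => f b + Y b) a = star mu2 f a + ins mu2 Y a.
  case: a sa => [|x a] sa.
    by rewrite /star !big_seq1 /= add0r /ins /= big_seq1 /= big_seq1.
  rewrite !star_mu2 // ?f0 ?Y0 ?addr0 //; last by rewrite /=; lia.
  transitivity (\sum_(s <- splits (x :: a)) (mul (f s.1) (f s.2) +
     (mul (f s.1) (Y s.2) + mul (Y s.1) (f s.2)))).
    apply: (eq_big_splits (F := fun u v => mul (f u + Y u) (f v + Y v))
      (G := fun u v => mul (f u) (f v) + (mul (f u) (Y v) + mul (Y u) (f v)))) => u v e.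
    have := mul_linl (f v + Y v) 1 (f u) (Y u); rewrite !scale1r => ->.
    have lr z y t : mul z (y + t) = mul z y + mul z t.
      by have := mul_linr z 1 y t; rewrite !scale1r.
    rewrite !lr -!addrA; congr (_ + (_ + _)).
    case: (eqVneq (size u) n) => su; last by rewrite (Y0 u) // !(bilinear0l mul_linl) addr0.
    rewrite (Y0 v) ?(bilinear0r mul_linr) ?addr0 //.
    by move/(congr1 size): e; rewrite size_cat; lia.
  rewrite big_split; congr (_ + _); rewrite big_split.
  case: (eqVneq a [::]) => [->|a0].
    have Yx u z v : u ++ z ++ v = [:: x] -> Y z = 0.
      by move/(congr1 size); rewrite !size_cat /= => e; apply: Y0; lia.
    rewrite [RHS]ins0 => [|u z v /Yx ->]; last by rewrite multilinear0.
    rewrite (big_splits0 (F := fun u v => mul (f u) (Y v))).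
      rewrite (big_splits0 (F := fun u v => mul (Y u) (f v))) => [|u v e].
        exact: addr0.
      by rewrite (Yx [::] u v) // (bilinear0l mul_linl).
    by move=> u v e; rewrite (Yx u v [::]) ?cats0 // (bilinear0r mul_linr).
  rewrite ins_mu2 //; congr (_ + _).
    rewrite (big_splits_cons (fun u v => mul (f u) (Y v))) f0 (bilinear0l mul_linl) add0r.
    rewrite (big_splits_head (F := fun u v => mul (f (x :: u)) (Y v))) ?f1 // => y u v e.
    rewrite Y0 ?(bilinear0r mul_linr) //.
    by move/(congr1 size): e; move: sa; rewrite /= size_cat; lia.
  rewrite (big_splits_last1 (F := fun u v => mul (Y u) (f v))) ?f1 // => u v e sv.
  case: (eqVneq v [::]) => [->|v0]; first by rewrite f0 (bilinear0r mul_linr).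
  rewrite Y0 ?(bilinear0l mul_linl) //; move/(congr1 size): e; move: sa.
  by move: v0; rewrite -size_eq0 /= size_cat; lia.
rewrite -!addrA; congr (_ + _); rewrite addrCA; congr (_ + _); rewrite addrCA.
congr (_ + _); rewrite addrC.
case: eqP => [san|/eqP san]; first by rewrite (hoch_ins mul YL) // san; lia.
rewrite !ins0 ?addr0 // => u z v e.
  case: (eqVneq (size z) n) => sz; last by rewrite Y0 // multilinear0.
  by rewrite mu2_size // size_cat /=; move: sa san; rewrite -e !size_cat; lia.
case: (eqVneq (size z) 2) => sz; last by rewrite mu2_size // multilinear0.
by rewrite Y0 // size_cat /=; move: sa san; rewrite -e !size_cat; lia.
Qed.

End Star.

(** * Quadratic monomial algebras *)

(** An algebra with a basis closed under products up to zero ([bmul]), in which a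
   basis element of length at least 2 starts with a unique letter, and adjacent
   letters decide whether a product vanishes ([bmul_quadratic]).  Paths form such
   a basis for both orders of composition. *)
Record monomial_algebra (K : comNzRingType) (P : choiceType) := MonomialAlgebra {
  bas : P -> {malg K[P]};
  bprod : {malg K[P]} -> {malg K[P]} -> {malg K[P]};
  bmul : P -> P -> option P;
  lunit : P -> P;
  runit : P -> P;
  blen : P -> nat;
  bhead : P -> P;
  btail : P -> P;
  mcoeff_bas : forall p q, (bas p)@_q = (p == q)%:R;
  bprod_linl : forall z c x y, bprod (c *: x + y) z = c *: bprod x z + bprod y z;
  bprod_linr : forall z c x y, bprod z (c *: x + y) = c *: bprod z x + bprod z y;
  bprodA : associative bprod;
  bprod_bas : forall p q, bprod (bas p) (bas q) = oapp bas 0 (bmul p q);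
  lunit_id : forall p, blen p = 0 -> lunit p = p;
  runit_id : forall p, blen p = 0 -> runit p = p;
  bmul_lunit : forall p, bmul (lunit p) p = Some p;
  bmul_runit : forall p, bmul p (runit p) = Some p;
  bmul_ends : forall p q s, bmul p q = Some s ->
    [/\ runit p = lunit q, lunit s = lunit p & runit s = runit q];
  blen_bmul : forall p q s, bmul p q = Some s -> blen s = (blen p + blen q)%N;
  bmul_head_tail : forall p, (1 < blen p)%N ->
    bmul (bhead p) (btail p) = Some p /\ blen (bhead p) = 1;
  head_tail_bmul : forall p q s, blen p = 1 -> (0 < blen q)%N ->
    bmul p q = Some s -> bhead s = p /\ btail s = q;
  bmul_quadratic : forall r p q s, (0 < blen p)%N -> bmul p q = Some s ->
    isSome (bmul r s) = isSome (bmul r p)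
}.

Arguments bas {K P}.
Arguments bprod {K P}.
Arguments bmul {K P}.
Arguments lunit {K P}.
Arguments runit {K P}.
Arguments blen {K P}.
Arguments bhead {K P}.
Arguments btail {K P}.

Section Monomial.
Variables (K : comNzRingType) (P : choiceType) (B : monomial_algebra K P).
Notation A := {malg K[P]}.
Notation bas := (bas B).
Notation bprod := (bprod B).
Notation bmul := (bmul B).
Notation lunit := (lunit B).
Notation runit := (runit B).
Notation blen := (blen B).
Notation bhead := (bhead B).
Notation btail := (btail B).
Notation mu2 := (mu2 bprod).
Notation hoch := (hoch bprod).
Notation hochr := (hochr bprod).
Implicit Types (f g h X Y E : seq A -> A) (a : seq A) (x y z : A).
Implicit Types (p q s : P) (u v w : seq P).

Let linl := @bprod_linl K P B.
Let linr := @bprod_linr K P B.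

Lemma malg_expand x : x = \sum_(p <- msupp x) x@_p *: bas p.
Proof.
apply/malgP => q; rewrite {1}[x]monalgE !raddf_sum /=.
apply: eq_bigr => p _; move: (x@_p) => c.
by rewrite mcoeffU mcoeffZ mcoeff_bas mulr_natr.
Qed.

Lemma multilinear_expand f (b c : seq A) x : multilinear f ->
  f (b ++ x :: c) = \sum_(p <- msupp x) x@_p *: f (b ++ bas p :: c).
Proof.
move=> fL; rewrite {1}[x]malg_expand multilinear_sum //.
by apply: eq_bigr => p _; rewrite multilinearZ.
Qed.

Lemma bprod_sumr y x :
  bprod y x = \sum_(p <- msupp x) x@_p *: bprod y (bas p).
Proof.
exact: (multilinear_expand [:: y] [::] x (multilinear_mu2 linl linr)).
Qed.

Lemma bprod_suml y x :
  bprod x y = \sum_(p <- msupp x) x@_p *: bprod (bas p) y.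
Proof.
exact: (multilinear_expand [::] [:: y] x (multilinear_mu2 linl linr)).
Qed.

Lemma bprod_runit x i : (forall p, x@_p != 0 -> runit p = i) -> bprod x (bas i) = x.
Proof.
move=> xi; rewrite bprod_suml [RHS]malg_expand; apply: eq_bigr => p _.
have [->|/xi <-] := eqVneq x@_p 0; first by rewrite !scale0r.
by rewrite bprod_bas bmul_runit.
Qed.

Lemma bprod_lunit x i : (forall p, x@_p != 0 -> lunit p = i) -> bprod (bas i) x = x.
Proof.
move=> xi; rewrite bprod_sumr [RHS]malg_expand; apply: eq_bigr => p _.
have [->|/xi <-] := eqVneq x@_p 0; first by rewrite !scale0r.
by rewrite bprod_bas bmul_lunit.
Qed.

Lemma multilinear_eq f g n : multilinear f -> multilinear g ->
  (forall w, size w = n -> f (map bas w) = g (map bas w)) ->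
  forall a, size a = n -> f a = g a.
Proof.
elim: n f g => [|n IH] f g fL gL e [|x a] //= => [_|[sa]]; first exact: (e [::]).
rewrite (multilinear_expand [::] a x fL) (multilinear_expand [::] a x gL).
apply: eq_bigr => p _; congr (_ *: _).
apply: (IH (fun b => f (bas p :: b)) (fun b => g (bas p :: b))) => //.
- exact: multilinear_cons.
- exact: multilinear_cons.
by move=> w sw; apply: (e (p :: w)); rewrite /= sw.
Qed.

Fixpoint mext (phi : seq P -> A) a : A :=
  if a is x :: a' then \sum_(p <- msupp x) x@_p *: mext (fun w => phi (p :: w)) a'
  else phi [::].

Lemma mext_bas phi w : mext phi (map bas w) = phi w.
Proof.
elim: w phi => //= p w IH phi.
rewrite (big_fset_incl _ (B := [fset p]%fset)) /= ?big_seq_fset1.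
- by rewrite mcoeff_bas eqxx scale1r IH.
- apply/fsubsetP => q; rewrite -mcoeff_neq0 mcoeff_bas inE.
  by rewrite [q == p]eq_sym; case: (p == q) => //=; rewrite eqxx.
- by move=> q _; rewrite -mcoeff_neq0 negbK => /eqP ->; rewrite scale0r.
Qed.

Lemma sum_msuppw (F : P -> A) x (d : {fset P}) : (msupp x `<=` d)%fset ->
  \sum_(p <- msupp x) x@_p *: F p = \sum_(p <- d) x@_p *: F p.
Proof.
move=> sd; rewrite (big_fset_incl _ sd) // => q _.
by rewrite -mcoeff_neq0 negbK => /eqP ->; rewrite scale0r.
Qed.

Lemma multilinear_mext phi : multilinear (mext phi).
Proof.
move=> b c k x y; elim: b phi => [|z b IH] phi /=.
  pose d := (msupp (k *: x + y) `|` msupp x `|` msupp y)%fset.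
  have s1 : (msupp (k *: x + y) `<=` d)%fset by rewrite /d -fsetUA fsubsetUl.
  have s2 : (msupp x `<=` d)%fset by rewrite /d fsetUAC fsubsetUr.
  have s3 : (msupp y `<=` d)%fset by rewrite /d fsubsetUr.
  rewrite (sum_msuppw _ s1) (sum_msuppw _ s2) (sum_msuppw _ s3) scaler_sumr -big_split.
  by apply: eq_bigr => p _; rewrite /= mcoeffD mcoeffZ scalerDl scalerA.
rewrite scaler_sumr -big_split; apply: eq_bigr => p _ /=.
by rewrite IH scalerDr !scalerA mulrC.
Qed.

(** Composable tuples running from [i] to [j]; vertices are represented by the
   idempotents of the basis. *)
Fixpoint ends (i j : P) w :=
  if w is p :: w' then (lunit p == i) && ends (runit p) j w' else i == j.

Lemma ends_cat i j u v : ends i j (u ++ v) -> exists2 k, ends i k u & ends k j v.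
Proof.
elim: u i => [|p u IH] i /=; first by exists i.
by case/andP=> -> /IH[k ? ?]; exists k.
Qed.

Lemma cat_ends i j k u v : ends i k u -> ends k j v -> ends i j (u ++ v).
Proof. by elim: u i => [|p u IH] i /=; [move/eqP->|case/andP=> -> /IH H /H]. Qed.

(** * Homogeneous cochains *)

Section Grading.
Variables (G : zmodType) (kdeg : G -> K -> Prop) (deg : P -> G) (e : G).
Hypothesis kdeg0 : forall d, kdeg d 0.
Hypothesis kdeg1 : kdeg 0 1.
Hypothesis kdegD : forall d k k', kdeg d k -> kdeg d k' -> kdeg d (k + k').
Hypothesis kdegM : forall d d' k k', kdeg d k -> kdeg d' k' -> kdeg (d + d') (k * k').
Hypothesis deg_bmul : forall p q s, bmul p q = Some s -> deg s = deg p + deg q.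
Hypothesis deg_unit : forall p, blen p = 0%N -> deg p = 0.

(** The degree of a tuple in the bar construction. *)
Definition degw w : G := \sum_(p <- w) (deg p + e).

(** The condition on the value [x] at [w] of a map that respects sources and
   targets and has degree [(n - c) e] in arity [n]: operations have [c = 2],
   morphisms [c = 1] and obstructions [c = 3]. *)
Definition sits x w (c : int) := forall p,
  kdeg (degw w - e *~ c - deg p) x@_p
  /\ (x@_p != 0 -> ends (lunit p) (runit p) w).

Definition homog c f := forall w, sits (f (map bas w)) w c.

Lemma sits0 w c : sits 0 w c.
Proof. by move=> p; rewrite mcoeff0 eqxx. Qed.

Lemma sitsD x y w c : sits x w c -> sits y w c -> sits (x + y) w c.
Proof.
move=> hx hy p; have [x1 x2] := hx p; have [y1 y2] := hy p.
rewrite mcoeffD; split; first exact: kdegD.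
have [->|/x2 //] := eqVneq x@_p 0; rewrite add0r; exact: y2.
Qed.

Lemma sits_sum I (r : seq I) (F : I -> A) w c : (forall i, sits (F i) w c) ->
  sits (\sum_(i <- r) F i) w c.
Proof.
move=> hF; elim/big_rec: _ => [|i y _ hy]; first exact: sits0.
exact: sitsD (hF i) hy.
Qed.

Lemma sits_splits (F : seq P -> seq P -> A) w v c :
  (forall u1 u2, u1 ++ u2 = w -> sits (F u1 u2) v c) ->
  sits (\sum_(s <- splits w) F s.1 s.2) v c.
Proof.
elim: w F => [|p w IH] F hF; first by rewrite big_splits_nil; apply: hF.
rewrite big_splits_cons; apply: sitsD; first exact: hF.
by apply: (IH (fun u => F (p :: u))) => u1 u2 eu; apply: hF; rewrite -eu.
Qed.

Lemma sits_eq x w w' c c' : degw w - e *~ c = degw w' - e *~ c' ->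
  (forall i j, ends i j w -> ends i j w') -> sits x w c -> sits x w' c'.
Proof. by move=> ed ee hx p; have [x1 x2] := hx p; rewrite -ed; split=> // /x2/ee. Qed.

Lemma sits_bas p : sits (bas p) [:: p] 1.
Proof.
move=> q; rewrite mcoeff_bas /degw big_seq1 mulr1z addrK.
by case: (eqVneq p q) => [<-|_]; rewrite ?subrr ?eqxx /= ?eqxx.
Qed.

Lemma subst_degree (a b q u v c p : G) :
  (a - b - q) + (u + (q + e + v) - c - p) = u + (a + v) - (c + b - e) - p.
Proof.
rewrite !opprD opprK !addrA; congr (_ + _).
by rewrite [LHS](ACl (3*5*4*1*7*8*2*6))/= addNr add0r.
Qed.

(** Homogeneity is stable under composition, one entry at a time. *)
Lemma sits_subst (F : A -> A) u t v c c' y :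
  (forall z, F z = \sum_(q <- msupp z) z@_q *: F (bas q)) ->
  (forall q, sits (F (bas q)) (u ++ q :: v) c) -> sits y t c' ->
  sits (F y) (u ++ t ++ v) (c + c' - 1).
Proof.
move=> FE hF hy; rewrite FE; apply: sits_sum => q p.
have [F1 F2] := hF q p; have [y1 y2] := hy q; rewrite mcoeffZ; split.
  move: (kdegM y1 F1); rewrite /degw !big_cat big_cons /= subst_degree.
  by rewrite mulrzBr mulrzDr mulr1z.
move=> yF; have: y@_q != 0 by apply: contraNneq yF => ->; rewrite mul0r.
move=> /y2 ex; have: (F (bas q))@_p != 0 by apply: contraNneq yF => ->; rewrite mulr0.
move=> /F2 /ends_cat[k eu /= /andP[/eqP lq ev]].
by apply: (cat_ends eu); apply: cat_ends ev; rewrite -lq.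
Qed.

Lemma homog_ins f g c c' : multilinear f -> homog c f -> homog c' g ->
  homog (c + c' - 1) (ins f g).
Proof.
move=> fL hf hg w; rewrite /ins splits_map big_map.
apply: (sits_splits (F := fun u r => \sum_(t <- splits (map bas r))
   f (map bas u ++ g t.1 :: t.2))) => u r eur.
rewrite splits_map big_map.
apply: (sits_splits (F := fun t v => f (map bas u ++ g (map bas t) :: map bas v)))
  => t v etv.
rewrite -eur -etv.
apply: (sits_subst (F := fun y => f (map bas u ++ y :: map bas v))) => //.
  by move=> z; apply: multilinear_expand.
by move=> q; have := hf (u ++ q :: v); rewrite map_cat.
Qed.

Lemma homogD f g c : homog c f -> homog c g -> homog c (fun a => f a + g a).
Proof. by move=> hf hg w; apply: sitsD. Qed.

Lemma homog_restrict n f c : homog c f -> homog c (restrict_size n f).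
Proof.
by move=> hf w; rewrite /restrict_size; case: ifP => _; [apply: hf|apply: sits0].
Qed.

Lemma homog_mext (phi : seq P -> A) c : (forall w, sits (phi w) w c) ->
  homog c (mext phi).
Proof. by move=> hp w; rewrite mext_bas. Qed.

Lemma homog_mu2 : homog 2 mu2.
Proof.
case=> [|p [|q [|r w]]] /=; try exact: sits0.
rewrite bprod_bas; case pq: (bmul p q) => [s|] /=; last exact: sits0.
have [epq ls rs] := bmul_ends pq.
move=> t; rewrite mcoeff_bas; case: (eqVneq s t) => [<-|_] /=; last by rewrite eqxx.
rewrite (deg_bmul pq) ls rs epq !eqxx; split=> //.
have -> : degw [:: p; q] - e *~ 2 - (deg p + deg q) = 0 => //.
rewrite /degw !big_cons big_nil addr0 addrACA -mulr2n -[e *~ 2]/(e *+ 2) addrK.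
exact: subrr.
Qed.

Lemma homog_unary : homog 1 (@unary K A).
Proof.
by case=> [|p [|q w]] /=; [apply: sits0|apply: sits_bas|apply: sits0].
Qed.

Lemma blocks_map (T T' : Type) (F : T -> T') (a : seq T) :
  blocks (map F a) = map (map (map F)) (blocks a).
Proof.
elim: a => //= t a ->; rewrite map_cat -!map_comp map_flatten -!map_comp.
by congr (_ ++ flatten _); apply: eq_map => -[].
Qed.

Lemma homog_star g f c : multilinear g -> homog c g -> homog 1 f ->
  homog c (star g f).
Proof.
move=> gL hg hf w; rewrite /star blocks_map big_map big_seq.
elim/big_rec: _ => [|b y bw hy]; first exact: sits0.
apply: sitsD hy; have [<- _] := mem_blocks bw.
suff: forall u, sits (g (map bas u ++ map f (map (map bas) b))) (u ++ flatten b) c.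
  by move/(_ [::]).
elim: b {bw} => [|t b IH] u /=; first by rewrite !cats0; apply: hg.
rewrite -[c](addrK 1).
apply: (sits_subst (F := fun y => g (map bas u ++ y :: map f (map (map bas) b)))) => //.
  by move=> z; apply: multilinear_expand.
by move=> q; have := IH (rcons u q); rewrite map_rcons !cat_rcons.
Qed.

(** * The contraction of the Hochschild complex *)

Hypothesis char2 : forall x : A, x + x = 0.

Definition mergeable (o : option P) p := if o is Some q then isSome (bmul q p) else false.

Fixpoint odd_units w := if w is p :: w' then (blen p == 0%N) && ~~ odd_units w' else false.

(** Discrete Morse matching on the bar complex.  Reading the tuple from the left,
   skip the letters that multiply to zero with their predecessor; if the next
   entry starts a run of units of odd length, lengthen the run; if it is a path of
   length at least 2 with zero product with its predecessor, split off its first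
   letter.  The tuples on which [up] fails are the values of [up] and the tuples
   of letters with successive products zero. *)
Fixpoint up (o : option P) w : option (seq P) :=
  if w is p :: w' then
    if blen p == 0%N then if odd_units w then Some (p :: w) else None
    else if mergeable o p then None
    else if (1 < blen p)%N then Some [:: bhead p, btail p & w']
    else omap (cons p) (up (Some p) w')
  else None.

Lemma up_cons o p w : up o (p :: w) =
  if blen p == 0%N then if ~~ odd_units w then Some [:: p, p & w] else None
  else if mergeable o p then None
  else if (1 < blen p)%N then Some [:: bhead p, btail p & w]
  else omap (cons p) (up (Some p) w).
Proof. by rewrite /=; case: eqP. Qed.

(* [o] is the letter that precedes the tuple, if any. *)
Fixpoint koszul (o : option P) w := if w is p :: w' then
  [&& blen p == 1%N, ~~ mergeable o p & koszul (Some p) w'] else true.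

Lemma blen_tail p : (1 < blen p)%N -> blen (btail p) = (blen p).-1.
Proof.
by move=> lp; have [/blen_bmul -> ->] := bmul_head_tail lp.
Qed.

Lemma up_split o w v : up o w = Some v ->
  [/\ size v = (size w).+1, degw v = degw w + e & forall i j, ends i j v = ends i j w].
Proof.
elim: w o v => //= q w IH o v.
case: eqP => [lq|/eqP lq].
  rewrite /=; case: ifP => //= _ [<-]; split=> // [|i j] /=.
    by rewrite /degw !big_cons deg_unit // add0r addrC.
  by rewrite runit_id // lunit_id // eqxx.
case: ifP => //= mq; case: ifP => lq'.
  case=> <-; have [qE lh] := bmul_head_tail lq'; have [rl ll rr] := bmul_ends qE.
  split=> // [|i j]; last by rewrite /= -rl eqxx ll rr.
  by rewrite /degw !big_cons (deg_bmul qE) !addrA [RHS](ACl (1*3*2*5*4)).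
case ew: (up _ w) => [v'|] //= [<-]; have [s1 d1 e1] := IH _ _ ew.
split=> [|| i j] /=; rewrite ?s1 ?e1 //.
by rewrite /degw !big_cons -!/(degw _) d1 addrA.
Qed.

Lemma up_up o o' w v : up o w = Some v -> up o' v = None.
Proof.
elim: w o o' v => //= p w IH o o' v; case: eqP => [lp|/eqP lp].
  by case: ifP => //= ow [<-] /=; rewrite lp /= ow.
case: ifP => // mp; case: ifP => lp'.
  case=> <- /=; have [pE lh] := bmul_head_tail lp'.
  rewrite lh /=; case: ifP => // _; rewrite blen_tail //.
  by rewrite pE; case: (blen p) lp' => [|[]].
case ew: (up _ w) => [v'|] //= [<-] /=; rewrite (negbTE lp) lp'.
by case: ifP => // _; rewrite (IH _ _ _ ew).
Qed.

Lemma koszul_up o o' w : koszul o w -> up o' w = None.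
Proof.
elim: w o o' => //= p w IH o o' /and3P[/eqP lp mp kw].
by rewrite lp /=; case: ifP => // _; rewrite (IH _ _ kw).
Qed.

(** The matching is exhaustive.  A tuple on which [up] fails is a value of [up]
   when its first entry that is not a letter with zero product with its
   predecessor is part of a run of units, or can be merged with its predecessor;
   without such an entry the tuple is Koszul. *)
Lemma up_None_letter o i j p w : blen p = 1%N -> ~~ mergeable o p ->
  ends i j (p :: w) -> up o (p :: w) = None ->
  koszul o (p :: w) \/ exists v, up o v = Some (p :: w).
Proof.
elim: w o i p => [|q w IH] o i p lp mp.
  by move=> _ _; left; rewrite /= lp mp.
rewrite /= => /and3P[_ /eqP lq ew]; rewrite lp (negbTE mp) /=.
case: eqP => [q0|/eqP q0].
  case: ifP => //= /negbFE oqw _; right.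
  case: w oqw ew {IH} => //= r w /andP[/eqP r0 ow] /andP[/eqP rl _].
  have qr : q = r by rewrite -(lunit_id r0) rl runit_id.
  by exists [:: p, q & w]; rewrite /= lp (negbTE mp) q0 /= ow qr.
case pq: (bmul p q) => [s|] /=.
  move=> _; right; exists (s :: w) => /=.
  rewrite (blen_bmul pq) lp add1n /=.
  have -> : mergeable o s = false.
    by case: o mp => //= r; rewrite (bmul_quadratic r _ pq) ?lp // => /negbTE.
  rewrite ltnS lt0n q0; have [|-> ->//] := head_tail_bmul lp _ pq.
  by rewrite lt0n.
case: ifP => // lq1; case ew': (up _ w) => [//|] _.
have lq1' : blen q = 1%N by move: q0 lq1; case: (blen q) => [|[]].
have [|||kw|[v vE]] := IH (Some p) (runit p) q lq1'.
- by rewrite /= pq.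
- by rewrite /= lq eqxx.
- by rewrite /= lq1' pq /= ew'.
- by left; move: kw; rewrite /= pq.
- by right; exists (p :: v); rewrite /= lp (negbTE mp) /= vE.
Qed.

Lemma up_None i j w : ends i j w -> up None w = None ->
  koszul None w \/ exists v, up None v = Some w.
Proof.
case: w => [|p w] ew; first by left.
case p0: (blen p == 0%N); last first.
  case p1: (1 < blen p)%N; first by rewrite /= p0 p1.
  apply: up_None_letter ew => //.
  by move: p0 p1; case: (blen p) => [|[]].
rewrite /= p0 /=; case: ifP => // /negbFE ow _; right.
case: w ow ew => //= r w /andP[/eqP r0 ow] /and3P[_ /eqP rl _].
have pr : p = r by rewrite -(lunit_id r0) rl runit_id //; apply/eqP.
by exists (p :: w); rewrite /= p0 ow pr.
Qed.

(** The values of [Y] respect sources and targets. *)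
Definition typed Y := forall w p, (Y (map bas w))@_p != 0 -> ends (lunit p) (runit p) w.

(** As [typed], for tuples with an already consumed prefix ending at [i]. *)
Definition typedr i Y := forall w p, (Y (map bas w))@_p != 0 -> ends i (runit p) w.

Lemma homog_typed c Y : homog c Y -> typed Y.
Proof. by move=> hY w p; have [_] := hY w p. Qed.

Lemma typed_eq0 Y w : typed Y -> (forall i j, ends i j w -> Y (map bas w) = 0) ->
  Y (map bas w) = 0.
Proof.
move=> tY Y0; apply/malgP => p; rewrite mcoeff0; apply/eqP.
by apply: contraT => /[dup] /tY/Y0 -> /negP[]; rewrite mcoeff0.
Qed.

Lemma typed_cons p Y : typed Y -> typedr (runit p) (fun b => Y (bas p :: b)).
Proof. by move=> tY w q /(tY (p :: w)) /=/andP[]. Qed.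

Lemma hochr_bas2 Y p q w : multilinear Y -> hochr Y (map bas [:: p, q & w]) =
  (if bmul p q is Some s then Y (map bas (s :: w)) else 0) +
  hochr (fun b => Y (bas p :: b)) (map bas (q :: w)).
Proof.
move=> YL; rewrite /= bprod_bas; congr (_ + _).
by case: (bmul p q) => //=; rewrite (multilinear0 [::]).
Qed.

Lemma hoch_bas Y p w : hoch Y (map bas (p :: w)) =
  bprod (bas p) (Y (map bas w)) + hochr Y (map bas (p :: w)).
Proof. by []. Qed.

Lemma hochr_zero Y w : multilinear Y -> (forall u, Y (map bas u) = 0) ->
  hochr Y (map bas w) = 0.
Proof.
elim: w Y => // p [|q w] IH Y YL Y0; first by rewrite /= (Y0 [::]) (bilinear0l linl).
rewrite hochr_bas2 // IH ?addr0.
- by case: (bmul p q).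
- exact: multilinear_cons.
- by move=> u; apply: (Y0 (p :: u)).
Qed.

(** The faces of [p :: w] start with a right multiple of [p], or are empty. *)
Lemma hochr_eq0 (S : pred P) Y p w : multilinear Y ->
  (forall q r s, S q -> bmul q r = Some s -> S s) ->
  Y [::] = 0 -> (forall q u, S q -> Y (map bas (q :: u)) = 0) -> S p ->
  hochr Y (map bas (p :: w)) = 0.
Proof.
move=> YL SM Y0 YS Sp; case: w => [|q w]; first by rewrite /= Y0 (bilinear0l linl).
rewrite hochr_bas2 //; case pq: (bmul p q) => [s|].
  rewrite YS ?add0r; last exact: SM pq.
  by apply: hochr_zero; [apply: multilinear_cons|move=> u; apply: YS].
by rewrite add0r; apply: hochr_zero; [apply: multilinear_cons|move=> u; apply: YS].
Qed.

(** The faces of a run of units are all equal, so only their parity matters. *)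
Lemma hochr_units Y i j v : multilinear Y -> typedr i Y -> blen i = 0%N ->
  ends i j v -> (forall u, odd_units u -> Y (map bas u) = 0) -> ~~ odd_units v ->
  hochr Y (map bas (i :: v)) = Y (map bas v).
Proof.
have [n] := ubnP (size v); elim: n v Y => // n IH [|q v] Y sv YL tY i0 ev Yodd nov.
  by rewrite /= bprod_runit // => p /(tY [::]) /= /eqP.
rewrite hochr_bas2 //; case/andP: ev => /eqP lq ev.
have iq : bmul i q = Some q by rewrite -lq bmul_lunit.
rewrite iq; case: (eqVneq (blen q) 0%N) => [q0|q0]; last first.
  rewrite (@hochr_eq0 (fun p => 0 < blen p)%N) ?addr0 ?lt0n //.
  - exact: multilinear_cons.
  - by move=> p r s lp /blen_bmul ->; rewrite addn_gt0 lp.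
  - by apply: (Yodd [:: i]); rewrite /= i0.
  - by move=> p u; rewrite lt0n => p0; apply: (Yodd [:: i, p & u]); rewrite /= i0 (negbTE p0).
have qi : q = i by rewrite -lq lunit_id.
have ov : odd_units v by move: nov; rewrite /= q0 /= negbK.
rewrite qi runit_id // in ev sv *.
case: v ov ev sv {nov} => [//|r v] ov ev sv.
have /andP[/eqP r0 {}ov] : (blen r == 0%N) && ~~ odd_units v := ov.
have /andP[/eqP rl {}ev] : (lunit r == i) && ends (runit r) j v := ev.
have ri : r = i by rewrite -rl lunit_id.
rewrite ri runit_id // in ev *.
have ii : bmul i i = Some i by rewrite -{1}(lunit_id i0) bmul_lunit.
rewrite hochr_bas2; last exact: multilinear_cons.
rewrite ii (IH v (fun b => Y [:: bas i, bas i & b])) //.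
- by rewrite char2 addr0.
- by rewrite ltnS in sv; apply: ltn_trans sv.
- exact: (multilinear_cons _ (multilinear_cons _ YL)).
- by move=> u p /(tY [:: i, i & u]) /=; rewrite !(runit_id i0) => /and3P[].
- by move=> u ou; apply: (Yodd [:: i, i & u]); rewrite /= i0 /= negbK.
Qed.

Lemma hochr_split Y p w : multilinear Y -> (1 < blen p)%N ->
  Y [::] = 0 -> (forall q u, (0 < blen q)%N -> isSome (bmul (bhead p) q) ->
    Y (map bas (q :: u)) = 0) ->
  hochr Y (map bas (btail p :: w)) = 0.
Proof.
move=> YL lp Y0 Yq; have [pE lh] := bmul_head_tail lp.
apply: (@hochr_eq0 (fun q => (0 < blen q)%N && isSome (bmul (bhead p) q))) => //.
- move=> q r s /andP[lq mq] qr.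
  by rewrite (blen_bmul qr) addn_gt0 lq (bmul_quadratic _ lq qr).
- by move=> q u /andP[]; apply: Yq.
- by rewrite blen_tail // pE /=; case: (blen p) lp => [|[]].
Qed.

Lemma hochr_up Y p j v v' : blen p = 1%N -> multilinear Y ->
  typedr (runit p) (fun b => Y (bas p :: b)) -> ends (runit p) j v ->
  (forall w, up (Some p) w = None -> Y (map bas (p :: w)) = 0) ->
  up (Some p) v = Some v' -> hochr Y (map bas (p :: v')) = Y (map bas (p :: v)).
Proof.
elim: v v' p Y => [//|q v IH] v' p Y lp YL tY /andP[/eqP lq ev] Yup.
have YpL := multilinear_cons (bas p) YL.
rewrite up_cons; case: eqP => [q0|/eqP q0].
  case: ifP => // ov [<-]; rewrite hochr_bas2 //.
  have -> : bmul p q = Some p by rewrite -(lunit_id q0) lq bmul_runit.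
  rewrite (hochr_bas2 _ _ _ YpL).
  have -> : bmul q q = Some q by rewrite -{1}(lunit_id q0) bmul_lunit.
  rewrite addrA char2 add0r.
  apply: (@hochr_units (fun b => Y [:: bas p, bas q & b]) q j) => //.
  - exact: (multilinear_cons (bas q) YpL).
  - by move=> u r /(tY (q :: u)) /= /andP[_]; rewrite runit_id.
  - by move: ev; rewrite runit_id.
  - by move=> u ou; apply: (Yup (q :: u)); rewrite up_cons q0 /= ou.
rewrite /mergeable; case pq: (bmul p q) => [//|]; case: ifP => lq1.
  case=> <-; have [qE lh] := bmul_head_tail lq1.
  have ph : bmul p (bhead q) = None.
    have := bmul_quadratic p (_ : (0 < blen (bhead q))%N) qE.
    by rewrite lh pq; case: (bmul p _) => // a /(_ isT).
  rewrite hochr_bas2 // ph add0r (hochr_bas2 _ _ _ YpL) qE.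
  rewrite hochr_split ?addr0 //.
  - exact: (multilinear_cons (bas (bhead q)) YpL).
  - by apply: (Yup [:: bhead q]); rewrite /= lh /= ph.
  - move=> r u lr hr; apply: (Yup [:: bhead q, r & u]).
    by rewrite /= lh /= ph /= hr; case: (blen r) lr.
case ew: (up _ v) => [w|] // [<-].
have lq1' : blen q = 1%N by move: q0 lq1; case: (blen q) => [|[]].
rewrite hochr_bas2 // pq add0r (IH w q (fun b => Y (bas p :: b))) //.
- by move=> u r /(tY (q :: u)) /=/andP[].
- by move=> u uq; apply: (Yup (q :: u)); rewrite /= lq1' pq /= uq.
Qed.

(** Against a cochain that vanishes where [up] fails, the only faces of [up v]
   that matter are [v] and, when the first entry was split, the outer one. *)
Lemma hoch_up Y i j v v' : multilinear Y -> typed Y -> ends i j v ->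
  (forall w, up None w = None -> Y (map bas w) = 0) ->
  up None v = Some v' ->
  hoch Y (map bas v') = Y (map bas v) +
    (if v is p :: w then
       if (1 < blen p)%N then bprod (bas (bhead p)) (Y (map bas (btail p :: w))) else 0
     else 0).
Proof.
case: v => [//|p w] YL tY /andP[/eqP lp ew] Yup.
rewrite up_cons; case: eqP => [p0|/eqP p0].
  case: ifP => // ow [<-]; rewrite p0 addr0 hoch_bas.
  rewrite bprod_lunit; last first.
    by move=> q /(tY (p :: w)) /=; rewrite lunit_id // => /andP[/eqP].
  rewrite hochr_bas2 //.
  have -> : bmul p p = Some p by rewrite -{1}(lunit_id p0) bmul_lunit.
  rewrite addrA char2 add0r.
  apply: (@hochr_units (fun b => Y (bas p :: b)) p j) => //.
  - exact: multilinear_cons.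
  - by move=> u r /(tY (p :: u)) /=/andP[_]; rewrite runit_id.
  - by move: ew; rewrite runit_id.
  - by move=> u ou; apply: (Yup (p :: u)); rewrite up_cons p0 /= ou.
case: ifP => lp1.
  case=> <-; have [pE lh] := bmul_head_tail lp1.
  rewrite hoch_bas hochr_bas2 // pE hochr_split ?addr0 1?addrC //.
  - exact: multilinear_cons.
  - by apply: (Yup [:: bhead p]); rewrite /= lh.
  - move=> r u lr hr; apply: (Yup [:: bhead p, r & u]).
    by rewrite /= lh /= hr; case: (blen r) lr.
case ew': (up _ w) => [w'|] // [<-].
have lp1' : blen p = 1%N by move: p0 lp1; case: (blen p) => [|[]].
rewrite hoch_bas (Yup w') ?(up_up _ ew') // (bilinear0r linr) add0r addr0.
apply: (@hochr_up Y p j) ew' => //; first exact: typed_cons.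
by move=> u uq; apply: (Yup (p :: u)); rewrite /= lp1' /= uq.
Qed.

Lemma hochr_koszul o Y p w : multilinear Y -> koszul o (p :: w) ->
  hochr Y (map bas (p :: w)) = bprod (Y (map bas (belast p w))) (bas (last p w)).
Proof.
elim: w o p Y => [//|q w IH] o p Y YL kw.
rewrite hochr_bas2 //; case/and3P: kw => lp mp kw; case/and3P: (kw) => _ /=.
case: (bmul p q) => //= _ _; rewrite add0r.
by apply: (IH (Some p) q (fun b => Y (bas p :: b))) => //; apply: multilinear_cons.
Qed.

Lemma koszul_belast o p w : koszul o (p :: w) -> koszul o (belast p w).
Proof.
elim: w o p => //= q w IH o p /and3P[-> -> kw]; exact: (IH (Some p) q kw).
Qed.

Lemma hoch_koszul Y w : multilinear Y -> koszul None w ->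
  (forall u, up None u = None -> Y (map bas u) = 0) -> hoch Y (map bas w) = 0.
Proof.
case: w => [|p w] YL kw Y0; first by rewrite /hoch addr0.
rewrite hoch_bas (hochr_koszul YL kw).
rewrite (Y0 (belast p w)) ?(koszul_up _ (koszul_belast kw)) // (bilinear0l linl).
case/and3P: kw => _ _ kw.
by rewrite Y0 ?(koszul_up _ kw) // (bilinear0r linr) addr0.
Qed.

(* The first argument bounds the length of [p]. *)
Fixpoint homotopyw n (F : seq P -> A) p w : A :=
  if n is n'.+1 then
    if (1 < blen p)%N then
      F [:: bhead p, btail p & w] + bprod (bas (bhead p)) (homotopyw n' F (btail p) w)
    else oapp F 0 (up None (p :: w))
  else 0.

(** The contracting homotopy of the Hochschild complex onto its Koszul part. *)
Definition homotopy E : seq A -> A := mext (fun w =>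
  if w is p :: w' then homotopyw (blen p).+1 (fun v => E (map bas v)) p w' else 0).

Lemma homotopy_None E w : up None w = None -> homotopy E (map bas w) = 0.
Proof.
rewrite /homotopy mext_bas; case: w => // p w uw; rewrite /homotopyw uw.
by case: ifP => // lp; move: uw; rewrite /= lp; case: (blen p) lp.
Qed.

Lemma homotopy_Some E w v : up None w = Some v ->
  homotopy E (map bas w) = E (map bas v) +
    (if w is p :: w' then
      if (1 < blen p)%N then bprod (bas (bhead p)) (homotopy E (map bas (btail p :: w')))
      else 0
     else 0).
Proof.
case: w => // p w uw; rewrite /homotopy !mext_bas.
have wS n F : homotopyw n.+1 F p w = if (1 < blen p)%N then
    F [:: bhead p, btail p & w] + bprod (bas (bhead p)) (homotopyw n F (btail p) w)
  else oapp F 0 (up None (p :: w)) by [].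
rewrite wS uw; case: ifP => lp; last by rewrite addr0.
rewrite blen_tail // prednK ?(ltnW lp) //; congr (_ + _).
by move: uw; rewrite up_cons lp /=; case: eqP lp => [->|_] // _ [<-].
Qed.

Lemma homog_homotopy E c : homog c E -> homog (c - 1) (homotopy E).
Proof.
move=> hE; apply: homog_mext => -[|p w]; first exact: sits0.
move: (blen p).+1 => n; elim: n p => [|n IH] p /=; first exact: sits0.
case: ifP => lp.
  have [pE lh] := bmul_head_tail lp; have [rl ll rr] := bmul_ends pE.
  apply: (@sits_eq _ [:: bhead p, btail p & w] _ c).
  - rewrite /degw !big_cons (deg_bmul pE) mulrzBr mulr1z opprB !addrA.
    by rewrite [RHS](ACl (1*3*2*5*4*6)).
  - by move=> i j /=; rewrite -rl eqxx ll rr.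
  apply: sitsD; first exact: hE.
  have -> : c = 2 + (c - 1) - 1 by rewrite addrAC -addrA addrC -!addrA; lia.
  have := @sits_subst (bprod (bas (bhead p))) [:: bhead p] (btail p :: w) [::] 2 (c - 1)
    (homotopyw n (fun v => E (map bas v)) (btail p) w) (bprod_sumr _) _ (IH _).
  by rewrite cats0; apply=> q; apply: (homog_mu2 [:: bhead p; q]).
rewrite -/(up None (p :: w)); case ew: (up None (p :: w)) => [v|]; last exact: sits0.
have [_ dv ev] := up_split ew.
apply: (sits_eq _ _ (hE v)); last by move=> i j; rewrite ev.
by rewrite dv mulrzBr mulr1z opprB addrA.
Qed.

(** The difference between [E] and the coboundary of [homotopy E] is a cocycle.  It
   vanishes on Koszul tuples by hypothesis, and on the values of [up] because
   [homotopy] is defined by the equation that [hoch_up] gives there.  On any other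
   tuple [w], the cocycle condition at [up w] and [hoch_up] express its value by
   its value on a tuple with a shorter first entry. *)
Theorem hoch_homotopy E n c : (0 < n)%N -> multilinear E -> homog c E ->
  (forall a, size a = n.+2 -> hoch E a = 0) ->
  (forall w, size w = n.+1 -> koszul None w -> E (map bas w) = 0) ->
  forall a, size a = n.+1 -> hoch (homotopy E) a = E a.
Proof.
move=> n0 EL hE dE Ek.
have m2L := multilinear_mu2 linl linr.
pose psi := restrict_size n (homotopy E).
have pL : multilinear psi by apply: multilinear_restrict; apply: multilinear_mext.
have hpsi : homog (c - 1) psi by apply: homog_restrict; apply: homog_homotopy.
have tpsi := homog_typed hpsi.
have psi0 w : up None w = None -> psi (map bas w) = 0.
  by move=> uw; rewrite /psi /restrict_size homotopy_None // if_same.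
pose Z := restrict_size n.+1 (fun a => E a + (ins psi mu2 a + ins mu2 psi a)).
have ZL : multilinear Z.
  apply: multilinear_restrict; apply: multilinear_add => //.
  by apply: multilinear_add; apply: multilinear_ins.
have hZ : homog c Z.
  apply: homog_restrict; apply: homogD => //; apply: homogD.
    have -> : c = c - 1 + 2 - 1 by ring.
    exact: homog_ins homog_mu2.
  have -> : c = 2 + (c - 1) - 1 by ring.
  exact: homog_ins homog_mu2 _.
have ZE a : size a = n.+1 -> Z a = E a + hoch psi a.
  by move=> sa; rewrite /Z /restrict_size sa eqxx hoch_ins // sa.
have dZ a : size a = n.+2 -> hoch Z a = 0.
  move=> sa; rewrite (@eq_hoch _ _ bprod _ (fun b => E b + hoch psi b)).
    by rewrite hochD // dE // add0r (hoch_hoch linl linr (@bprodA _ _ B)) // sa.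
  by move=> b; rewrite sa; apply: ZE.
have Z0 w : up None w = None -> Z (map bas w) = 0.
  move=> uw; case: (eqVneq (size w) n.+1) => sw; last first.
    by rewrite /Z /restrict_size size_map (negbTE sw).
  apply: (typed_eq0 (homog_typed hZ)) => i j ew.
  have [kw|[v uv]] := up_None ew uw.
    rewrite ZE ?size_map // Ek // add0r; exact: hoch_koszul.
  have [sv _ ev] := up_split uv.
  have {}sv : size v = n by move: sv; rewrite sw; case.
  have psiE u : size u = n -> psi (map bas u) = homotopy E (map bas u).
    by move=> su; rewrite /psi /restrict_size size_map su eqxx.
  have := hoch_up pL tpsi (etrans (esym (ev _ _)) ew) psi0 uv.
  rewrite ZE ?size_map // => ->; rewrite psiE // (homotopy_Some E uv).
  rewrite !addrA char2 add0r; case: v sv {uv ev} => [|p v] sv; first by rewrite addr0.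
  by case: ifP => _; rewrite ?addr0 // psiE // char2.
have Zw w : size w = n.+1 -> Z (map bas w) = 0.
  have [k] := ubnP (if w is p :: _ then blen p else 0%N).
  elim: k w => // k IH w wk sw.
  case uw: (up None w) => [v|]; last exact: Z0.
  apply: (typed_eq0 (homog_typed hZ)) => i j ew.
  have := hoch_up ZL (homog_typed hZ) ew Z0 uw.
  rewrite dZ; last by have [sv _ _] := up_split uw; rewrite size_map sv sw.
  move=> /esym; case: w wk sw {uw ew} => [|p w] wk sw; first by rewrite addr0.
  case: ifP => lp; last by rewrite addr0.
  rewrite (IH (btail p :: w)) ?(bilinear0r linr) ?addr0 //.
  by rewrite /= blen_tail //; case: (blen p) lp wk.
move=> a sa; rewrite (@eq_hoch _ _ bprod _ psi); last first.
  by move=> b; rewrite sa => sb; rewrite /psi /restrict_size sb eqxx.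
have Za : Z a = 0.
  apply: (multilinear_eq (g := fun=> 0) ZL) sa => //.
  by move=> b d k x y; rewrite scaler0 addr0.
by move: Za; rewrite ZE // => /(congr1 (+%R (E a))); rewrite addrA char2 add0r addr0.
Qed.

(** * Existence and uniqueness of deformations *)

(** A sequence whose step [i] only changes arity [m + i] stabilizes in each
   arity. *)
Section Limit.
Variables (X : nat -> seq A -> A) (m : nat).
Hypothesis X_step : forall i a, size a != (m + i)%N -> X i.+1 a = X i a.

Definition limit a := X (size a) a.

Lemma X_stable i j a : (i <= j)%N -> (size a < m + i)%N -> X j a = X i a.
Proof.
move=> /subnK <-; elim: (j - i)%N => //= k IH sa.
by rewrite addSn X_step ?IH //; lia.
Qed.

Lemma limitE i a : (0 < m)%N -> (size a < m + i)%N -> limit a = X i a.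
Proof.
move=> m0 sa; case: (leqP i (size a)) => ia; first exact: X_stable.
by rewrite (X_stable (ltnW ia)) //; lia.
Qed.

Lemma multilinear_limit : (forall i, multilinear (X i)) -> multilinear limit.
Proof. by move=> XL u v c x y; rewrite /limit !size_cat /= XL. Qed.

Lemma homog_limit c : (forall i, homog c (X i)) -> homog c limit.
Proof. by move=> hX w; apply: hX. Qed.

End Limit.

Section Existence.
Variables (n0 : nat) (seed : seq P -> A).
Hypothesis n0_gt2 : (2 < n0)%N.
Hypothesis seed_sits : forall w, sits (seed w) w 2.
Hypothesis seed_size : forall w, size w != n0 -> seed w = 0.
Hypothesis seed_cocycle : forall w i j, size w = n0.+1 -> koszul None w ->
  ends i j w -> hoch (mext seed) (map bas w) = 0.
Hypothesis no_obstruction : forall x w, sits x w 3 -> koszul None w ->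
  (n0.+1 < size w)%N -> x = 0.
Hypothesis no_unit : forall x w, sits x w 2 -> size w = n0 ->
  all (fun p => blen p <= 1)%N w -> has (fun p => blen p == 0)%N w -> x = 0.

(** Step [i] corrects arity [n0 + i] so that the relations hold up to arity
   [n0 + i + 1]. *)
Fixpoint approx i : seq A -> A :=
  if i is i'.+1 then
    fun a => approx i' a +
      restrict_size (n0 + i') (homotopy (ins (approx i') (approx i'))) a
  else fun a => mu2 a + mext seed a.

Lemma mext_seed0 a : size a != n0 -> mext seed a = 0.
Proof.
move=> sa; apply: (multilinear_eq (g := fun=> 0) (multilinear_mext seed)) (erefl _).
  by move=> b c k x y; rewrite scaler0 addr0.
by move=> w sw; rewrite mext_bas seed_size ?sw.
Qed.

Lemma extends_mul_mu2 : extends_mul bprod mu2.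
Proof.
split=> // [|a sa]; first exact: multilinear_mu2 linl linr.
by rewrite mu2_size //; lia.
Qed.

Lemma ins_approx0 a : (size a <= n0.+1)%N ->
  ins (approx 0) (approx 0) a = if size a == n0.+1 then hoch (mext seed) a else 0.
Proof.
move=> sa; rewrite /= (ins_correct linl linr extends_mul_mu2 (multilinear_mext _) n0_gt2) //.
  by rewrite (ins_mu2_mu2 linl linr (@bprodA _ _ B)) // add0r.
exact: mext_seed0.
Qed.

Lemma approxP i : [/\ extends_mul bprod (approx i), homog 2 (approx i)
  & forall a, (size a <= n0 + i)%N -> ins (approx i) (approx i) a = 0].
Proof.
have [m2L m20 m22] := extends_mul_mu2.
elim: i => [|i [XE hX OX]].
  split.
  - rewrite [approx 0]/=; split=> [|a sa|x y].
    + by apply: multilinear_add => //; apply: multilinear_mext.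
    + rewrite m20 // mext_seed0 ?add0r //.
      by rewrite (ltn_eqF (leq_trans sa (ltnW n0_gt2))).
    + by rewrite mext_seed0 ?addr0 // (ltn_eqF n0_gt2).
  - apply: homogD homog_mu2 _; exact: homog_mext.
  move=> a; rewrite addn0 => sa; rewrite ins_approx0 ?leqW //.
  by case: eqP => // ea; move: sa; rewrite ea ltnn.
have [XL X0 X2] := XE.
set E := ins (approx i) (approx i) in OX.
pose Y := restrict_size (n0 + i) (homotopy E).
have EL : multilinear E by apply: multilinear_ins.
have YL : multilinear Y by apply: multilinear_restrict; apply: multilinear_mext.
have hE : homog 3 E by exact: (homog_ins XL hX hX).
have Y0 b : size b != (n0 + i)%N -> Y b = 0.
  by rewrite /Y /restrict_size => /negbTE ->.
rewrite [approx i.+1]/= -/E -/Y; split.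
- split=> [|a sa|x y]; first exact: multilinear_add.
    by rewrite X0 // Y0 ?add0r //; lia.
  by rewrite X2 Y0 ?addr0 //=; lia.
- exact: homogD (homog_restrict _ (homog_homotopy hE)).
move=> a sa.
rewrite addnS in sa; rewrite (ins_correct linl linr XE YL _ Y0) ?ltn_addr // -/E.
case: eqP => [ea|/eqP ea]; last by rewrite addr0 OX // -ltnS ltn_neqAle ea.
rewrite (@eq_hoch _ _ bprod _ (homotopy E)); last first.
  by move=> b; rewrite ea => sb; rewrite /Y /restrict_size sb eqxx.
rewrite (hoch_homotopy (n := n0 + i) (c := 3)) // ?char2 //; first by lia.
  by move=> b; apply: (hoch_obstruction linl linr char2 XE).
move=> w sw kw; case: (posnP i) => [i0|i0]; last first.
  by apply: no_obstruction (hE w) kw _; lia.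
apply: (typed_eq0 (homog_typed hE)) => k l ew.
move: sw; rewrite /E i0 addn0 => sw.
rewrite ins_approx0 ?size_map ?sw // eqxx; exact: seed_cocycle ew.
Qed.

(** A deformation with prescribed values [seed] on the tuples of size [n0] of
   generators. Those that contain a unit are excluded by degree; on the others
   [homotopy] vanishes because [up] fails, so that correcting arity [n0] does not
   alter the prescribed values. *)
Theorem deformation_exists : exists mu : seq A -> A,
  [/\ extends_mul bprod mu, homog 2 mu /\ mu [::] = 0, forall a, ins mu mu a = 0,
      forall a, (2 < size a < n0)%N -> mu a = 0
    & forall w, size w = n0 -> all (fun p => blen p <= 1)%N w ->
        mu (map bas w) = seed w].
Proof.
have step i a : size a != (n0 + i)%N -> approx i.+1 a = approx i a.
  by move=> sa; rewrite /= /restrict_size (negbTE sa) addr0.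
have n00 : (0 < n0)%N by lia.
have limE i b := @limitE _ _ step i b n00.
have lim0 a : (size a < n0)%N -> limit approx a = mu2 a.
  by move=> sa; rewrite (limE 0%N) ?addn0 //= mext_seed0 ?addr0 //; lia.
have XL i : multilinear (approx i) by have [[]] := approxP i.
have limL := multilinear_limit XL.
have limh : homog 2 (limit approx) by apply: homog_limit => i; have [] := approxP i.
exists (limit approx); split.
- split=> // [a sa|x y].
    by rewrite lim0 ?(leq_trans sa (ltnW n0_gt2)) // mu2_size // (ltn_eqF sa).
  by rewrite lim0.
- by split=> //; rewrite lim0.
- move=> a; have [_ _ O] := approxP (size a).
  rewrite -(O a); last by lia.
  apply: eq_ins => u z v ez; have := congr1 size ez; rewrite !size_cat => {}ez.
  have lt k : (k <= (size a).+1)%N -> (k < n0 + size a)%N by lia.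
  rewrite (limE (size a) z); last first.
    by apply: lt; rewrite -ez; apply/leqW/(leq_trans (leq_addr _ _))/leq_addl.
  rewrite (limE (size a)) //; apply: lt.
  by rewrite size_cat addnS ltnS -ez leq_add2l leq_addl.
- by move=> a /andP[a2 an]; rewrite lim0 // mu2_size // (gtn_eqF a2).
move=> w sw w1; case: (boolP (has (fun p => blen p == 0)%N w)) => w0.
  by rewrite (no_unit (limh w) sw w1 w0) (no_unit (seed_sits w) sw w1 w0).
rewrite (limE 1%N) ?size_map ?sw ?addn1 //= mu2_size ?size_map ?add0r; last by lia.
rewrite mext_bas /restrict_size; case: ifP => _; rewrite ?addr0 // homotopy_None ?addr0 //.
elim: w None w1 w0 {sw} => //= p w IH o /andP[p1 w1] /norP[p0 w0].
by rewrite (negbTE p0) ltnNge p1 /= (IH _ w1 w0); case: ifP.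
Qed.

End Existence.

Section Uniqueness.
Variables (n0 : nat) (mu nu : seq A -> A).
Hypothesis n0_gt2 : (2 < n0)%N.
Hypotheses (muE : extends_mul bprod mu) (nuE : extends_mul bprod nu).
Hypotheses (mu_homog : homog 2 mu) (nu_homog : homog 2 nu).
Hypotheses (mu_ainf : forall a, ins mu mu a = 0) (nu_ainf : forall a, ins nu nu a = 0).
Hypothesis mu_nu_small : forall a, (2 < size a < n0)%N -> mu a = nu a.
Hypothesis mu_nu_koszul : forall w, size w = n0 -> koszul None w ->
  mu (map bas w) = nu (map bas w).
Hypothesis no_freedom : forall x w, sits x w 2 -> koszul None w ->
  (n0 < size w)%N -> x = 0.

Notation defect := (defect mu nu).

(** The morphism is the identity below arity [n0 - 1], because the two structures
   agree below arity [n0]. *)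
Fixpoint morph i : seq A -> A :=
  if i is i'.+1 then
    fun a => morph i' a + restrict_size (n0.-1 + i') (homotopy (defect (morph i'))) a
  else @unary K A.

Lemma ins_unary a : ins (@unary K A) mu a = mu a.
Proof.
rewrite /ins (big_splits_head (F := fun u w : seq A => \sum_(t <- splits w)
  unary (u ++ mu t.1 :: t.2))).
  by rewrite (big_splits_last (F := fun u w : seq A => unary (mu u :: w))).
by move=> x u v _; rewrite big1 // => s _; case: u.
Qed.

Lemma defect_unary a : defect (@unary K A) a = nu a + mu a.
Proof.
rewrite -[LHS]/(star nu _ a + ins _ mu a) ins_unary star_unary //.
by have [] := nuE.
Qed.

Lemma morphP i : [/\ extends_id (morph i), homog 1 (morph i)
  & forall a, (size a < n0 + i)%N -> defect (morph i) a = 0].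
Proof.
have [muL mu0 mu2E] := muE; have [nuL nu0 nu2E] := nuE.
elim: i => [|i [fE hf Of]].
  split; [split=> //; exact: multilinear_unary|exact: homog_unary|].
  move=> a; rewrite addn0 => sa; rewrite defect_unary.
  case: (leqP (size a) 2) => sa2; first by rewrite (extends_mul2 muE) ?(extends_mul2 nuE) ?char2.
  by rewrite mu_nu_small ?char2 // sa2.
have [fL f0 f1] := fE.
set E := defect (morph i) in Of.
pose Y := restrict_size (n0.-1 + i) (homotopy E).
have EL : multilinear E by apply: multilinear_defect.
have YL : multilinear Y by apply: multilinear_restrict; apply: multilinear_mext.
have hE : homog 2 E by apply: homogD; [apply: homog_star|exact: (homog_ins fL hf mu_homog)].
have Y0 b : size b != (n0.-1 + i)%N -> Y b = 0.
  by rewrite /Y /restrict_size => /negbTE ->.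
rewrite [morph i.+1]/= -/E -/Y; split.
- split=> [||x]; first exact: multilinear_add.
    by rewrite f0 Y0 ?add0r //=; lia.
  by rewrite f1 Y0 ?addr0 //=; lia.
- exact: homogD (homog_restrict _ (homog_homotopy hE)).
move=> a sa.
have en : (n0.-1 + i).+1 = (n0 + i)%N by lia.
rewrite addnS ltnS -en in sa.
rewrite (defect_correct linl linr muE nuE fE YL _ Y0) // -/E; last by lia.
case: eqP => [ea|/eqP ea]; last by rewrite addr0 Of // -en ltn_neqAle ea.
rewrite (@eq_hoch _ _ bprod _ (homotopy E)); last first.
  by move=> b; rewrite ea => sb; rewrite /Y /restrict_size sb eqxx.
rewrite (hoch_homotopy (n := n0.-1 + i) (c := 2)) // ?char2 //; first by lia.
  move=> b; apply: (hoch_defect linl linr char2 muE nuE fE) => // c sc.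
  by apply: Of; rewrite -en ltnS.
move=> w sw kw; case: (posnP i) => [i0|i0]; last first.
  by apply: no_freedom (hE w) kw _; lia.
have swn : size w = n0 by rewrite sw en i0 addn0.
by rewrite /E i0 defect_unary mu_nu_koszul ?char2.
Qed.

Theorem deformation_unique : exists2 f, extends_id f & forall a, defect f a = 0.
Proof.
have step i a : size a != (n0.-1 + i)%N -> morph i.+1 a = morph i a.
  by move=> sa; rewrite /= /restrict_size (negbTE sa) addr0.
have n00 : (0 < n0.-1)%N by lia.
have limE i b := @limitE _ _ step i b n00.
have fL i : multilinear (morph i) by have [[]] := morphP i.
exists (limit morph).
  have n01 : (1 < n0.-1)%N by lia.
  split=> [||x]; first exact: multilinear_limit.
    by rewrite (limE 0%N) // addn0.
  by rewrite (limE 0%N) // addn0.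
move=> a; have [_ _ O] := morphP (size a).
rewrite -(O a); last by lia.
congr (_ + _).
  apply: eq_big_seq => b ba; congr nu; apply/eq_in_map => c cb.
  apply: limE; have := size_block ba cb; case: b cb {ba} => // d b _.
  rewrite /= addnS ltnS => /(leq_trans (leq_addr _ _)) sc; apply: leq_ltn_trans sc _.
  by rewrite -[X in (X < _)%N]add0n ltn_add2r.
apply: eq_ins => u z v ez; have := congr1 size ez; rewrite !size_cat => {}ez.
have lt k : (k <= (size a).+1)%N -> (k < n0.-1 + size a)%N by lia.
rewrite (limE (size a)) //; apply: lt.
by rewrite size_cat addnS ltnS -ez leq_add2l leq_addl.
Qed.

End Uniqueness.

End Grading.
End Monomial.

(** * The explicit sums of the [A_oo]-relations *)

Lemma splitsE (T : Type) (a : seq T) :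
  splits a = [seq (take k a, drop k a) | k <- iota 0 (size a).+1].
Proof.
elim: a => [//|x a IH]; rewrite [LHS]/= IH -map_comp [size _]/=.
rewrite -[iota 0 _.+2]/(0%N :: iota (1 + 0) (size a).+1) iotaDl map_cons -map_comp.
by rewrite take0 drop0.
Qed.

Lemma big_splitsE (T : Type) (V : nmodType) (F : seq T -> seq T -> V) a :
  \sum_(s <- splits a) F s.1 s.2 = \sum_(0 <= k < (size a).+1) F (take k a) (drop k a).
Proof. by rewrite splitsE big_map /index_iota subn0. Qed.

Section Relations.
Variables (K : comNzRingType) (A : lmodType K).
Implicit Types (f g mu nu : seq A -> A) (a : seq A).

Lemma insertionsE f g a : multilinear f -> g [::] = 0 -> insertions f g a = ins f g a.
Proof.
move=> fL g0; rewrite /ins (big_splitsE (fun u w => \sum_(t <- splits w)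
  f (u ++ g t.1 :: t.2))).
set n := size a; pose F k r := f (take k a ++ g (take r (drop k a)) :: drop (k + r) a).
transitivity (\sum_(0 <= k < n.+1) \sum_(1 <= r < n.+1 | (k < (n - r).+1)%N) F k r).
  rewrite [RHS](exchange_big_dep_nat xpredT) //=; apply: eq_big_nat => r /andP[r1 rn].
  by rewrite [LHS](big_nat_widen _ _ n.+1) ?ltnS ?leq_subr.
apply: eq_big_nat => k /andP[_ kn].
rewrite (big_splitsE (fun z v => f (take k a ++ g z :: v))) size_drop -/n.
rewrite big_nat_recl // take0 g0 multilinear0 // add0r.
rewrite (big_addn 0 n.+1 1) subn1 /= (big_nat_widen 0 (n - k) n) ?leq_subr //.
rewrite big_nat_cond [RHS]big_nat_cond.
apply: eq_big => [r|r _]; first by apply/idP/idP; lia.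
by rewrite /F addn1 drop_drop addnC.
Qed.

(** [ins] also applies operations to empty pieces, where they must then vanish. *)
Definition cut mu a := if a is [::] then 0 else mu a.

Lemma multilinear_cut mu : multilinear mu -> multilinear (cut mu).
Proof. by move=> muL [|x u] v c y z; apply: (muL). Qed.

Lemma insertions_cut f mu a : multilinear f -> insertions f mu a = ins f (cut mu) a.
Proof.
move=> fL; rewrite -insertionsE //; apply: eq_big_nat => r /andP[r1 rn].
apply: eq_big_nat => k /andP[_ kn]; congr f; congr cat; congr cons.
have: size (take r (drop k a)) = r by rewrite size_take size_drop; case: ifP; lia.
by case: (take r _) => //= e; move: r1; rewrite -e.
Qed.

Lemma ins_cut f mu a : ins (cut f) mu a = ins f mu a.
Proof. by apply: eq_ins => -[]. Qed.

(** Compositions of [n] index the block decompositions of a list of size [n]: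
   [blocks] and the bounded tuples of [ainf_morphism] both enumerate them. *)
Fixpoint comps n : seq (seq nat) :=
  if n is n'.+1 then [seq 1%N :: c | c <- comps n'] ++
    flatten [seq (if c is d :: c' then [:: d.+1 :: c'] else [::]) | c <- comps n']
  else [:: [::]].

Lemma mem_comps n c : (c \in comps n) = (sumn c == n) && all (leq 1) c.
Proof.
elim: n c => [|n IH] c; first by case: c => [|[|d] c] //=; rewrite andbF.
rewrite /= mem_cat; apply/orP/andP => [[/mapP[d]|/flatten_mapP[[//|d c']]]|].
- by rewrite IH => /andP[/eqP <- ad] -> /=; rewrite ad add1n eqxx.
- by rewrite IH /= => /and3P[/eqP <- d0 ac]; rewrite inE => /eqP -> /=; rewrite eqxx ac.
case: c => [|[|[|d]] c] /= [] // sc ac; [left|right].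
  by apply: map_f; rewrite IH ac andbT.
by apply/flatten_mapP; exists (d.+1 :: c); rewrite ?IH /= ?ac ?andbT ?inE.
Qed.

Lemma uniq_comps n : uniq (comps n).
Proof.
elim: n => //= n IH; rewrite cat_uniq map_inj_uniq ?IH => [|x y []//] /=.
apply/andP; split.
  apply/hasPn => c /flatten_mapP[[//|d c']]; rewrite mem_comps inE /=.
  case/and3P=> _ d0 _ /eqP ->; apply/mapP => -[? _ [e _]]; by rewrite e in d0.
have -> : flatten [seq (if c is d :: c' then [:: d.+1 :: c'] else [::]) | c <- comps n]
  = map (fun c => (head 0%N c).+1 :: behead c) [seq c <- comps n | c != [::]].
  by elim: (comps n) => //= -[|d c] s ->.
rewrite map_inj_in_uniq ?filter_uniq // => -[|d c] [|d' c'];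
  rewrite !mem_filter //= => _ _ [-> -> //].
Qed.

Lemma blocksE (T : Type) (a : seq T) : blocks a = [seq reshape c a | c <- comps (size a)].
Proof.
elim: a => //= x a ->; rewrite map_cat -!map_comp map_flatten -!map_comp.
congr (_ ++ _); first by apply: eq_map => c /=; rewrite take0 drop0.
by congr flatten; apply: eq_map => -[|d c].
Qed.

Lemma big_compositions (V : nmodType) (G : seq nat -> V) n : (0 < n)%N ->
  \sum_(1 <= k < n.+1) \sum_(l : k.-tuple 'I_n.+1
     | all (fun i : 'I__ => 0 < i)%N l && (sumn (map val l) == n)) G (map val l)
  = \sum_(c <- comps n) G c.
Proof.
move=> n0; transitivity (\sum_(1 <= k < n.+1) \sum_(c <- comps n | size c == k) G c).
  apply: eq_bigr => k _.
  set P := fun l : k.-tuple 'I_n.+1 => _.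
  rewrite -big_filter -[RHS]big_filter -(big_map (fun l : k.-tuple 'I_n.+1 => map val l) xpredT G).
  apply: perm_big; apply: uniq_perm.
  - rewrite map_inj_uniq ?filter_uniq ?index_enum_uniq // => l l' /(inj_map val_inj).
    exact: val_inj.
  - by rewrite filter_uniq // uniq_comps.
  move=> c; rewrite mem_filter mem_comps; apply/mapP/and3P => [[l]|[/eqP sc /eqP ec ac]].
    rewrite mem_filter /P => /andP[/andP[al el] _] ->.
    by rewrite size_map size_tuple eqxx el all_map.
  have cn i : i \in c -> (i < n.+1)%N.
    rewrite ltnS -ec; elim: c {sc ec ac} => //= d c IH; rewrite inE.
    by case/predU1P=> [->|/IH H]; [exact: leq_addr|apply: leq_trans H (leq_addl _ _)].
  have lc : map val (map (@inord n) c) = c.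
    by rewrite -map_comp -[RHS]map_id; apply/eq_in_map => i /cn ci /=; rewrite inordK.
  have sl : size (map (@inord n) c) == k by rewrite size_map sc.
  exists (Tuple sl) => //; rewrite mem_filter mem_index_enum andbT /P /= lc ec eqxx andbT.
  by move: ac; rewrite -{1}lc all_map.
rewrite (exchange_big_dep xpredT) //= big_seq [RHS]big_seq; apply: eq_bigr => c.
rewrite mem_comps => /andP[/eqP ec ac].
have c1 : (1 <= size c < n.+1)%N.
  rewrite ltnS -ec; apply/andP; split; first by case: c ec ac => //= e; move: n0; rewrite -e.
  by elim: c ac {ec} => //= d c IH /andP[d0 /IH H]; rewrite -add1n leq_add.
by rewrite (big_rem (size c)) ?mem_index_iota //= eqxx big1_seq ?addr0 // => i /andP[/eqP <-];
  rewrite mem_rem_uniq ?iota_uniq // inE eqxx.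
Qed.

(** An [A_oo]-morphism in terms of [star] and [ins]. *)
Lemma ainf_morphismP mu nu f : multilinear f ->
  (forall a, star (cut nu) f a = ins f (cut mu) a) -> ainf_morphism mu nu f.
Proof.
move=> fL e; split=> // a; case: a => [|x a].
  by rewrite /insertions !big_geq.
rewrite (big_compositions (fun c => nu (map f (reshape c (x :: a))))) //.
rewrite insertions_cut // -e /star blocksE big_map.
rewrite big_seq [RHS]big_seq; apply: eq_bigr => -[|d c] //.
by rewrite mem_comps.
Qed.

End Relations.

Lemma baseR_char2 (c : baseR) : c + c = 0.
Proof.
apply/malgP => m; rewrite mcoeffD mcoeff0 -mulr2n.
exact: (mulrn_pchar (pchar_Fp (isT : prime 2))).
Qed.

Lemma lmod_char2 (A : lmodType baseR) (x : A) : x + x = 0.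
Proof. by rewrite -[x]scale1r -scalerDl baseR_char2 scale0r. Qed.

(** * Path algebras as quadratic monomial algebras *)

Section Paths.
Variables (N : nat) (r : rel bool).
Notation qpath := (qpath N r).
Implicit Types (p q s : qpath) (i j : 'I_N) (w : seq bool).

Lemma qpath_eq p q : src p = src q -> word p = word q -> p = q.
Proof.
move=> es ew; apply: val_inj; move: es ew; rewrite /src /word.
by case: (val p) (val q) => [? ?] [? ?] /= -> ->.
Qed.

Definition mkpath i w : qpath := insubd (idem r i) (i, w).

Lemma src_mkpath i w : sorted r w -> src (mkpath i w) = i.
Proof. by move=> sw; rewrite /src /mkpath val_insubd /= sw. Qed.

Lemma word_mkpath i w : sorted r w -> word (mkpath i w) = w.
Proof. by move=> sw; rewrite /word /mkpath val_insubd /= sw. Qed.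

Lemma word_sorted p : sorted r (word p).
Proof. exact: (valP p). Qed.

Definition pcat p q : option qpath :=
  if (tgt p == src q) && sorted r (word p ++ word q)
  then Some (mkpath (src p) (word p ++ word q)) else None.

Lemma pcat_some p q s : pcat p q = Some s ->
  [/\ tgt p = src q, src s = src p, word s = word p ++ word q & tgt s = tgt q].
Proof.
rewrite /pcat; case: ifP => // /andP[/eqP e so] [<-].
rewrite /tgt src_mkpath // word_mkpath // foldl_cat.
by split=> //; rewrite /tgt in e; rewrite e.
Qed.

Lemma isSome_pcat p q : isSome (pcat p q) = (tgt p == src q) && sorted r (word p ++ word q).
Proof. by rewrite /pcat; case: ifP. Qed.

Lemma qmul_pcat p q : qmul (elt p) (elt q) = oapp elt 0 (pcat p q).
Proof.
rewrite qmul_elt; case e: (pcat p q) => [s|] /=.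
  have [e1 e2 e3 e4] := pcat_some e; apply: path_mulP => //.
  by rewrite -e2 -e3 /src /word; case: (val s).
by apply: path_mul0; rewrite -isSome_pcat e.
Qed.

Lemma sorted_overlap w1 b w2 : sorted r (w1 ++ [:: b]) -> sorted r (b :: w2) ->
  sorted r (w1 ++ b :: w2).
Proof. by case: w1 => //= c w1; rewrite !cat_path /= => /and3P[-> -> _] ->. Qed.

Definition pleft p := idem r (src p).
Definition pright p := idem r (tgt p).
Definition plen p := size (word p).
Definition phead p := mkpath (src p) (take 1 (word p)).
Definition ptail p := mkpath (foldl (@step N) (src p) (take 1 (word p))) (behead (word p)).
Definition pbelast p := mkpath (src p) (rev (behead (rev (word p)))).
Definition plast p := mkpath (foldl (@step N) (src p) (rev (behead (rev (word p)))))
  (rev (take 1 (rev (word p)))).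

Lemma pcat_eq p q s : tgt p = src q -> src s = src p -> word s = word p ++ word q ->
  pcat p q = Some s.
Proof.
move=> e1 e2 e3; have so := word_sorted s; rewrite e3 in so.
rewrite /pcat e1 eqxx so; congr Some; apply: qpath_eq.
  by rewrite src_mkpath.
by rewrite word_mkpath.
Qed.

Lemma pleft_id p : plen p = 0%N -> pleft p = p.
Proof. by move=> /size0nil e; apply: qpath_eq; rewrite // e. Qed.

Lemma pright_id p : plen p = 0%N -> pright p = p.
Proof. by move=> /size0nil e; apply: qpath_eq; rewrite // /src /= /tgt e. Qed.

Lemma pcat_left p : pcat (pleft p) p = Some p.
Proof. by apply: pcat_eq. Qed.

Lemma pcat_right p : pcat p (pright p) = Some p.
Proof. by apply: pcat_eq => //; rewrite cats0. Qed.

Lemma pcat_ends p q s : pcat p q = Some s ->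
  [/\ pright p = pleft q, pleft s = pleft p & pright s = pright q].
Proof. by rewrite /pright /pleft => /pcat_some[-> -> _ ->]. Qed.

Lemma plen_pcat p q s : pcat p q = Some s -> plen s = (plen p + plen q)%N.
Proof. by rewrite /plen => /pcat_some[_ _ -> _]; rewrite size_cat. Qed.

Lemma pcat_head_tail p : (1 < plen p)%N -> pcat (phead p) (ptail p) = Some p /\
  plen (phead p) = 1%N.
Proof.
rewrite /plen /phead /ptail /tgt; have := word_sorted p.
case ew: (word p) => [|b w] //= so _; rewrite take0 /= !word_mkpath //.
split=> //; have sw := sorted_catr (so : sorted r ([:: b] ++ w)).
apply: pcat_eq.
- by rewrite /tgt word_mkpath // !src_mkpath.
- by rewrite src_mkpath.
by rewrite !word_mkpath.
Qed.

Lemma head_tail_pcat p q s : plen p = 1%N -> (0 < plen q)%N -> pcat p q = Some s ->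
  phead s = p /\ ptail s = q.
Proof.
rewrite /plen => lp lq /pcat_some[e1 e2 e3 e4].
have := word_sorted q; have := word_sorted s; rewrite /phead /ptail e2 e3.
case ep: (word p) lp => [|b [|? ?]] //= _; rewrite take0 /= => so sq.
split; apply: qpath_eq; rewrite ?src_mkpath ?word_mkpath ?ep //.
by rewrite -e1 /tgt ep.
Qed.

(** The relations are quadratic: whether a product vanishes depends only on the two
   letters that meet. *)
Lemma pcat_quadratic t p q s : (0 < plen p)%N -> pcat p q = Some s ->
  isSome (pcat t s) = isSome (pcat t p).
Proof.
rewrite /plen => lp epq; have [_ e2 e3 _] := pcat_some epq.
rewrite !isSome_pcat e2 e3; congr (_ && _).
have := word_sorted s; rewrite e3 catA.
case/lastP: (word p) lp => // w b _; rewrite -cats1 -!catA => so.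
apply/idP/idP => [|so']; first by rewrite !catA => /sorted_catl; rewrite -catA.
rewrite [X in sorted _ X]catA; apply: sorted_overlap; first by rewrite -catA.
exact: sorted_catr so.
Qed.

Definition path_algebra : monomial_algebra baseR qpath :=
  MonomialAlgebra (@mcoeff_elt N r) (fun z c x y => qmul_linearl z c x y)
    (fun z c x y => qmul_linearr z c x y) (@qmulA N r) qmul_pcat
    pleft_id pright_id pcat_left pcat_right pcat_ends plen_pcat
    pcat_head_tail head_tail_pcat pcat_quadratic.

Lemma pcat_belast_last p : (1 < plen p)%N -> pcat (pbelast p) (plast p) = Some p /\
  plen (plast p) = 1%N.
Proof.
rewrite /plen /pbelast /plast; have := word_sorted p.
case/lastP ew: (word p) => [|w b] //; rewrite rev_rcons /= take0 revK.
rewrite -cats1 => so _; have sw := sorted_catl so.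
rewrite !word_mkpath //; split=> //; apply: pcat_eq.
- by rewrite /tgt word_mkpath // !src_mkpath.
- by rewrite src_mkpath.
by rewrite !word_mkpath // ew cats1.
Qed.

Lemma belast_last_pcat p q s : plen p = 1%N -> (0 < plen q)%N -> pcat q p = Some s ->
  plast s = p /\ pbelast s = q.
Proof.
rewrite /plen => lp lq /pcat_some[e1 e2 e3 e4].
have := word_sorted q; have := word_sorted s; rewrite /plast /pbelast e2 e3.
case ep: (word p) lp => [|b [|? ?]] //= _; rewrite cats1 rev_rcons /= take0 revK => so sq.
split; apply: qpath_eq; rewrite ?src_mkpath ?word_mkpath ?ep //.
Qed.

Lemma pcat_quadratic_op t p q s : (0 < plen p)%N -> pcat q p = Some s ->
  isSome (pcat s t) = isSome (pcat p t).
Proof.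
rewrite /plen => lp epq; have [_ _ e3 e4] := pcat_some epq.
rewrite !isSome_pcat e4 e3; congr (_ && _).
have := word_sorted s; rewrite e3 -catA.
case: (word p) lp => // b w _ so.
apply/idP/idP => [/sorted_catr//|so'].
by apply: sorted_overlap; [rewrite -cat1s catA in so; exact: sorted_catl so|].
Qed.

(** For right-to-left products the first letter of a product is the last letter of
   its word. *)
Definition path_algebra_op : monomial_algebra baseR qpath.
Proof.
refine (@MonomialAlgebra _ _ (@elt N r) (fun x y => qmul y x) (fun p q => pcat q p)
  pright pleft plen plast pbelast (@mcoeff_elt N r)
  (fun z c x y => qmul_linearr z c x y) (fun z c x y => qmul_linearl z c x y)
  _ (fun p q => qmul_pcat q p) pright_id pleft_id pcat_right pcat_left _ _
  pcat_belast_last belast_last_pcat pcat_quadratic_op).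
- by move=> x y z; rewrite qmulA.
- by move=> p q s /pcat_ends[-> -> ->].
- by move=> p q s /plen_pcat ->; rewrite addnC.
Defined.

End Paths.

(** * Sources and targets of the values of an [A_oo]-structure *)

Section TypedAinf.
Variables (K : comNzRingType) (P : choiceType) (B : monomial_algebra K P).
Notation A := {malg K[P]}.
Notation bas := (bas B).
Notation bprod := (bprod B).
Notation bmul := (bmul B).
Notation lunit := (lunit B).
Notation runit := (runit B).
Notation blen := (blen B).
Notation mu2 := (mu2 bprod).
Notation ends := (ends B).
Implicit Types (p q s : P) (u v w : seq P).

Lemma blen_lunit p : blen (lunit p) = 0%N.
Proof. by have := blen_bmul (bmul_lunit B p); lia. Qed.

Lemma blen_runit p : blen (runit p) = 0%N.
Proof. by have := blen_bmul (bmul_runit B p); lia. Qed.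

Lemma mcoeff_lunit p (x : A) : (bprod (bas (lunit p)) x)@_p = x@_p.
Proof.
rewrite bprod_sumr raddf_sum [in RHS](malg_expand B x) raddf_sum; apply: eq_bigr => q _ /=.
rewrite !mcoeffZ; congr (_ * _); rewrite bprod_bas.
have l0 := blen_lunit p.
case e: (bmul _ q) => [s|] /=.
  have [e1 _ _] := bmul_ends e; move: e; rewrite -[lunit p](runit_id l0) e1.
  by rewrite bmul_lunit => -[->].
rewrite mcoeff0 mcoeff_bas; case: eqVneq => // qp.
by rewrite qp bmul_lunit in e.
Qed.

Lemma mcoeff_runit p (x : A) : (bprod x (bas (runit p)))@_p = x@_p.
Proof.
rewrite bprod_suml raddf_sum [in RHS](malg_expand B x) raddf_sum; apply: eq_bigr => q _ /=.
rewrite !mcoeffZ; congr (_ * _); rewrite bprod_bas.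
have l0 := blen_runit p.
case e: (bmul q _) => [s|] /=.
  have [e1 _ _] := bmul_ends e; move: e; rewrite -[runit p](lunit_id l0) -e1.
  by rewrite bmul_runit => -[->].
rewrite mcoeff0 mcoeff_bas; case: eqVneq => // qp.
by rewrite qp bmul_runit in e.
Qed.

Lemma scale_bas_runit c p : bprod (bas p) (c *: bas (runit p)) = c *: bas p.
Proof.
have := bprod_linr B (bas p) c (bas (runit p)) 0.
by rewrite (bilinear0r (@bprod_linr _ _ B)) !addr0 bprod_bas bmul_runit.
Qed.

Lemma scale_bas_lunit c p : bprod (c *: bas (lunit p)) (bas p) = c *: bas p.
Proof.
have := bprod_linl B (bas p) c (bas (lunit p)) 0.
by rewrite (bilinear0l (@bprod_linl _ _ B)) !addr0 bprod_bas bmul_lunit.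
Qed.

Definition composable w :=
  if w is p :: w' then ends (lunit p) (runit (last p w')) w else true.

Lemma ends_composable i j w : ends i j w -> composable w.
Proof.
case: w => // p w /andP[_]; rewrite /= eqxx /=.
elim: w p => //= q w IH p /andP[-> /=]; exact: IH.
Qed.

Lemma ends_last i j p w : ends i j (p :: w) -> j = runit (last p w).
Proof. by elim: w i p => [|q w IH] i p /= /andP[_]; [move/eqP|move/IH]. Qed.

(** If the operations vanish on tuples that are not composable, the relations
   on [I, a_1, .., a_n] and [a_1, .., a_n, I], where [I] is an idempotent, locate
   the value on [a_1, .., a_n]. *)
Lemma typed_ainf nu : extends_mul bprod nu ->
  (forall a, ins nu nu a = 0) ->
  (forall w, ~~ composable w -> nu (map bas w) = 0) -> typed B nu.
Proof.
move=> nuE nunu nuc w.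
have [nuL nu1 nu2] := nuE.
have mL := multilinear_mu2 (@bprod_linl _ _ B) (@bprod_linr _ _ B).
have [n] := ubnP (size w); elim: n w => // n IH w sw q nuq.
have s2 : (1 < size w)%N.
  by rewrite ltnNge; apply: contraNN nuq => sw1; rewrite nu1 ?size_map ?mcoeff0.
have cw : composable w by apply: contraNT nuq => /nuc ->; rewrite mcoeff0.
(* The terms that survive in the relation on a non-composable tuple are those *)
(* that multiply a value of arity [size w] by an entry. *)
have rel W : size W = (size w).+1 -> ~~ composable W ->
    ins mu2 (restrict_size (size w) nu) (map bas W) = 0.
  move=> sW nW; rewrite -(nunu (map bas W)) /ins splits_map !big_map.
  apply: (eq_big_splits (F := fun u y => \sum_(t <- splits (map bas y))
      mu2 (map bas u ++ restrict_size (size w) nu t.1 :: t.2))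
    (G := fun u y => \sum_(t <- splits (map bas y))
      nu (map bas u ++ nu t.1 :: t.2))) => u y euy.
  rewrite splits_map !big_map.
  apply: (eq_big_splits (F := fun z v =>
      mu2 (map bas u ++ restrict_size (size w) nu (map bas z) :: map bas v))
    (G := fun z v => nu (map bas u ++ nu (map bas z) :: map bas v))) => z v ezv.
  have eW : u ++ z ++ v = W by rewrite ezv.
  have sW' : (size u + (size z + size v))%N = (size w).+1.
    by rewrite -sW -eW !size_cat.
  rewrite /restrict_size size_map; case: eqP => [sz|/eqP sz].
    by apply/esym/(extends_mul2 nuE); rewrite size_cat /= !size_map; lia.
  rewrite (multilinear0 _ _ mL).
  case: (ltnP (size z) (size w)) => szw.
    rewrite (multilinear_expand B _ _ _ nuL) big1 // => s _.
    have [->|es] := eqVneq (nu (map bas z))@_s 0; first by rewrite scale0r.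
    have ez := IH z (leq_trans szw sw) s es.
    have := nuc (u ++ s :: v); rewrite map_cat => -> //; first by rewrite scaler0.
    apply: contraNN nW; rewrite -eW; case: u {euy eW sW'} => [|p u].
      move=> /andP[_ /= ev]; have := cat_ends ez ev; exact: ends_composable.
    move=> /ends_cat[t eu /= /andP[/eqP st ev]].
    by apply: ends_composable (cat_ends eu (cat_ends _ ev)); rewrite -st.
  have u0 : u = [::] by case: (u) sW' => //= *; lia.
  have v0 : v = [::] by case: (v) sW' => //= *; lia.
  have -> : z = W by rewrite -eW u0 v0 cats0.
  by rewrite (nuc W) // multilinear0.
case: w sw nuq s2 cw rel IH => // p w sw nuq s2 cw rel _.
have lq : lunit q = lunit p.
  apply/eqP; apply: contraNT nuq => lq.
  have nc u : ~~ composable [:: lunit q, p & u].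
    by rewrite /= (runit_id (blen_lunit q)) [lunit p == _]eq_sym (negbTE lq) andbF.
  move: (rel (lunit q :: p :: w) erefl (nc w)); rewrite [map _ _]/= ins_mu2 //.
  have -> : restrict_size (size (p :: w)) nu (belast (bas (lunit q)) (bas p :: map bas w)) = 0.
    rewrite /restrict_size; case: ifP => // _.
    case: (w) s2 => // p' w' _; rewrite -map_cons belast_map.
    exact: nuc (nc _).
  rewrite (bilinear0l (@bprod_linl _ _ B)) addr0 /restrict_size /= size_map eqxx.
  by rewrite -(mcoeff_lunit q) => ->; rewrite mcoeff0.
have rq : runit q = runit (last p w).
  apply/eqP; apply: contraNT nuq => rq.
  have nc p' u : last p' u = last p w -> ~~ composable (p' :: rcons u (runit q)).
    move=> eu; apply/negP; rewrite /composable -rcons_cons -[rcons (p' :: u) _]cats1.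
    move=> /ends_cat[k].
    move=> /ends_last; rewrite eu => -> /=; rewrite (lunit_id (blen_runit q)).
    by rewrite (negbTE rq).
  move: (rel (p :: rcons w (runit q))); rewrite /= size_rcons => /(_ erefl (nc _ _ erefl)).
  rewrite map_rcons ins_mu2; last by case: (map _ w).
  have -> : restrict_size (size w).+1 nu (rcons (map bas w) (bas (runit q))) = 0.
    rewrite /restrict_size; case: ifP => // _; rewrite -map_rcons.
    by case: (w) s2 nc => // p' w' _ nc; apply: nuc; apply: nc.
  rewrite (bilinear0r (@bprod_linr _ _ B)) add0r belast_rcons last_rcons.
  rewrite /restrict_size /= size_map eqxx.
  by rewrite -(mcoeff_runit q) => ->; rewrite mcoeff0.
by rewrite lq rq.
Qed.

End TypedAinf.

(** * Gradings of path algebras *)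

Section PathGrading.
Variables (N : nat) (r : rel bool) (G : zmodType).
Variables (v : 'I_2 -> G) (g : bool -> 'I_N -> G) (e : G).
Notation qpath := (qpath N r).
Notation A := (qalg N r).

Definition vdeg (m : 'X_{1..2}) : G := \sum_(i < 2) v i *+ m i.
Definition kdeg (d : G) (c : baseR) := forall m, c@_m != 0 -> vdeg m = d.
Definition pdeg (p : qpath) : G := word_deg g (src p) (word p).

Lemma vdegM (m1 m2 : 'X_{1..2}) : vdeg (mmul m1 m2) = vdeg m1 + vdeg m2.
Proof. by rewrite -big_split; apply: eq_bigr => i _ /=; rewrite cmM mulrnDr. Qed.

Lemma vdeg1 : vdeg mone = 0.
Proof. by rewrite /vdeg big1 // => i _; rewrite cm1 mulr0n. Qed.

Lemma vdegU i : vdeg (ucm i) = v i.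
Proof.
rewrite /vdeg (bigD1 i) //= ucmE eqxx mulr1n big1 ?addr0 // => j ji.
by rewrite ucmE eq_sym (negbTE ji).
Qed.

Lemma kdeg0 d : kdeg d 0.
Proof. by move=> m; rewrite mcoeff0 eqxx. Qed.

Lemma kdeg1 : kdeg 0 1.
Proof. by move=> m; rewrite mcoeff1; case: (eqVneq m mone) => [-> _|_]; rewrite ?vdeg1 ?eqxx. Qed.

Lemma kdegU i : kdeg (v i) << ucm i >>.
Proof.
by move=> m; rewrite mcoeffU1; case: (eqVneq (ucm i) m) => [<- _|_]; rewrite ?vdegU ?eqxx.
Qed.

Lemma kdegD d c c' : kdeg d c -> kdeg d c' -> kdeg d (c + c').
Proof.
move=> hc hc' m; rewrite mcoeffD; have [->|/hc //] := eqVneq c@_m 0.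
by rewrite add0r; apply: hc'.
Qed.

Lemma mcoeffM_neq0 (c c' : baseR) m : (c * c')@_m != 0 ->
  exists m1 m2, [/\ c@_m1 != 0, c'@_m2 != 0 & m = (mmul m1 m2)].
Proof.
rewrite mcoeff_neq0 => /msuppM_le[m1 [m2 [h1 h2 ->]]].
by exists m1, m2; rewrite !mcoeff_neq0.
Qed.

Lemma kdegM d d' c c' : kdeg d c -> kdeg d' c' -> kdeg (d + d') (c * c').
Proof.
move=> hc hc' m /mcoeffM_neq0[m1 [m2 [h1 h2 ->]]].
by rewrite vdegM (hc _ h1) (hc' _ h2).
Qed.

Lemma word_deg_cat i w1 w2 :
  word_deg g i (w1 ++ w2) = word_deg g i w1 + word_deg g (foldl (@step N) i w1) w2.
Proof. by elim: w1 i => [|b w1 IH] i /=; rewrite ?add0r // IH addrA. Qed.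

Lemma pdeg_pcat p q s : pcat p q = Some s -> pdeg s = pdeg p + pdeg q.
Proof.
by move=> /pcat_some[e1 e2 e3 _]; rewrite /pdeg e2 e3 word_deg_cat -/(tgt p) e1.
Qed.

Lemma pdeg_unit p : plen p = 0%N -> pdeg p = 0.
Proof. by rewrite /pdeg => /size0nil ->. Qed.

Variable B : monomial_algebra baseR qpath.
Hypothesis basE : bas B =1 @elt N r.
Implicit Types (mu : seq A -> A) (w : seq qpath).

Let basEw w : map (bas B) w = map elt w.
Proof. exact: eq_map. Qed.

Lemma degwE w c :
  degw pdeg e w - e *~ c = \sum_(p <- w) pdeg p + e *~ ((size w)%:Z - c).
Proof.
rewrite /degw big_split /= mulrzBr addrA; congr (_ + _ - _).
elim: w => [|p w IH]; first by rewrite big_nil mulr0z.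
by rewrite big_cons IH [size _]/= intS mulrzDr mulr1z.
Qed.

Lemma term_degE m p : term_deg v g m p = vdeg m + pdeg p.
Proof. by []. Qed.

Lemma homogeneous_elt p : homogeneous v g (pdeg p) (elt p).
Proof.
move=> q m; rewrite mcoeff_elt; case: (eqVneq p q) => [<-|_]; last by rewrite mcoeff0 eqxx.
by rewrite mcoeff1 term_degE; case: (eqVneq m mone) => [->|_]; rewrite ?vdeg1 ?add0r ?eqxx.
Qed.

Variable sh : nat -> G.
Hypothesis shE : forall n, sh n = e *~ (n%:Z - 2).

Lemma graded_homog mu : mu [::] = 0 -> typed B mu -> graded v g sh mu ->
  homog B kdeg pdeg e 2 mu.
Proof.
move=> mu0 tmu gmu [|p w] q; first by rewrite mu0 mcoeff0 eqxx; split=> //; apply: kdeg0.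
split; last exact: tmu.
set W := p :: w; rewrite degwE -shE => m nz.
have := gmu (map elt W) (map pdeg W); rewrite !size_map big_map => gW.
have := gW isT erefl _ q m; rewrite -basEw => /(_ _ nz) <-; first by rewrite term_degE addrK.
move=> i si; have -> : (map pdeg W)`_i = pdeg (nth p W i) by rewrite (nth_map p).
by rewrite (nth_map p) // basE; apply: homogeneous_elt.
Qed.

(** Homogeneity need only be checked on basis elements: expand the entries one at a
   time, from the left. *)
Lemma homog_graded mu : multilinear mu -> homog B kdeg pdeg e 2 mu ->
  graded v g sh mu.
Proof.
move=> muL hmu a d a0 sd ha; rewrite shE.
suff gen n c f : multilinear f ->
    (forall w, size w = n -> forall p m, ((f (map elt w))@_p)@_m != 0 ->
       term_deg v g m p = \sum_(q <- w) pdeg q + c) ->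
    forall a d, size a = n -> size d = n ->
    (forall i, (i < n)%N -> homogeneous v g d`_i a`_i) ->
    homogeneous v g (\sum_(x <- d) x + c) (f a).
  apply: (gen (size a)) => // w sw p m nz; have [hw _] := hmu w p.
  move: hw; rewrite degwE sw basEw => /(_ m nz); rewrite term_degE => ->.
  by rewrite subrK.
elim: n c f {a d a0 sd ha} => [|n IH] c f fL fw [|x a] [|y d] //= => [_ _ _ p m|[sa] [sd] ha].
  by rewrite big_nil => /(fw [::] erefl) ->; rewrite big_nil.
move=> p m; rewrite (multilinear_expand B [::] a x fL) raddf_sum raddf_sum /= => nz.
have [q nzq] : exists q, ((x@_q *: f (bas B q :: a))@_p)@_m != 0.
  have: has (fun q => ((x@_q *: f (bas B q :: a))@_p)@_m != 0) (msupp x).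
    apply: contraNT nz => /hasPn nz; rewrite big_seq big1 // => q /nz.
    by rewrite negbK => /eqP.
  by case/hasP => q _ nzq; exists q.
move: nzq; rewrite mcoeffZ => /mcoeffM_neq0[m1 [m2 [h1 h2 ->]]].
have hx : term_deg v g m1 q = y := ha 0%N isT q m1 h1.
have := IH (c + pdeg q) (fun b => f (bas B q :: b)) (multilinear_cons _ fL).
move=> /(_ _ a d sa sd _ p m2 h2) => hm2.
rewrite big_cons term_degE vdegM -addrA -term_degE hm2.
- by rewrite -hx term_degE !addrA [RHS](ACl (1*3*4*2)).
- move=> w sw p' m'; rewrite basE => /(fw (q :: w)) /= -> //; last by rewrite sw.
  by rewrite big_cons !addrA [RHS](ACl (3*1*2)).
- by move=> i si; apply: (ha i.+1).
Qed.

End PathGrading.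

(** * Changes of grading group *)

Section DegreeEquation.
Variables (N : nat) (r : rel bool).
Notation qpath := (qpath N r).

(** The equation between degrees for the monomial [m] in the coefficient of [p] in a
   value on [w]. *)
Definition degeq (G : zmodType) (v : 'I_2 -> G) (g : bool -> 'I_N -> G) (e : G)
    (w : seq qpath) (c : int) (m : 'X_{1..2}) (p : qpath) :=
  vdeg v m = degw (pdeg (r := r) g) e w - e *~ c - pdeg g p.

Lemma degeq_map (G G' : zmodType) (phi : {additive G -> G'}) v v' g g' e e' w c m p :
  (forall i, phi (v i) = v' i) -> (forall b i, phi (g b i) = g' b i) -> phi e = e' ->
  degeq v g e w c m p -> degeq v' g' e' w c m p.
Proof.
move=> phiv phig phie /(congr1 phi); rewrite /degeq.
have phip q : phi (pdeg g q) = pdeg g' q.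
  rewrite /pdeg; elim: (word q) (src q) => [|b u IH] i /=; first exact: raddf0.
  by rewrite raddfD /= phig IH.
have -> : phi (vdeg v m) = vdeg v' m.
  by rewrite raddf_sum; apply: eq_bigr => i _; rewrite raddfMn /= phiv.
move=> ->; rewrite !raddfB /= phip raddfMz /= phie; congr (_ - _ - _).
by rewrite raddf_sum; apply: eq_bigr => q _; rewrite raddfD /= phip phie.
Qed.

End DegreeEquation.

Section HomogMap.
Variables (N : nat) (r : rel bool) (B : monomial_algebra baseR (qpath N r)).
Variables (G G' : zmodType) (v : 'I_2 -> G) (g : bool -> 'I_N -> G) (e : G).
Variables (v' : 'I_2 -> G') (g' : bool -> 'I_N -> G') (e' : G').
Implicit Types (mu : seq (qalg N r) -> qalg N r).

Lemma homog_map (phi : {additive G -> G'}) c mu :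
  (forall i, phi (v i) = v' i) -> (forall b i, phi (g b i) = g' b i) -> phi e = e' ->
  homog B (kdeg v) (pdeg (r := r) g) e c mu -> homog B (kdeg v') (pdeg (r := r) g') e' c mu.
Proof.
move=> phiv phig phie hmu w q; have [h1 h2] := hmu w q; split=> // m /h1.
exact: degeq_map phiv phig phie.
Qed.

(** Two gradings are treated as one with values in the product group. *)
Lemma graded_pair (sh : nat -> G) (sh' : nat -> G') mu :
  graded v g sh mu -> graded v' g' sh' mu ->
  graded (fun i => (v i, v' i)) (fun b i => (g b i, g' b i)) (fun n => (sh n, sh' n)) mu.
Proof.
have tp m (p : qpath N r) : term_deg (fun i => (v i, v' i)) (fun b i => (g b i, g' b i)) m p =
    (term_deg v g m p, term_deg v' g' m p).
  have mp (x : G) (y : G') n : (x, y) *+ n = (x *+ n, y *+ n).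
    by apply: injective_projections; rewrite raddfMn.
  rewrite /term_deg !big_ord_recl !big_ord0 !mp.
  suff -> : word_deg (fun b i => (g b i, g' b i)) (src p) (word p) =
    (word_deg g (src p) (word p), word_deg g' (src p) (word p)) by [].
  by elim: (word p) (src p) => //= b u IH i; rewrite IH.
move=> gmu gmu' a d a0 sd ha p m nz; rewrite tp.
have h1 := gmu a (map fst d) a0 (etrans (size_map _ _) sd).
have h2 := gmu' a (map snd d) a0 (etrans (size_map _ _) sd).
apply: injective_projections.
  rewrite raddfD /= raddf_sum -(big_map fst xpredT id); apply: h1 nz => i si q m' nz'.
  by have := ha i si q m' nz'; rewrite tp (nth_map 0) ?sd // => <-.
rewrite raddfD /= raddf_sum -(big_map snd xpredT id); apply: h2 nz => i si q m' nz'.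
by have := ha i si q m' nz'; rewrite tp (nth_map 0) ?sd // => <-.
Qed.

Lemma eq_graded (sh1 sh2 : nat -> G) mu : sh1 =1 sh2 ->
  graded v g sh1 mu -> graded v g sh2 mu.
Proof. by move=> esh gmu a d; rewrite -esh; apply: gmu. Qed.

End HomogMap.

(** * Deformations with prescribed values on the rotations of a tuple *)

Section CyclicDeformations.
Variables (N : nat) (r : rel bool) (B : monomial_algebra baseR (qpath N r)).
Notation qpath := (qpath N r).
Notation A := (qalg N r).
Notation mul := (bprod B).
Implicit Types (mu nu : seq A -> A) (p q : qpath) (u w : seq qpath) (i j : 'I_N).

Variables (lv rv : qpath -> 'I_N).
Hypothesis basE : bas B =1 @elt N r.
Hypothesis blenE : forall p, blen B p = plen p.
Hypothesis lunitE : forall p, lunit B p = idem r (lv p).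
Hypothesis runitE : forall p, runit B p = idem r (rv p).
Hypothesis initialE : forall p i, initial_idem mul p i = (lv p == i).
Hypothesis finalE : forall p i, final_idem mul p i = (rv p == i).

Lemma idem_inj i j : idem r i = idem r j -> i = j.
Proof. by move/(congr1 (@src N r)). Qed.

Let basEw w : map (bas B) w = map elt w.
Proof. exact: eq_map. Qed.

Lemma composable_unital mu : typed B mu -> idem_unital mul mu.
Proof.
move=> tmu s t p q i j; rewrite finalE initialE => /eqP <- /eqP <- ij.
rewrite -basEw; apply: (typed_eq0 tmu) => k l /ends_cat[c _ /= /andP[_ /andP[e _]]].
by move: e ij; rewrite lunitE runitE => /eqP/idem_inj ->; rewrite eqxx.
Qed.

Lemma unital_composable mu w : idem_unital mul mu -> ~~ composable B w ->
  mu (map (bas B) w) = 0.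
Proof.
move=> umu nw.
have [s [t [p [q [-> pq]]]]] : exists s t p q, w = s ++ p :: q :: t /\ rv p != lv q.
  case: w nw => // p w; rewrite /= eqxx /=; elim: w p => [|q w IH] p /=; first by rewrite eqxx.
  rewrite runitE lunitE; case: (eqVneq (rv p) (lv q)) => [->|pq].
    rewrite eqxx /= => /IH[s [t [p' [q' [-> pq]]]]].
    by exists (p :: s), t, p', q'.
  by move=> _; exists [::], w, p, q.
by rewrite basEw; apply: (umu s t p q (rv p) (lv q)); rewrite ?finalE ?initialE.
Qed.

Variables (W : seq qpath) (k : 'I_2).
Notation n0 := (size W).
Notation V := (<< ucm k >> : baseR).
Hypothesis n0_gt2 : (2 < n0)%N.

(** [q] can follow [p] in a composable tuple with successive products zero. *)
Definition dual_succ p q := (runit B p == lunit B q) && ~~ isSome (bmul B p q).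

Hypothesis W_letter : all (fun p => plen p == 1%N) W.
Hypothesis W_cycle : cycle dual_succ W.
Hypothesis succ_inj : forall p q q', plen p = 1%N -> plen q = 1%N -> plen q' = 1%N ->
  dual_succ p q -> dual_succ p q' -> q = q'.
Hypothesis pred_inj : forall p p' q, plen p = 1%N -> plen p' = 1%N -> plen q = 1%N ->
  dual_succ p q -> dual_succ p' q -> p = p'.

(** Rotations beyond the size of [W] repeat, so that this is decidable. *)
Definition rotation w := has (fun m => w == rot m W) (iota 0 n0.+1).

Lemma rotationP w : reflect (exists m, w = rot m W) (rotation w).
Proof.
apply: (iffP hasP) => [[m _ /eqP ->]|[m ->]]; first by exists m.
by exists (minn m n0); rewrite ?mem_iota ?ltnS ?geq_minr // -rot_minn.
Qed.

Lemma rotation_rot1 p w : rotation (p :: w) = rotation (rcons w p).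
Proof.
rewrite -rot1_cons; move: (p :: w) => {p}w.
apply/rotationP/rotationP => [[m ->]|[m e]].
  rewrite [rot m W]rot_minn; case: (leqP n0 m) => mn; first by exists 1%N; rewrite rot_size.
  by exists m.+1; rewrite ?(minn_idPl (ltnW mn)) [RHS]rotS.
rewrite -(rotK 1 w) e rot_minn; move: (geq_minr m n0); case: (minn m n0) => [|m'] mn.
  by exists (n0 - 1)%N; rewrite rot0.
by exists m'; rewrite rotS // rotK.
Qed.

Lemma rotation_cycle w : rotation w ->
  [/\ size w = n0, all (fun p => plen p == 1%N) w, cycle dual_succ w & perm_eq w W].
Proof.
case/rotationP=> m ->; rewrite size_rot rot_cycle perm_rot; split=> //.
by rewrite (perm_all _ (permEl (perm_rot m W))).
Qed.

Lemma path_dual_succ (i j : qpath) o p w : koszul B o (p :: w) -> ends B i j (p :: w) ->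
  path dual_succ p w /\ all (fun p => plen p == 1%N) (p :: w).
Proof.
elim: w o p i => [|q w IH] o p i /=; first by rewrite blenE => /andP[-> _].
case/and3P=> lp _ kw /andP[_ ew]; have [pw aw] := IH (Some p) q (runit B p) kw ew.
rewrite -blenE lp pw /=; split=> //; rewrite andbT /dual_succ.
by case/andP: ew => /eqP -> _; case/and3P: kw => _ ->; rewrite eqxx.
Qed.

(** In a tuple of letters with successive products zero, every letter determines
   its neighbours; so the first [n0] entries form a rotation of [W] exactly when
   the last [n0] do, and then the first and last entries agree. *)
Lemma rotation_shift p q w : size w = n0.-1 -> plen q = 1%N ->
  path dual_succ p (rcons w q) -> all (fun p => plen p == 1%N) (p :: w) ->
  rotation (p :: w) || rotation (rcons w q) ->
  p = q /\ rotation (p :: w) /\ rotation (rcons w q).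
Proof.
move=> sw lq pw /= /andP[/eqP lp aw] rr; suff pq : p = q.
  by split=> //; move: rr; rewrite pq rotation_rot1 orbb.
case/orP: rr => [/rotation_cycle[_ _ cw _]|/rotation_cycle[_ _ cw _]].
  move: cw pw; rewrite /= !rcons_path => /andP[_ s1] /andP[_ s2].
  apply: succ_inj s1 s2 => //.
  case/lastP: (w) aw => //= w' y; last by rewrite last_rcons all_rcons => /andP[/eqP].
move: cw pw; rewrite -rot1_cons rot_cycle /= => cw.
case: w sw aw cw => [|y w] /= sw; first by move: n0_gt2; rewrite -(ltn_predK n0_gt2) -sw.
by case/andP=> /eqP ly _ /andP[s1 _] /andP[s2 _]; apply: pred_inj s2 s1.
Qed.

(** The prescribed values, extended by zero to all tuples of basis elements. *)
Definition seed w : A :=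
  if w is p :: _ then if rotation w then V *: bas B (lunit B p) else 0 else 0.

Lemma seed_cocycle w (i j : qpath) : size w = n0.+1 -> koszul B None w -> ends B i j w ->
  hoch mul (mext seed) (map (bas B) w) = 0.
Proof.
case: w => // p w; case/lastP: w => [|w q] [sw] kw ew; first by move: n0_gt2; rewrite -sw.
rewrite size_rcons in sw.
have [pw] := path_dual_succ kw ew; rewrite /= all_rcons => /and3P[lp /eqP lq lw].
have s0 : size w = n0.-1 by rewrite -sw.
have alw : all (fun p => plen p == 1%N) (p :: w) by rewrite /= lp.
have rs := rotation_shift s0 lq pw alw.
rewrite hoch_bas (hochr_koszul (o := None)) ?belast_rcons ?last_rcons //; last first.
  exact: multilinear_mext.
rewrite !mext_bas; case: w s0 rs sw {kw ew lw alw} pw => [|y w] s0 rs sw pw.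
  by move: n0_gt2; rewrite -sw.
rewrite [rcons (y :: w) q]/= /seed.
case: (boolP (rotation (p :: y :: w))) rs => [rp|np] rs.
  have [pq [_ rq]] := rs isT; rewrite -[y :: rcons w q]/(rcons (y :: w) q) rq -pq.
  have yp : lunit B y = runit B p by case/andP: pw => /andP[/eqP].
  rewrite yp scale_bas_runit scale_bas_lunit; exact: lmod_char2.
case: (boolP (rotation (y :: rcons w q))) rs => [rq|nq] rs.
  by have [_ [h _]] := rs isT; rewrite ?h in np *.
by rewrite (bilinear0r (@bprod_linr _ _ B)) (bilinear0l (@bprod_linl _ _ B)) addr0.
Qed.

Lemma seed_size w : size w != n0 -> seed w = 0.
Proof.
case: w => // p w sw; rewrite /seed; case: ifP => // /rotation_cycle[e].
by rewrite e eqxx in sw.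
Qed.

Lemma cycle_ends p w : cycle dual_succ (p :: w) -> ends B (lunit B p) (lunit B p) (p :: w).
Proof.
rewrite /= eqxx /=.
suff gen q : path dual_succ q (rcons w p) -> ends B (runit B q) (lunit B p) w by apply: gen.
elim: w q => [|y w IH] q /=; first by case/andP => /andP[].
by case/andP=> /andP[/eqP -> _] /IH ->; rewrite eqxx.
Qed.

Section Graded.
Variables (G : zmodType) (v : 'I_2 -> G) (g : bool -> 'I_N -> G) (e : G).
Notation kdeg := (kdeg v).
Notation pdeg := (pdeg (r := r) g).
Notation sits := (sits B kdeg pdeg e).
Notation homog := (homog B kdeg pdeg e).
Hypothesis pdeg_bmul : forall p q s, bmul B p q = Some s -> pdeg s = pdeg p + pdeg q.

Let pdeg_blen0 p : blen B p = 0%N -> pdeg p = 0.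
Proof. by rewrite blenE; apply: pdeg_unit. Qed.

Lemma seed_sits w : \sum_(p <- W) pdeg p + e *~ (n0%:Z - 2) = v k -> sits (seed w) w 2.
Proof.
move=> hV; case: w => [|p w] q; first by rewrite /seed mcoeff0 eqxx; split=> //; apply: kdeg0.
rewrite /seed; case: ifP => [rw|_]; last by rewrite mcoeff0 eqxx; split=> //; apply: kdeg0.
have [sw _ cw pw] := rotation_cycle rw.
rewrite mcoeffZ mcoeff_bas; case: (eqVneq (lunit B p) q) => [<-|_]; last first.
  by rewrite mulr0 eqxx; split=> //; apply: kdeg0.
have l0 := blen_lunit B p.
split=> [|_]; last by rewrite lunit_id // runit_id //; apply: cycle_ends.
by rewrite mulr1 degwE sw pdeg_blen0 // subr0 (perm_big _ pw) hV; apply: kdegU.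
Qed.

(** The second condition on degrees makes the values vanish on generators with an
   idempotent among them, where the obstruction argument prescribes nothing. *)
Theorem cyclic_deformation_exists :
  \sum_(p <- W) pdeg p + e *~ (n0%:Z - 2) = v k ->
  (forall x w, sits x w 3 -> koszul B None w -> (n0.+1 < size w)%N -> x = 0) ->
  (forall x w, sits x w 2 -> size w = n0 ->
     all (fun p => plen p <= 1)%N w -> has (fun p => plen p == 0)%N w -> x = 0) ->
  exists mu, [/\ ainf_deformation mul mu, idem_unital mul mu, homog 2 mu,
    forall a, (2 < size a < n0)%N -> mu a = 0 & cyclic_values mul mu W V].
Proof.
move=> hV obs unit.
have [|mu [[muL mu1 mu2] [hmu mu0] mumu mus muW]] := @deformation_exists _ _ B G kdeg pdeg e
  (kdeg0 v) (kdeg1 v) (@kdegD _ v) (@kdegM _ v) pdeg_bmul pdeg_blen0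
  (@lmod_char2 _) n0 seed n0_gt2 (fun w => @seed_sits w hV) seed_size seed_cocycle obs.
- move=> x w hx sw w1 w0; apply: (unit x w hx sw).
    by apply: sub_all w1 => p; rewrite blenE.
  by apply: sub_has w0 => p; rewrite blenE.
exists mu; split=> //.
- by split=> //; split=> // a; rewrite insertionsE.
- exact: composable_unital (homog_typed hmu).
split=> [m p t i rm|u su ug ur].
  have rw : rotation (p :: t) by apply/rotationP; exists m.
  have [sw aw _ _] := rotation_cycle rw; rewrite initialE => /eqP li.
  rewrite -basEw muW // /seed ?rw ?basE ?lunitE ?li //.
  by apply: sub_all aw => q; rewrite blenE => /eqP ->.
rewrite -basEw muW //; last by apply: sub_all ug => q; rewrite blenE.
rewrite /seed; case: u su ug ur => // p u _ _ ur.
by case: rotationP => // -[m em]; have := ur m; rewrite em eqxx.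
Qed.

Variables (mu nu : seq A -> A).

(** [nodiff] says that no monomial times a path has the degree of [mu_1 p], so that
   [mu_1 = 0]. *)
Lemma cyclic_deformation_props (nu' : seq A -> A) :
  (forall p q m, vdeg v m + pdeg q <> pdeg p - e) ->
  ainf_deformation mul nu' -> idem_unital mul nu' ->
  graded v g (fun n => e *~ (n%:Z - 2)) nu' ->
  [/\ extends_mul mul (cut nu'), forall a, ins (cut nu') (cut nu') a = 0
    & homog 2 (cut nu')].
Proof.
move=> nodiff [[nL nn] n2] nun ngr.
have cL := multilinear_cut nL.
have n1 p : nu' [:: elt p] = 0.
  apply/malgP => q; apply/malgP => m; rewrite !mcoeff0; apply/eqP.
  apply/negPn/negP => nz; apply: (nodiff p q m).
  have := ngr [:: elt p] [:: pdeg p] isT erefl _ q m nz.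
  rewrite big_seq1 term_degE [e *~ _](mulrN1z e) => h; apply: h => -[] //= _.
  exact: homogeneous_elt.
have n1' : forall a, size a = 1%N -> nu' a = 0.
  apply: (@multilinear_eq _ _ B nu' (fun=> 0)) => //.
    by move=> ? ? ? ? ?; rewrite scaler0 addr0.
  by case=> [|p []] //= _; rewrite basE n1.
have cE : extends_mul mul (cut nu') by split=> // -[|x [|y a]] // _; apply: n1'.
have cc a : ins (cut nu') (cut nu') a = 0 by rewrite ins_cut -insertions_cut // nn.
have ct : typed B (cut nu').
  apply: typed_ainf => // w nw; rewrite /cut; case: w nw => // p w.
  exact: unital_composable.
split=> //; apply: (graded_homog basE (sh := fun n => e *~ (n%:Z - 2))) => //.
by move=> [|x a] d //; apply: (ngr (x :: a) d).
Qed.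

Theorem cyclic_deformation_unique :
  (forall p q m, vdeg v m + pdeg q <> pdeg p - e) ->
  (forall x w, sits x w 2 -> koszul B None w -> (n0 < size w)%N -> x = 0) ->
  ainf_deformation mul mu -> idem_unital mul mu ->
  graded v g (fun n => e *~ (n%:Z - 2)) mu ->
  (forall a, (2 < size a < n0)%N -> mu a = 0) -> cyclic_values mul mu W V ->
  ainf_deformation mul nu -> idem_unital mul nu ->
  graded v g (fun n => e *~ (n%:Z - 2)) nu ->
  (forall a, (2 < size a < n0)%N -> nu a = 0) -> cyclic_values mul nu W V ->
  ainf_isomorphic mu nu.
Proof.
move=> nodiff free dmu umu gmu smu vmu dnu unu gnu snu vnu.
have [muE mumu hmu] := cyclic_deformation_props nodiff dmu umu gmu.
have [nuE nunu hnu] := cyclic_deformation_props nodiff dnu unu gnu.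
have [|||f [fL f0 f1] fE] := @deformation_unique _ _ B G kdeg pdeg e
  (kdeg0 v) (kdeg1 v) (@kdegD _ v) (@kdegM _ v) pdeg_bmul pdeg_blen0
  (@lmod_char2 _) n0 (cut mu) (cut nu) n0_gt2 muE nuE hmu hnu mumu nunu.
- by move=> [|x a] // sa; rewrite /cut smu ?snu.
- move=> w sw kw; rewrite basEw; case: w sw kw => // p w sw kw; rewrite /cut /=.
  have gw : all is_generator (p :: w).
    elim: (p :: w) None kw {sw} => // q u IH o /and3P[lq _ /IH gu].
    by rewrite /= gu andbT /is_generator -/(plen q) -blenE (eqP lq).
  case: (boolP (rotation (p :: w))) => [/rotationP[m em]|nr].
    have ip : initial_idem mul p (lv p) by rewrite initialE.
    have [h1 _] := vmu; have [h2 _] := vnu.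
    by rewrite (h1 m p w _ (esym em) ip) (h2 m p w _ (esym em) ip).
  have nrot m : (p :: w) != rot m W by apply: contra nr => /eqP em; apply/rotationP; exists m.
  by have [_ h1] := vmu; have [_ h2] := vnu; rewrite (h1 _ sw gw nrot) (h2 _ sw gw nrot).
- by [].
exists f; last by exists id => x; rewrite f1.
apply: ainf_morphismP => // a; have := fE a.
by move/(congr1 (fun x => x + ins f (cut mu) a)); rewrite -addrA lmod_char2 addr0 add0r.
Qed.

End Graded.

End CyclicDeformations.

(** * Letters and cyclic words *)

Section Letters.
Variables (N : nat) (r : rel bool).
Notation qpath := (qpath N r).
Implicit Types (p q : qpath) (i j : 'I_N) (b c : bool).

Lemma letterP p : plen p = 1%N -> exists b i, p = arrow r b i.
Proof.
rewrite /plen => lp; exists (head true (word p)), (src p).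
by apply: qpath_eq => //; case: (word p) lp => [|b []].
Qed.

Lemma step_inj b : injective (fun i => step i b).
Proof. by case: b => // i j /ordS_inj. Qed.

Lemma initial_idem_qmul p i : initial_idem (@qmul N r) p i = (src p == i).
Proof.
rewrite /initial_idem idem_mul [src p == i]eq_sym.
by case: (i == src p); rewrite ?elt_neq0 ?eqxx.
Qed.

Lemma final_idem_qmul p i : final_idem (@qmul N r) p i = (tgt p == i).
Proof. by rewrite /final_idem mul_idem; case: (tgt p == i); rewrite ?elt_neq0 ?eqxx. Qed.

Lemma dual_succ_arrow b c i j :
  dual_succ (path_algebra N r) (arrow r b i) (arrow r c j) = (step i b == j) && ~~ r b c.
Proof.
rewrite /dual_succ /= isSome_pcat /= andbT /tgt /= /src /=.
have -> : (pright (arrow r b i) == pleft (arrow r c j)) = (step i b == j).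
  by apply/eqP/eqP => [/idem_inj|]; rewrite /pright /pleft /tgt /src //= => ->.
by case: (step i b == j).
Qed.

Lemma dual_succ_op_arrow b c i j :
  dual_succ (path_algebra_op N r) (arrow r b i) (arrow r c j) = (step j c == i) && ~~ r c b.
Proof.
rewrite /dual_succ /= isSome_pcat /= andbT /tgt /= /src /=.
have -> : (pleft (arrow r b i) == pright (arrow r c j)) = (step j c == i).
  by apply/eqP/eqP => [/idem_inj|]; rewrite /pright /pleft /tgt /src //= => ->.
by case: (step j c == i).
Qed.

End Letters.

Lemma path_map_iota (T : Type) (R : rel T) (f : nat -> T) m n :
  (forall k, (m <= k < m + n)%N -> R (f k) (f k.+1)) ->
  path R (f m) [seq f k | k <- iota m.+1 n].
Proof.
elim: n m => //= n IH m e; rewrite e /=; last by rewrite leqnn addnS ltnS leq_addr.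
by apply: IH => k /andP[mk kn]; apply: e; rewrite (ltnW mk) addnS -addSn.
Qed.

Lemma cycle_mkseq (T : Type) (R : rel T) (f : nat -> T) n : f n.+1 = f 0%N ->
  (forall k, (k <= n)%N -> R (f k) (f k.+1)) -> cycle R (mkseq f n.+1).
Proof.
move=> fn fR; rewrite /mkseq /=.
have -> : rcons [seq f i | i <- iota 1 n] (f 0%N) = [seq f i | i <- iota 1 n.+1].
  by rewrite -[n.+1]addn1 iotaD map_cat cats1 add1n fn.
by apply: path_map_iota => k; rewrite add0n ltnS => /fR.
Qed.

Lemma enum_inord M : enum 'I_M.+1 = [seq inord k | k <- iota 0 M.+1].
Proof.
rewrite -val_enum_ord -map_comp -[LHS]map_id; apply: eq_map => i /=.
by rewrite inord_val.
Qed.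

Lemma ordS_inord M k : ordS (inord (k %% M.+1) : 'I_M.+1) = inord (k.+1 %% M.+1).
Proof.
apply: val_inj; rewrite /= !inordK ?ltn_mod //.
by rewrite -addn1 modnDml addn1.
Qed.

(** * Degrees *)

Section IntDegree.
Variables (N : nat) (r : rel bool).
Notation qpath := (qpath N r).

Definition lenw (w : seq qpath) : nat := \sum_(p <- w) plen p.

Lemma degeq_const v g (e d : int) w c m p : (forall b i, g b i = d) ->
  degeq v g e w c m p ->
  v ord0 * (m ord0)%:Z + v ord_max * (m ord_max)%:Z =
  d * (lenw w)%:Z + e * (size w)%:Z - e * c - d * (plen p)%:Z.
Proof.
move=> gd.
have pd q : pdeg g q = d * (plen q)%:Z.
  rewrite /pdeg /plen; elim: (word q) (src q) => [|b u IH] i /=; first by rewrite mulr0.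
  by rewrite gd IH intS mulrDr mulr1.
have dw : degw (pdeg g) e w = d * (lenw w)%:Z + e * (size w)%:Z.
  rewrite /degw /lenw; elim: w => [|q w IH]; first by rewrite !big_nil !mulr0.
  by rewrite !big_cons IH pd [size _]/= intS PoszD; ring.
have nz (x : int) n : x *+ n = x * n%:Z by rewrite -mulr_natr natz.
rewrite /degeq pd dw /vdeg big_ord_recl big_ord1 !nz mulrzz.
by rewrite (_ : lift ord0 ord0 = ord_max) //; apply: val_inj.
Qed.

End IntDegree.

Section Counting.
Variables (N : nat) (r : rel bool) (B : monomial_algebra baseR (qpath N r)).
Hypothesis blenE : forall p, blen B p = plen p.
Implicit Types (w : seq (qpath N r)).

Lemma sits_eq0 (G : zmodType) (v : 'I_2 -> G) (g : bool -> 'I_N -> G) e x w c :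
  (forall p m, ends B (lunit B p) (runit B p) w -> ~ degeq v g e w c m p) ->
  sits B (kdeg v) (pdeg (r := r) g) e x w c -> x = 0.
Proof.
move=> nd hx; apply/malgP => p; apply/malgP => m; rewrite !mcoeff0; apply/eqP.
apply/negPn/negP => nz; have [h1 h2] := hx p; apply: (nd p m); last exact: h1.
by apply: h2; apply: contraNneq nz => ->; rewrite mcoeff0.
Qed.

Lemma lenw_letters w : all (fun p => plen p == 1%N) w -> lenw w = size w.
Proof.
rewrite /lenw; elim: w => [|p w IH] /=; first by rewrite big_nil.
by case/andP=> /eqP lp /IH; rewrite big_cons lp => ->.
Qed.

Lemma lenw_unit w : all (fun p => plen p <= 1)%N w -> has (fun p => plen p == 0)%N w ->
  (lenw w < size w)%N.
Proof.
have le u : all (fun p : qpath N r => plen p <= 1)%N u -> (lenw u <= size u)%N.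
  rewrite /lenw; elim: u => [|p u IH] /=; first by rewrite big_nil.
  by case/andP=> lp /IH; rewrite big_cons -[(size u).+1]add1n => /(leq_add lp).
rewrite /lenw; elim: w => [|p w IH] //= /andP[lp aw]; rewrite big_cons ltnS.
case/orP=> [/eqP ->|/(IH aw) hw]; first exact: le.
by have := leq_add lp hw; rewrite addnS add1n ltnS.
Qed.

Lemma koszul_letters o w : koszul B o w -> all (fun p => plen p == 1%N) w.
Proof. by elim: w o => //= p w IH o; rewrite blenE => /and3P[-> _ /IH]. Qed.

End Counting.

Lemma len_is_additive n : {morph @len n : x y / x - y}.
Proof. by move=> x y; rewrite /len -sumrB; apply: eq_bigr => j _; rewrite !mxE. Qed.

HB.instance Definition _ n :=
  GRing.isZmodMorphism.Build 'rV[int]_n int (@len n) (@len_is_additive n).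

Lemma len_h N j : (0 < j <= 2 * N)%N -> len (h N j) = 1.
Proof.
case/andP=> j0 jN; have lj : (j.-1 < 2 * N)%N by rewrite prednK.
rewrite /len (bigD1 (Ordinal lj)) //= mxE /= prednK // eqxx big1 ?addr0 // => i ij.
rewrite mxE; case: eqP => // e; case/eqP: ij; apply: val_inj => /=.
by rewrite -e.
Qed.

Lemma nodiff_degeq N r (G : zmodType) (v : 'I_2 -> G) (g : bool -> 'I_N -> G) e :
  (forall p q m, ~ degeq (r := r) v g e [:: p] 2 m q) ->
  forall (p q : qpath N r) m, vdeg v m + pdeg g q <> pdeg g p - e.
Proof.
move=> nd p q m h; apply: (nd p q m); rewrite /degeq /degw big_seq1.
rewrite -[e *~ 2]/(e + e) opprD addrA addrK -h; exact: esym (addrK _ _).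
Qed.

(** * The algebra [A_0] *)

(** In the arithmetic lemmas [a] and [b] are the exponents of [V_0] and [V_{N+1}],
   [s] is the number of inputs, and [P] is the length of the path in the value. *)
Lemma A0_free_arith (N a b s P : nat) : (2 < N)%N ->
  (2 * N)%:Z * a%:Z + N%:Z * b%:Z = s%:Z - P%:Z ->
  ((2 * N)%:Z - 2) * a%:Z + 2 * b%:Z = s%:Z - 2 -> (s <= 2 * N)%N.
Proof.
move=> N2 h1 h2.
have h : (2 * a + (N - 2) * b + P = 2)%N by nia.
case: a h h1 h2 => [|[|a]] h h1 h2.
- case: b h h1 h2 => [|[|[|b]]] h h1 h2; nia.
- case: b h h1 h2 => [|b] h h1 h2; nia.
- nia.
Qed.

Lemma A0_obs_arith (N a s P : nat) : (2 < N)%N ->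
  (2 * N)%:Z * a%:Z = s%:Z - P%:Z ->
  ((2 * N)%:Z - 2) * a%:Z = s%:Z - 3 -> (s <= (2 * N).+1)%N.
Proof.
move=> N2 h1 h2.
have h : (2 * a + P = 3)%N by nia.
case: a h h1 h2 => [|[|a]] h h1 h2; nia.
Qed.

(** Here [L] is the total length of [2N] inputs, which is less than [2N] if one of
   these generators is an idempotent. *)
Lemma A0_unit_arith (N a L P : nat) : (2 < N)%N ->
  (2 * N)%:Z * a%:Z = L%:Z - P%:Z ->
  ((2 * N)%:Z - 2) * a%:Z = (2 * N)%:Z - 2 -> (2 * N <= L)%N.
Proof.
move=> N2 h1 h2; case: a h1 h2 => [|a] h1 h2; nia.
Qed.

Lemma A0_nodiff_arith (N a b : nat) : (2 < N)%N ->
  ((2 * N)%:Z - 2) * a%:Z + 2 * b%:Z = -1 -> False.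
Proof. move=> N2; nia. Qed.

Section A0.
Variable N : nat.
Hypothesis N_gt2 : (2 < N)%N.
Let r (b c : bool) := b == c.
Notation qpath := (qpath N r).
Notation B := (path_algebra N r).

Lemma A0_succ_inj (p q q' : qpath) : plen p = 1%N -> plen q = 1%N -> plen q' = 1%N ->
  dual_succ B p q -> dual_succ B p q' -> q = q'.
Proof.
move=> /letterP[b [i ->]] /letterP[c [j ->]] /letterP[c' [j' ->]].
rewrite !dual_succ_arrow => /andP[/eqP <- bc] /andP[/eqP <- bc'].
by congr arrow; move: bc bc'; rewrite /r; case: b c c' => [] [] [].
Qed.

Lemma A0_pred_inj (p p' q : qpath) : plen p = 1%N -> plen p' = 1%N -> plen q = 1%N ->
  dual_succ B p q -> dual_succ B p' q -> p = p'.
Proof.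
move=> /letterP[b [i ->]] /letterP[b' [i' ->]] /letterP[c [j ->]].
rewrite !dual_succ_arrow => /andP[/eqP <- bc] /andP[/eqP e bc'].
have bb : b = b' by move: bc bc'; rewrite /r; case: b b' c {e} => [] [] [].
by congr arrow => //; apply: (@step_inj N b); rewrite -e bb.
Qed.

Lemma A0_wordE M : A0_word M.+1 =
  mkseq (fun k => arrow _ (odd k) (inord (k./2 %% M.+1))) (2 * M.+1).
Proof.
rewrite /A0_word enum_inord -map_comp.
have gen n : (n <= M.+1)%N -> flatten [seq ((fun i : 'I_M.+1 =>
    [:: arrow (fun b c => b == c) false i; arrow _ true i]) \o inord) k | k <- iota 0 n] =
    mkseq (fun k => arrow _ (odd k) (inord (k./2 %% M.+1))) (2 * n).
  elim: n => // n IH nM; rewrite -[n.+1]addn1 iotaD map_cat flatten_cat IH ?(ltnW nM) //.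
  rewrite mulnDr muln1 /mkseq iotaD map_cat add0n; congr (_ ++ _) => /=.
  by rewrite mul2n odd_double doubleK uphalf_double modn_small.
exact: gen.
Qed.

Lemma A0_word_size : size (A0_word N) = (2 * N)%N.
Proof. by case: N N_gt2 => // M _; rewrite A0_wordE size_mkseq. Qed.

Lemma A0_word_letter : all (fun p => plen p == 1%N) (A0_word N).
Proof. by rewrite /A0_word; elim: (enum 'I_N). Qed.

Lemma A0_word_cycle : cycle (dual_succ B) (A0_word N).
Proof.
rewrite /B /r; case: N N_gt2 => // M _; rewrite A0_wordE.
have -> : (2 * M.+1 = (2 * M).+1.+1)%N by rewrite mulnS.
apply: cycle_mkseq.
  rewrite -[(2 * M).+2]/(2 + 2 * M)%N -mulnS mul2n odd_double doubleK modnn.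
  by rewrite mod0n.
move=> k _; rewrite dual_succ_arrow /step /=; case ok: (odd k) => /=.
  have -> : uphalf k = (k./2).+1 by rewrite uphalf_half ok.
  by rewrite ordS_inord eqxx.
by rewrite uphalf_half ok add0n eqxx.
Qed.

Definition A0_lenV i := len (alexV N i).
Definition A0_len (b : bool) (i : 'I_N) := len (alex_arrow b i).

Lemma A0_lenE b i : A0_len b i = 1.
Proof.
rewrite /A0_len /alex_arrow; have := ltn_ord i.
by case: b => iN; apply: len_h; lia.
Qed.

Lemma A0_lenV0 : A0_lenV ord0 = (2 * N)%:Z.
Proof.
rewrite /A0_lenV /alexV eqxx raddf_sum /= big_nat (eq_bigr (fun=> 1)).
  by rewrite -big_nat sumr_const_nat subn1 /= -mulr_natr mul1r natz.
by move=> j /andP[j0 jN]; rewrite len_h // j0.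
Qed.

Lemma A0_lenV1 : A0_lenV ord_max = N%:Z.
Proof.
rewrite /A0_lenV /alexV raddf_sum /= big_nat (eq_bigr (fun=> 1)).
  by rewrite -big_nat sumr_const_nat subn1 /= -mulr_natr mul1r natz.
by move=> j /andP[j0 jN]; rewrite len_h //; lia.
Qed.

Notation v2 := (fun i => (A0_lenV i, A0_maslovV N i)).
Notation g2 := (fun b i => (A0_len b i, 0 : int)).
Notation e2 := ((0, 1) : int * int).

(* The third component counts the factors V_{N+1}: in a structure that is homogeneous *)
(* of degree zero for it, all coefficients are polynomials in V_0. *)
Notation v3 := (fun i => (v2 i, ((i == ord_max)%:R : int))).
Notation g3 := (fun b i => (g2 b i, 0 : int)).
Notation e3 := (e2, 0 : int).

Lemma A0_degrees (w : seq qpath) c m p : degeq v2 g2 e2 w c m p ->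
  (2 * N)%:Z * (m ord0)%:Z + N%:Z * (m ord_max)%:Z = (lenw w)%:Z - (plen p)%:Z /\
  ((2 * N)%:Z - 2) * (m ord0)%:Z + 2 * (m ord_max)%:Z = (size w)%:Z - c.
Proof.
move=> hd.
have h1 : degeq A0_lenV A0_len 0 w c m p by apply: (degeq_map (phi := fst) _ _ _ hd).
have h2 : degeq (A0_maslovV N) (fun _ _ => 0) 1 w c m p.
  by apply: (degeq_map (phi := snd) _ _ _ hd).
move/(degeq_const A0_lenE): h1; rewrite A0_lenV0 A0_lenV1 => h1.
move/(degeq_const (fun _ => fun=> erefl)): h2; rewrite /A0_maslovV /= => h2.
by rewrite !mul1r !mul0r ?addr0 ?subr0 ?add0r in h1 h2; split.
Qed.

Lemma A0_free x (w : seq qpath) : sits B (kdeg v2) (pdeg (r := r) g2) e2 x w 2 ->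
  koszul B None w -> (2 * N < size w)%N -> x = 0.
Proof.
move=> hx kw sw; apply: sits_eq0 hx => p m _ /A0_degrees[].
rewrite (lenw_letters (koszul_letters _ kw)) // => h1 h2.
by have := A0_free_arith N_gt2 h1 h2; rewrite leqNgt sw.
Qed.

Lemma A0_degrees3 (w : seq qpath) c m p : degeq v3 g3 e3 w c m p ->
  (2 * N)%:Z * (m ord0)%:Z = (lenw w)%:Z - (plen p)%:Z /\
  ((2 * N)%:Z - 2) * (m ord0)%:Z = (size w)%:Z - c.
Proof.
move=> hd.
have /A0_degrees[] : degeq v2 g2 e2 w c m p by apply: (degeq_map (phi := fst) _ _ _ hd).
have : degeq (fun i : 'I_2 => ((i == ord_max)%:R : int)) (fun _ _ => 0) 0 w c m p.
  by apply: (degeq_map (phi := snd) _ _ _ hd).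
move/(degeq_const (fun _ => fun=> erefl)); rewrite /= !mul0r add0r mul1r addr0 !subr0 => ->.
by rewrite !mulr0 !addr0.
Qed.

Lemma A0_obstruction x (w : seq qpath) : sits B (kdeg v3) (pdeg (r := r) g3) e3 x w 3 ->
  koszul B None w -> ((2 * N).+1 < size w)%N -> x = 0.
Proof.
move=> hx kw sw; apply: sits_eq0 hx => p m _ /A0_degrees3[].
rewrite (lenw_letters (koszul_letters _ kw)) // => h1 h2.
by have := A0_obs_arith N_gt2 h1 h2; rewrite leqNgt sw.
Qed.

Lemma A0_unit x (w : seq qpath) : sits B (kdeg v3) (pdeg (r := r) g3) e3 x w 2 ->
  size w = (2 * N)%N -> all (fun p => plen p <= 1)%N w ->
  has (fun p => plen p == 0)%N w -> x = 0.
Proof.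
move=> hx sw w1 w0; apply: sits_eq0 hx => p m _ /A0_degrees3[] h1.
rewrite sw => /(A0_unit_arith N_gt2 h1); rewrite -sw leqNgt.
by rewrite lenw_unit.
Qed.

Theorem A0_unique (mu nu : seq (A0 N) -> A0 N) :
  A0_deformation mu -> A0_deformation nu -> ainf_isomorphic mu nu.
Proof.
have gr2 mu' : graded (fun e => len (alexV N e)) (fun b i => len (alex_arrow b i))
        (fun=> 0) mu' /\ graded (A0_maslovV N) (fun _ _ => 0) maslov_shift mu' ->
    graded v2 g2 (fun n => e2 *~ (n%:Z - 2)) mu'.
  case=> gl gm; apply: eq_graded (graded_pair gl gm) => n.
  apply: injective_projections; first by rewrite raddfMz /= mul0rz.
  by rewrite raddfMz /= intz.
case=> dmu umu /gr2 gmu smu vmu [dnu unu /gr2 gnu snu vnu].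
have W2 : (2 < size (A0_word N))%N by rewrite A0_word_size; lia.
apply: (@cyclic_deformation_unique N r B (@src N r) (@tgt N r) (fun=> erefl) (fun=> erefl)
  (fun=> erefl) (fun=> erefl) (@initial_idem_qmul N r) (@final_idem_qmul N r)
  (A0_word N) ord0 W2 _ v2 g2 e2 (@pdeg_pcat N r _ g2) mu nu) => //.
- apply: nodiff_degeq => p q m /A0_degrees[_]; apply: A0_nodiff_arith N_gt2.
- by move=> x w hx kw; rewrite A0_word_size; apply: A0_free hx kw.
- by move=> a; rewrite A0_word_size; apply: smu.
- by move=> a; rewrite A0_word_size; apply: snu.
Qed.

Theorem A0_exists : exists mu : seq (A0 N) -> A0 N, A0_deformation mu.
Proof.
have W2 : (2 < size (A0_word N))%N by rewrite A0_word_size; lia.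
have [|||mu [dmu umu hmu smu vmu]] := @cyclic_deformation_exists N r B (@src N r) (@tgt N r)
  (fun=> erefl) (fun=> erefl) (fun=> erefl) (fun=> erefl)
  (@initial_idem_qmul N r) (@final_idem_qmul N r)
  (A0_word N) ord0 W2 A0_word_letter A0_word_cycle A0_succ_inj A0_pred_inj
  _ v3 g3 e3 (@pdeg_pcat N r _ g3).
- have -> : \sum_(p <- A0_word N) pdeg g3 p = ((size (A0_word N))%:Z, 0, 0).
    elim: (A0_word N) A0_word_letter => [|p w IH] /=; first by rewrite big_nil.
    case/andP=> /eqP/letterP[b [i ->]] /IH; rewrite big_cons => ->.
    by rewrite /pdeg /= A0_lenE addr0 intS.
  rewrite A0_word_size; apply: injective_projections; rewrite raddfD raddfMz /=.
    apply: injective_projections; rewrite raddfD raddfMz /= ?mul0rz ?addr0 ?A0_lenV0 //.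
    by rewrite add0r intz.
  by rewrite mul0rz.
- by move=> x w hx kw; rewrite A0_word_size; apply: A0_obstruction hx kw.
- by move=> x w hx; rewrite A0_word_size; apply: A0_unit hx.
have [[muL _] _] := dmu.
exists mu; split=> //; last by move=> a; rewrite -A0_word_size; apply: smu.
split.
  apply: (homog_graded (B := B) (e := 0)) => //; first by move=> n; rewrite mul0rz.
  by apply: (homog_map (phi := fst \o fst) _ _ _ hmu).
apply: (homog_graded (B := B) (e := 1)) => //; first by move=> n; rewrite intz.
by apply: (homog_map (phi := snd \o fst) _ _ _ hmu).
Qed.

End A0.

(** * The algebra [B_0] *)

(** On a Koszul tuple of [s] letters, all [rho] or all [sigma], the first two equations
   count the letters [rho] and [sigma]; [P] and [Q] are their numbers in the path of the
   value, which differ by at most one. *)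
Lemma B0_rho_arith (N a b s P Q : nat) (c : int) : (2 < N)%N -> 1 < c ->
  N%:Z * a%:Z = s%:Z - P%:Z -> N%:Z * a%:Z + N%:Z * b%:Z = 0 - Q%:Z ->
  ((2 * N)%:Z - 2) * a%:Z - 2 * b%:Z = - s%:Z + s%:Z - c + (P + Q)%:Z ->
  (P <= Q.+1)%N -> False.
Proof.
move=> N2 c1 h1 h2 h3 PQ.
have [a0 [b0 Q0]] : (a = 0 /\ b = 0 /\ Q = 0)%N by nia.
by subst; lia.
Qed.

Lemma B0_sigma_arith (N a b s P Q : nat) (c : int) : (2 < N)%N -> 1 < c -> c <= 3 ->
  N%:Z * a%:Z = 0 - P%:Z -> N%:Z * a%:Z + N%:Z * b%:Z = s%:Z - Q%:Z ->
  ((2 * N)%:Z - 2) * a%:Z - 2 * b%:Z = - s%:Z + s%:Z - c + (P + Q)%:Z ->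
  (Q <= P.+1)%N -> s%:Z = N%:Z + c - 2.
Proof.
move=> N2 c1 c3 h1 h2 h3 PQ.
have [a0 P0] : (a = 0 /\ P = 0)%N by nia.
have b1 : b = 1%N by subst; lia.
by subst; nia.
Qed.

(** In the next two lemmas [L] is the total length of the inputs. *)
Lemma B0_unit_arith (N a b L P : nat) : (2 < N)%N -> (L < N)%N ->
  (2 * N)%:Z * a%:Z + N%:Z * b%:Z = L%:Z - P%:Z ->
  ((2 * N)%:Z - 2) * a%:Z - 2 * b%:Z = - L%:Z + N%:Z - 2 + P%:Z -> False.
Proof.
move=> N2 LN h1 h3; have [a0 b0] : (a = 0 /\ b = 0)%N by nia.
by subst; lia.
Qed.

Lemma B0_nodiff_arith (N a b L P : nat) : (2 < N)%N ->
  (2 * N)%:Z * a%:Z + N%:Z * b%:Z = L%:Z - P%:Z ->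
  ((2 * N)%:Z - 2) * a%:Z - 2 * b%:Z = - L%:Z - 1 + P%:Z -> False.
Proof. by move=> N2 h1 h3; nia. Qed.

(** [h_{2i-1}], the degree of [rho_i], is the coordinate [2i-2], and [h_{2i}] is the
   coordinate [2i-1]: the parity of the coordinate tells [rho] from [sigma]. *)
Definition cnt N (b : bool) (x : 'rV[int]_(2 * N)) : int :=
  \sum_(k < 2 * N | odd k == b) x 0 k.

Lemma cnt_is_additive N b : {morph @cnt N b : x y / x - y}.
Proof. by move=> x y; rewrite /cnt -sumrB; apply: eq_bigr => j _; rewrite !mxE. Qed.

HB.instance Definition _ N b :=
  GRing.isZmodMorphism.Build 'rV[int]_(2 * N) int (@cnt N b) (@cnt_is_additive N b).

Lemma cnt_h N b j : (j < 2 * N)%N -> cnt b (h N j.+1) = (odd j == b)%:R.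
Proof.
move=> lj; rewrite /cnt; case: (eqVneq (odd j) b) => ob.
  rewrite (bigD1 (Ordinal lj)) /= ?ob // mxE /= eqxx big1 ?addr0 // => i /andP[_ ij].
  by rewrite mxE eqSS; case: eqP => // e; case/eqP: ij; apply: val_inj.
rewrite big1 // => i /eqP oi; rewrite mxE eqSS; case: eqP => // e.
by rewrite -e oi eqxx in ob.
Qed.

Lemma cnt_arrow N b b' (i : 'I_N) : cnt b (alex_arrow b' i) = (b' == b)%:R.
Proof.
rewrite /alex_arrow; have := ltn_ord i; case: b' => iN.
  have -> : (2 * i.+1 = (2 * i).+1.+1)%N by lia.
  by rewrite cnt_h ?oddS ?oddM //; lia.
have -> : (2 * i.+1 - 1 = (2 * i).+1)%N by lia.
by rewrite cnt_h ?oddM //; lia.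
Qed.

Lemma cnt_alexV0 N b : cnt b (alexV N ord0) = N%:Z.
Proof.
rewrite /alexV eqxx raddf_sum /= big_add1 /= big_nat.
rewrite (eq_bigr (fun j => (odd j == b)%:R)) => [|j /andP[_ jN]]; last exact: cnt_h.
rewrite -big_nat; elim: N => [|N IH]; first by rewrite big_geq.
have -> : (2 * N.+1 = (2 * N).+2)%N by lia.
rewrite !big_nat_recr //= IH oddM /= intS.
by case: b {IH}; rewrite ?addr0 addrC.
Qed.

Lemma cnt_alexV1 N b : cnt b (alexV N ord_max) = if b then N%:Z else 0.
Proof.
rewrite /alexV raddf_sum /= big_add1 /= big_nat.
rewrite (eq_bigr (fun=> (b : nat)%:Z)) => [|j /andP[_ jN]].
  rewrite -big_nat sumr_const_nat subn0 -mulr_natr natz.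
  by case: b; rewrite ?mul0r ?mul1r.
have -> : (2 * j.+1 = (2 * j).+1.+1)%N by lia.
by rewrite cnt_h ?oddS ?oddM /=; [case: b|lia].
Qed.

Section B0.
Variable N : nat.
Hypothesis N_gt2 : (2 < N)%N.
Let r (b c : bool) := b != c.
Notation qpath := (qpath N r).
Notation B := (path_algebra_op N r).

Lemma B0_succ_inj (p q q' : qpath) : plen p = 1%N -> plen q = 1%N -> plen q' = 1%N ->
  dual_succ B p q -> dual_succ B p q' -> q = q'.
Proof.
move=> /letterP[b [i ->]] /letterP[c [j ->]] /letterP[c' [j' ->]].
rewrite !dual_succ_op_arrow => /andP[/eqP <- bc] /andP[/eqP e bc'].
have cc : c = c' by move: bc bc'; rewrite /r !negbK => /eqP -> /eqP ->.
by congr arrow => //; apply: (@step_inj N c); rewrite -e cc.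
Qed.

Lemma B0_pred_inj (p p' q : qpath) : plen p = 1%N -> plen p' = 1%N -> plen q = 1%N ->
  dual_succ B p q -> dual_succ B p' q -> p = p'.
Proof.
move=> /letterP[b [i ->]] /letterP[b' [i' ->]] /letterP[c [j ->]].
rewrite !dual_succ_op_arrow => /andP[/eqP <- bc] /andP[/eqP <- bc'].
by congr arrow; move: bc bc'; rewrite /r !negbK => /eqP <- /eqP <-.
Qed.

Lemma B0_word_size : size (B0_word N) = N.
Proof. by rewrite size_rev size_map size_enum_ord. Qed.

Lemma B0_word_letter : all (fun p => plen p == 1%N) (B0_word N).
Proof. by rewrite all_rev; elim: (enum 'I_N). Qed.

Lemma B0_word_cycle : cycle (dual_succ B) (B0_word N).
Proof.
rewrite rev_cycle; case: N N_gt2 => // M _; rewrite enum_inord.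
have -> : [seq inord k : 'I_M.+1 | k <- iota 0 M.+1] =
    mkseq (fun k => inord (k %% M.+1)) M.+1.
  by apply/eq_in_map => k; rewrite mem_iota add0n => /andP[_ kM]; rewrite modn_small.
rewrite -map_comp; apply: (@cycle_mkseq _ _ (fun k => arrow _ true (inord (k %% M.+1)))).
  by rewrite modnn mod0n.
by move=> k _; rewrite /= dual_succ_op_arrow /step ordS_inord eqxx.
Qed.

Definition count_letters b (w : seq qpath) : nat := \sum_(p <- w) count_mem b (word p).

Lemma degeq_count v (b0 : bool) w c m (p : qpath) :
  degeq v (fun b (i : 'I_N) => ((b == b0)%:R : int)) 0 w c m p ->
  v ord0 * (m ord0)%:Z + v ord_max * (m ord_max)%:Z =
  (count_letters b0 w)%:Z - (count_mem b0 (word p))%:Z.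
Proof.
have pd (q : qpath) : pdeg (fun b (i : 'I_N) => ((b == b0)%:R : int)) q =
    (count_mem b0 (word q))%:Z.
  rewrite /pdeg; elim: (word q) (src q) => [|b u IH] i //=.
  by rewrite IH PoszD; case: (b == b0).
have dw : degw (pdeg (fun b (i : 'I_N) => ((b == b0)%:R : int))) 0 w = (count_letters b0 w)%:Z.
  rewrite /degw /count_letters; elim: w => [|q w IH]; first by rewrite !big_nil.
  by rewrite !big_cons IH pd PoszD addr0.
have nz (x : int) n : x *+ n = x * n%:Z by rewrite -mulr_natr natz.
rewrite /degeq pd dw /vdeg big_ord_recl big_ord1 !nz mul0rz subr0.
by rewrite (_ : lift ord0 ord0 = ord_max) //; apply: val_inj.
Qed.

Notation v2 := (fun i => (B0_maslovV N i, alexV N i)).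
Notation g2 := (fun b i => (- 1 : int, @alex_arrow N b i)).
Notation e2 := ((1, 0) : int * 'rV[int]_(2 * N)).

Lemma B0_degrees (w : seq qpath) c m p : degeq v2 g2 e2 w c m p ->
  [/\ N%:Z * (m ord0)%:Z = (count_letters false w)%:Z - (count_mem false (word p))%:Z,
      N%:Z * (m ord0)%:Z + N%:Z * (m ord_max)%:Z =
        (count_letters true w)%:Z - (count_mem true (word p))%:Z
    & ((2 * N)%:Z - 2) * (m ord0)%:Z - 2 * (m ord_max)%:Z =
        - (lenw w)%:Z + (size w)%:Z - c + (plen p)%:Z].
Proof.
move=> hd.
have h1 : degeq (B0_maslovV N) (fun _ _ => - 1) 1 w c m p.
  by apply: (degeq_map (phi := fst) _ _ _ hd).
have h2 b0 : degeq (fun i => cnt b0 (alexV N i)) (fun b i => ((b == b0)%:R : int)) 0 w c m p.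
  apply: (degeq_map (phi := @cnt N b0 \o snd) _ _ _ hd) => //=.
    by move=> b i; apply: cnt_arrow.
  exact: raddf0.
move/(degeq_const (fun _ => fun=> erefl)): h1; rewrite /B0_maslovV /= => h1.
have := degeq_count (h2 false); rewrite cnt_alexV0 cnt_alexV1 mul0r addr0 => h3.
have := degeq_count (h2 true); rewrite cnt_alexV0 cnt_alexV1 => h4.
split=> //; move: h1; rewrite mulNr => ->.
by rewrite !mulN1r !mul1r opprK.
Qed.

Lemma size_count2 (u : seq bool) : size u = (count_mem false u + count_mem true u)%N.
Proof. by elim: u => //= -[] u ->; rewrite ?addnS ?addSn ?add0n ?add1n. Qed.

Lemma count_alternating b (u : seq bool) : sorted r u ->
  (count_mem b u <= (count_mem (~~ b) u).+1)%N.
Proof.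
have gen c w : path r c w -> (count_mem c w <= count_mem (~~ c) w <= (count_mem c w).+1)%N.
  elim: w c => // d w IH c /=; rewrite {1}/r => /andP[cd /IH].
  by case: c d cd => [] [] //= _; rewrite ?add0n ?add1n !ltnS andbC.
case: u => // c u /gen /andP[h1 h2]; rewrite /=.
by case: b c h1 h2 => [] [] /= h1 h2; lia.
Qed.

Lemma plenE (p : qpath) : plen p = (count_mem false (word p) + count_mem true (word p))%N.
Proof. exact: size_count2. Qed.

Lemma lenwE (w : seq qpath) : lenw w = (count_letters false w + count_letters true w)%N.
Proof. by rewrite /lenw /count_letters -big_split; apply: eq_bigr => p _; apply: plenE. Qed.

(** Only equal letters have product zero. *)
Lemma koszul_constant i j (w : seq qpath) : koszul B None w -> ends B i j w ->
  exists b, count_letters b w = size w /\ count_letters (~~ b) w = 0%N.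
Proof.
case: w => [|p w] kw ew; first by exists true; rewrite /count_letters !big_nil.
have [] := path_dual_succ (B := B) (fun=> erefl) kw ew.
rewrite /count_letters.
elim: w p {kw ew} => [|q w IH] p.
  move=> _ /= /andP[/eqP/letterP[b [k ->]] _]; exists b; rewrite !big_seq1 /=.
  by case: b.
move=> /= /andP[pq pw] /andP[/eqP lp aw].
have [b [h1 h2]] := IH q pw aw; exists b.
case/andP: aw => /eqP lq _.
case/letterP: lp pq => c [k ->]; case/letterP: lq h1 h2 => d [l ->] h1 h2.
rewrite dual_succ_op_arrow => /andP[_]; rewrite /r negbK => /eqP dc.
rewrite !(big_cons _ _ (arrow _ c k)) h1 h2 -dc /=.
by move: h1 h2; rewrite !big_cons /=; case: b d {dc} => [] [].
Qed.

Lemma B0_koszul_degree x (w : seq qpath) c : 1 < c -> c <= 3 ->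
  sits B (kdeg v2) (pdeg (r := r) g2) e2 x w c ->
  koszul B None w -> (N%:Z + c - 2 < (size w)%:Z) -> x = 0.
Proof.
move=> c1 c3 hx kw sw; apply: sits_eq0 hx => p m ew /B0_degrees[].
rewrite (lenw_letters (koszul_letters _ kw)) //.
have [[] [-> ->]] := koszul_constant kw ew; rewrite plenE => h1 h2 h3.
  have e := B0_sigma_arith N_gt2 c1 c3 h1 h2 h3 (count_alternating true (word_sorted p)).
  by lia.
exact: B0_rho_arith N_gt2 c1 h1 h2 h3 (count_alternating false (word_sorted p)).
Qed.

Lemma B0_length (w : seq qpath) c m p : degeq v2 g2 e2 w c m p ->
  (2 * N)%:Z * (m ord0)%:Z + N%:Z * (m ord_max)%:Z = (lenw w)%:Z - (plen p)%:Z.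
Proof. by case/B0_degrees; rewrite lenwE plenE; lia. Qed.

Lemma B0_unit x (w : seq qpath) : sits B (kdeg v2) (pdeg (r := r) g2) e2 x w 2 ->
  size w = N -> all (fun p => plen p <= 1)%N w ->
  has (fun p => plen p == 0)%N w -> x = 0.
Proof.
move=> hx sw w1 w0; apply: sits_eq0 hx => p m _ hd; have h1 := B0_length hd.
have [_ _ h2] := B0_degrees hd; rewrite sw in h2.
have lN : (lenw w < N)%N by apply: leq_trans (lenw_unit w1 w0) _; rewrite sw.
exact: B0_unit_arith N_gt2 lN h1 h2.
Qed.

Lemma pdeg_pcat_op (G : zmodType) (g : bool -> 'I_N -> G) (p q s : qpath) :
  bmul B p q = Some s -> pdeg g s = pdeg g p + pdeg g q.
Proof. by move/(pdeg_pcat g) ->; rewrite addrC. Qed.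

Lemma initial_idem_op (p : qpath) i : initial_idem (bprod B) p i = (tgt p == i).
Proof. exact: final_idem_qmul. Qed.

Lemma final_idem_op (p : qpath) i : final_idem (bprod B) p i = (src p == i).
Proof. exact: initial_idem_qmul. Qed.

Theorem B0_unique (mu nu : seq (B0 N) -> B0 N) :
  B0_deformation mu -> B0_deformation nu -> ainf_isomorphic mu nu.
Proof.
have gr2 mu' : graded (B0_maslovV N) (fun _ _ => - 1) maslov_shift mu' /\
    graded (alexV N) (@alex_arrow N) (fun=> 0) mu' ->
    graded v2 g2 (fun n => e2 *~ (n%:Z - 2)) mu'.
  case=> gm ga; apply: eq_graded (graded_pair gm ga) => n.
  apply: injective_projections; first by rewrite raddfMz /= intz.
  by rewrite raddfMz /= mul0rz.
case=> dmu umu /gr2 gmu smu vmu [dnu unu /gr2 gnu snu vnu].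
have W2 : (2 < size (B0_word N))%N by rewrite B0_word_size.
apply: (@cyclic_deformation_unique N r B (@tgt N r) (@src N r) (fun=> erefl) (fun=> erefl)
  (fun=> erefl) (fun=> erefl) initial_idem_op final_idem_op
  (B0_word N) ord_max W2 _ v2 g2 e2 (@pdeg_pcat_op _ g2) mu nu) => //.
- apply: nodiff_degeq => p q m hd; have h1 := B0_length hd.
  have [_ _ h2] := B0_degrees hd; apply: (B0_nodiff_arith N_gt2 h1).
  by rewrite h2 /lenw big_seq1 /=; lia.
- move=> x w hx kw; rewrite B0_word_size => sw.
  by apply: (B0_koszul_degree (c := 2)) hx kw _ => //; lia.
- by move=> a; rewrite B0_word_size; apply: smu.
- by move=> a; rewrite B0_word_size; apply: snu.
Qed.

Theorem B0_exists : exists mu : seq (B0 N) -> B0 N, B0_deformation mu.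
Proof.
have W2 : (2 < size (B0_word N))%N by rewrite B0_word_size.
have [|||mu [dmu umu hmu smu vmu]] := @cyclic_deformation_exists N r B (@tgt N r) (@src N r)
  (fun=> erefl) (fun=> erefl) (fun=> erefl) (fun=> erefl)
  initial_idem_op final_idem_op
  (B0_word N) ord_max W2 B0_word_letter B0_word_cycle B0_succ_inj B0_pred_inj
  _ v2 g2 e2 (@pdeg_pcat_op _ g2).
- rewrite B0_word_size; apply: injective_projections; rewrite raddfD raddfMz raddf_sum /=.
    rewrite (_ : \sum_(p <- _) _ = - N%:Z); last first.
      transitivity (- (size (B0_word N))%:Z); last by rewrite B0_word_size.
      elim: (B0_word N) B0_word_letter => [|p w IH] /=.
        by rewrite big_nil.
      case/andP=> /eqP/letterP[b [i ->]] /IH; rewrite big_cons => ->.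
      by rewrite /pdeg /= addr0 intS opprD.
    by rewrite intz /B0_maslovV /=; lia.
  rewrite mul0rz addr0 /alexV /= big_add1 big_mkord /B0_word.
  rewrite (perm_big _ (permEl (perm_rev _))) big_map big_enum; apply: eq_bigr => i _.
  by rewrite /pdeg /= addr0.
- move=> x w hx kw; rewrite B0_word_size => sw.
  by apply: (B0_koszul_degree (c := 3)) hx kw _ => //; lia.
- by move=> x w hx; rewrite B0_word_size; apply: B0_unit hx.
have [[muL _] _] := dmu.
exists mu; split=> //; last by move=> a sa; apply: smu; rewrite B0_word_size.
split.
  apply: (homog_graded (B := B) (e := 1)) => //; first by move=> n; rewrite intz.
  by apply: (homog_map (phi := fst) _ _ _ hmu).
apply: (homog_graded (B := B) (e := 0)) => //; first by move=> n; rewrite mul0rz.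
by apply: (homog_map (phi := snd) _ _ _ hmu).
Qed.

End B0.

Theorem proposition5p1 (N : nat) (hN : (2 < N)%N) :
  (exists2 mu : seq (A0 N) -> A0 N, A0_deformation mu &
     forall nu : seq (A0 N) -> A0 N, A0_deformation nu -> ainf_isomorphic mu nu)
  /\
  (exists2 mu : seq (B0 N) -> B0 N, B0_deformation mu &
     forall nu : seq (B0 N) -> B0 N, B0_deformation nu -> ainf_isomorphic mu nu).
Proof.
split.
  have [mu dmu] := A0_exists hN; exists mu => // nu dnu.
  exact: A0_unique hN _ _ dmu dnu.
have [mu dmu] := B0_exists hN; exists mu => // nu dnu.
exact: B0_unique hN _ _ dmu dnu.
Qed.
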